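(* Let $s$ be a fixed positive integer and let $\varepsilon>0$ be a fixed real number. Let $p$ be a prime and let $H,M$ be positive integers such that $$H^{24/17}M^{11/17}>p^{1+\varepsilon},\qquad H^{9/5}M^{2/5}>p^{1+\varepsilon},\qquad H^{6/5}M>p^{1+\varepsilon}.$$ Let $\mathcal H=\{1,\ldots,H\}$, let $\mathcal M_i\subseteq\mathbb F_p^*$, $i=1,\ldots,6$, be any sets with $\#\mathcal M_i=M$, let $L_1,\ldots,L_6$ be integers such that $L_i+\mathcal H=\{L_i+1,\ldots,L_i+H\}\subseteq\{1,\ldots,p-1\}$ for $i=1,\ldots,6$, and let $\lambda$ be an integer. Then the number $T_6(\lambda)$ of solutions of the congruence $$\frac{m_1}{x_1^s}+\frac{m_2}{x_2^s}+\frac{m_3}{x_3^s}+\frac{m_4}{x_4^s}+\frac{m_5}{x_5^s}+\frac{m_6}{x_6^s}\equiv\lambda \pmod p,\qquad m_i\in\mathcal M_i,\ x_i\in L_i+\mathcal H,\ i=1,\ldots,6,$$ satisfies $$T_6(\lambda)=\frac{H^6M^6}{p}\left(1+O(p^{-\delta})\right),$$ where $\delta>0$ depends only on $s$ and $\varepsilon$.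
   Context: $p$ is a (large) prime, $\mathbb F_p$ is the field of residue classes modulo $p$, and $\mathbb F_p^*$ is its set of non-zero elements. Division in the congruence is in $\mathbb F_p$. $U=O(V)$ means $|U|\le cV$ for some constant $c>0$; here $c$ may depend only on $s$ and $\varepsilon$ (it is uniform in $p$, $H$, $M$, $\mathcal M_i$, $L_i$ and $\lambda$). *)

(* Defs.v *)
From mathcomp Require Import all_boot all_order all_algebra.
From mathcomp Require Import all_classical all_reals all_analysis.

Set Implicit Arguments.
Unset Strict Implicit.
Unset Printing Implicit Defensive.

Import Order.TTheory GRing.Theory Num.Theory.

Local Open Scope ring_scope.

(* The integer x_i in L_i + {1, ..., H} is encoded by h i : 'I_H through
   x_i = L_i + h_i + 1; the ordinal h_i ranges over {0, ..., H - 1}. *)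
Definition shifted (H : nat) (L : 'I_6 -> int) (h : {ffun 'I_6 -> 'I_H})
  (i : 'I_6) : int := L i + (h i).+1%:Z.

Definition T6 (p s H : nat) (A : 'I_6 -> {set 'F_p}) (L : 'I_6 -> int)
  (lambda : int) : nat :=
  #|[set mh : {ffun 'I_6 -> 'F_p} * {ffun 'I_6 -> 'I_H} |
      [forall i, mh.1 i \in A i] &&
      (\sum_(i < 6) mh.1 i / (shifted L mh.2 i)%:~R ^+ s
         == lambda%:~R :> 'F_p)]|.

(* Main.v *)
Require Import Defs.
From mathcomp Require Import all_boot all_order all_algebra.
From mathcomp Require Import all_classical all_reals all_analysis.
From mathcomp Require Import fintype finset perm complex zify ring lra.

(** Let [S_i(a)] be the sum of [e(a m / x^s)] over [m] in the [i]-th set and [x] in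
    the [i]-th interval, and [f_i = |S_i| / (M H)]. By orthogonality,
    [p T6 - (M H)^6] is the sum over [a != 0] of a unimodular factor times
    [S_1(a) ... S_6(a)], so that the relative error is at most the sum over [i] and
    [a != 0] of [f_i(a)^6] ([T6_error_le]). It is enough to save a power of [p] in
    this sixth moment for one set [A] of [M] elements and one interval. Write
    [H = p^h] and [M = p^m], and ignore divisor functions and logarithms.

    The source of the saving is a bound for multiplicative energy ([energy_le]).
    Fix [B] of size [min (p^(1/4), p/H)]. For a set [X] of residues and an interval
    of length [n] between [B] and [p/B], the equation [a x^s = a' y^s] with [a], [a']
    in [X] and [x], [y] in the interval has at most [n |X| (1 + |X|/B)] solutions.
    By Thue's lemma each ratio [x/y] is, up to sign, a reduced fraction with terms
    below the square root of [p], and a fraction of height [T] occurs about [n/T]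
    times if [T <= B], and at most about [n/B] times otherwise. The energy is
    thereby at most a sum over fractions [u/v] of height up to [B] of the number of
    [a] in [X] with [a (u/v)^s] in [X], with weight [n/T]. This sum is bounded by
    comparing scales: Cauchy-Schwarz bounds the square of the sum over [u, v <= T] by the
    sum over [u, v <= T^2], whereas grouping by reduced fractions shows that the
    latter is at most [T^2] times the weighted sum one started from, up to a term
    [T^2 |X|^2/B] ([height_sum_le]).

    Energy enters twice. By Parseval the second moment of [f] is an energy of [A].
    Exchanging the roles of [A] and of a set [Y] of frequencies gives
    [(sum over Y of f)^2 <= Q |Y| (1 + |Y|/B)] with [Q = p/(M H)]. Hence fewer than
    [B] frequencies have [f^2 > 2Q/B]; the sum of [f^2] over those is about [Q] at
    most, and the others are controlled by the threshold and by the second moment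
    ([sum_pow6_le]). What remains is a pointwise bound for [f^4].

    For [H] up to about [p^(2/3)] it comes from the sixth moment of the sums of
    [e(b/x^s)] over the interval, that is, from the number of solutions of
    [1/x1^s + 1/x2^s + 1/x3^s = 1/y1^s + 1/y2^s + 1/y3^s]. Shifting [x] by products
    [u v] with [u, v <= H^(1/2)] and writing [x + u v = v (x/v + u)] leads to the
    same equation among six translates of one point [x/v]. A sum of
    negative powers with distinct poles has few zeros, so that for most [x/v] only
    the trivial solutions remain ([moment6_coincidences_le]).

    For larger [H], up to [p^(19/25)], the incomplete sum is expanded into complete
    sums with frequencies [c]. These are cut into blocks of length [p/H]; in a block
    the products [m c^s] have few coincidences, again by the energy bound, and a
    fourth moment of complete sums finishes the estimate ([power_sum_average_le]).
    The fourth moment only needs the number of zeros of polynomials. For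
    the longest intervals the fourth moment of the incomplete sums alone is small
    ([long_range_le]). Comparing the exponents in the three ranges is linear
    arithmetic in [h] and [m]. *)

Set Implicit Arguments.
Unset Strict Implicit.
Unset Printing Implicit Defensive.

Import Order.TTheory GRing.Theory Num.Theory.

Local Open Scope ring_scope.

(** * Divisors and harmonic sums *)

Lemma succ_exp_le_exp2 (k e : nat) : (0 < k)%N -> (e.+1 ^ k <= k ^ k * 2 ^ e)%N.
Proof.
move=> k0; set q := (e %/ k)%N.
have le_e : (e.+1 <= k * 2 ^ q)%N.
  apply: (@leq_trans (k * q.+1)%N); first by rewrite mulnC ltn_ceil.
  by rewrite leq_mul2l ltn_expl ?orbT.
apply: (@leq_trans ((k * 2 ^ q) ^ k)%N); first by rewrite leq_exp2r.
by rewrite expnMn -expnM leq_mul2l leq_exp2l // leq_divM orbT.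
Qed.

(** The step of [divisors], which adjoins the powers of one prime to the list
    built so far; it makes the number of divisors multiplicative along
    [prime_decomp]. *)
Lemma size_add_divisors (f : nat * nat) (divs : seq nat) :
  size (PrimeDecompAux.add_divisors f divs) = (f.2.+1 * size divs)%N.
Proof.
case: f => q e /=; elim: e => [|e IHe]; first by rewrite mul1n.
by rewrite iterS size_merge size_cat size_map IHe -mulSnr.
Qed.

(** Compare [(e + 1) ^ k] with [q ^ e] at each prime power [q ^ e] of the
    factorisation. The former is at most the latter once [q >= 2 ^ k], and
    exceeds it by a factor of at most [k ^ k] at the fewer than [2 ^ k] smaller
    primes. *)
Lemma divisors_bound (k : nat) : (0 < k)%N ->
  exists C : nat, (0 < C)%N /\
    forall n, (0 < n)%N -> (size (divisors n) ^ k <= C * n)%N.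
Proof.
move=> k0; exists ((k ^ k) ^ (2 ^ k))%N; split; first by rewrite !expn_gt0 k0.
move=> n n0; rewrite [X in (_ <= _ * X)%N]prod_prime_decomp // /divisors.
have Hc : (count (fun f : nat * nat => f.1 < 2 ^ k) (prime_decomp n) <= 2 ^ k)%N.
  rewrite -(count_map fst (fun q => (q < 2 ^ k)%N)) -size_filter.
  rewrite -[X in (_ <= X)%N](size_iota 0); apply: uniq_leq_size.
    by apply: filter_uniq; exact: primes_uniq.
  by move=> q; rewrite mem_filter mem_iota add0n => /andP[].
apply: (@leq_trans
  ((k ^ k) ^ count (fun f : nat * nat => (f.1 < 2 ^ k)%N) (prime_decomp n)
   * \prod_(f <- prime_decomp n) f.1 ^ f.2)%N); last first.
  by rewrite leq_mul2r leq_pexp2l ?orbT // expn_gt0 k0.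
have : all (fun f : nat * nat => (1 < f.1)%N) (prime_decomp n).
  apply/allP => -[q e] /mem_prime_decomp[qp _ _]; exact: prime_gt1.
elim: (prime_decomp n) => [|[q e] l IHl] /=; first by rewrite big_nil exp1n.
move=> /andP[q1 /IHl {}IHl].
rewrite big_cons; have /= -> := size_add_divisors (q, e) (foldr PrimeDecompAux.add_divisors [:: 1%N] l).
rewrite expnMn expnD.
rewrite mulnACA leq_mul //.
have [q_small|q_large] := ltnP q (2 ^ k).
  apply: leq_trans (succ_exp_le_exp2 e k0) _.
  by rewrite expn1 leq_mul2l; case: e => [|e]; rewrite ?orbT ?leq_exp2r ?q1 ?orbT.
rewrite expn0 mul1n; apply: (@leq_trans ((2 ^ e) ^ k)%N).
  by rewrite leq_exp2r // ltn_expl.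
by rewrite -expnM mulnC expnM; case: e => [|e] //; rewrite leq_exp2r.
Qed.

Lemma trunc_log_bound (k n : nat) : (0 < k)%N -> (0 < n)%N ->
  ((trunc_log 2 n).+1 ^ k <= k ^ k * n)%N.
Proof.
move=> k0 n0; apply: leq_trans (succ_exp_le_exp2 _ k0) _.
by rewrite leq_mul2l trunc_logP ?orbT.
Qed.

Lemma harmonic_le_log (R : realFieldType) (n : nat) :
  \sum_(i < n) (i.+1%:R : R)^-1 <= (trunc_log 2 n).+1%:R.
Proof.
have [m] := ubnP n; elim: m n => // m IHm [|[|n]] nm.
- by rewrite big_ord0 ler0n.
- by rewrite big_ord1 invr1 trunc_log1.
set k := n.+2; have kE : (k = k./2 + (k - k./2))%N by lia.
rewrite trunc_log2S // -addn1 natrD [in X in X <= _]kE big_split_ord /=.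
apply: lerD; first by apply: IHm; lia.
apply: (@le_trans _ _ (\sum_(i < k - k./2) (k./2.+1%:R : R)^-1)).
  by apply: ler_sum => i _; rewrite lef_pV2 ?posrE ?ltr0n // ler_nat; lia.
rewrite sumr_const card_ord -[_ *+ _]mulr_natr mulrC ler_pdivrMr ?ltr0n //.
by rewrite mul1r ler_nat; lia.
Qed.

(** * Fractions modulo p with small numerator and denominator *)

(** The point [x = L + h + 1] of the interval, as an element of the field. *)
Definition pt (p : nat) (L : int) (i : nat) : 'F_p := (L + i.+1%:Z)%:~R.

Lemma pt_shift (p : nat) (L : int) (i : nat) : pt p L i = pt p L 0 + i%:R.
Proof. by rewrite /pt -[i.+1]add1n PoszD addrA !intrD. Qed.

Lemma exists_sqrtn (n : nat) : exists r, (r ^ 2 <= n < r.+1 ^ 2)%N.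
Proof.
elim: n => [|n [r /andP[r1 r2]]]; first by exists 0%N.
have [h|h] := ltnP n.+1 (r.+1 ^ 2).
  by exists r; rewrite h andbT ltnW.
by exists r.+1; rewrite h /=; nia.
Qed.

Section Fractions.
Variable p : nat.
Hypothesis p_pr : prime p.

Lemma natr_Fp_eq (a b : nat) : ((a%:R == b%:R :> 'F_p) = (a == b %[mod p])).
Proof. by rewrite -val_eqE /= !val_Fp_nat. Qed.

Lemma natr_Fp_eq0 (a : nat) : ((a%:R == 0 :> 'F_p) = (p %| a)%N).
Proof. by have := natr_Fp_eq a 0; rewrite mod0n => ->. Qed.

Lemma natr_Fp_neq0 (a : nat) : (0 < a < p)%N -> a%:R != 0 :> 'F_p.
Proof. by move=> /andP[a0 ap]; rewrite natr_Fp_eq0 gtnNdvd. Qed.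

(** The integers [v i + u j] stay below [2 u n] and are determined modulo [p],
    which leaves few possible values. On one of the lines so obtained [i] is
    determined modulo [u]. *)
Lemma card_line_le (n u v : nat) (g : 'F_p) : coprime u v -> (0 < v <= u)%N ->
  (#|[set ij : 'I_n * 'I_n | (v * ij.1 + u * ij.2)%:R == g]|
    <= (2 * u * n %/ p).+1 * (n %/ u).+1)%N.
Proof.
move=> cuv /andP[v0 vu]; have p0 := prime_gt0 p_pr.
have u0 : (0 < u)%N by apply: leq_trans vu.
set S := [set _ | _].
have bound1 (ij : 'I_n * 'I_n) :
    ((v * ij.1 + u * ij.2) %/ p < (2 * u * n %/ p).+1)%N.
  by rewrite ltnS leq_div2r //; have := ltn_ord ij.1; have := ltn_ord ij.2; nia.
have bound2 (ij : 'I_n * 'I_n) : (ij.1 %/ u < (n %/ u).+1)%N.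
  by rewrite ltnS leq_div2r // ltnW.
pose f ij := (Ordinal (bound1 ij), Ordinal (bound2 ij)).
rewrite -[X in (X * _)%N]card_ord -[X in (_ * X)%N]card_ord -card_prod.
rewrite -(card_in_imset (f := f)); first exact: max_card.
move=> [i j] [i' j']; rewrite !inE /= => /eqP Sij /eqP Sij' [qE iE].
have rE : (v * i + u * j = v * i' + u * j')%N.
  rewrite (divn_eq (v * i + u * j) p) (divn_eq (v * i' + u * j') p) qE.
  by congr (_ + _)%N; apply/eqP; rewrite -natr_Fp_eq Sij Sij'.
have iE' : val i = val i'.
  rewrite /= [LHS](divn_eq _ u) [RHS](divn_eq _ u) iE; congr (_ + _)%N.
  have : (v * i = v * i' %[mod u])%N.
    by rewrite -(modnMDl j (v * i)) -(modnMDl j' (v * i')) ![(_ * u)%N]mulnC addnC rE addnC.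
  have ii' : (i <= i')%N \/ (i' <= i)%N by lia.
  move=> /eqP; case: ii' => ii'.
    rewrite eq_sym eqn_mod_dvd ?leq_mul2l ?ii' ?orbT // -mulnBr Gauss_dvdr //.
    by rewrite -eqn_mod_dvd // => /eqP.
  rewrite eqn_mod_dvd ?leq_mul2l ?ii' ?orbT // -mulnBr Gauss_dvdr //.
  by rewrite -eqn_mod_dvd // => /eqP.
congr (_, _); apply: val_inj => //=.
by move: rE; rewrite iE' => /addnI/eqP; rewrite eqn_pmul2l // => /eqP.
Qed.

(** A box of side [n] meets few of the parallel lines [v x = u y] modulo [p],
    since consecutive ones are spaced by a multiple of [p], and each of them in
    few points, since [u] and [v] are coprime. *)
Lemma card_ratio_le (L : int) (n u v : nat) (sg : bool) :
  coprime u v -> (0 < u)%N -> (0 < v)%N ->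
  (#|[set ij : 'I_n * 'I_n |
       (v%:R * pt p L ij.1 == (-1) ^+ sg * u%:R * pt p L ij.2)%R]|
    <= (2 * maxn u v * n %/ p).+1 * (n %/ maxn u v).+1)%N.
Proof.
have main (g : 'F_p) (u' v' : nat) : coprime u' v' -> (0 < u')%N -> (0 < v')%N ->
  (#|[set ij : 'I_n * 'I_n | (v' * ij.1 + u' * ij.2)%:R == g]|
    <= (2 * maxn u' v' * n %/ p).+1 * (n %/ maxn u' v').+1)%N.
  move=> cuv u0 v0; have [uv|/ltnW vu] := leqP u' v'.
    have cvu : coprime v' u' by rewrite coprime_sym.
    have uv' : (0 < u' <= v')%N by rewrite u0.
    apply: leq_trans (card_line_le n g cvu uv').
    have swK : involutive (fun ij : 'I_n * 'I_n => (ij.2, ij.1)) by case.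
    rewrite -(card_imset _ (inv_inj swK)).
    apply/subset_leq_card/subsetP => x /imsetP[[i j]]; rewrite inE /= => h ->{x}; rewrite inE /=.
    by rewrite addnC.
  by apply: card_line_le => //; rewrite v0.
move=> cuv u0 v0.
case: sg => /=.
  apply: leq_trans (main (- (v%:R + u%:R) * pt p L 0) _ _ cuv u0 v0).
  apply/subset_leq_card/subsetP => -[i j]; rewrite !inE /= => /eqP.
  rewrite (pt_shift p L i) (pt_shift p L j) => h; apply/eqP.
  by rewrite natrD !natrM; apply/eqP; rewrite -subr_eq0; move: h => /eqP; rewrite -subr_eq0 => /eqP h; apply/eqP; rewrite -h; ring.
rewrite expr0 mul1r.
(* Reversing the second coordinate turns [v x = u y] into [v x + u y']
   constant. *)
pose rv (ij : 'I_n * 'I_n) := (ij.1, rev_ord ij.2).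
have rvK : involutive rv by move=> [i j]; rewrite /rv /= rev_ordK.
rewrite -(card_imset _ (inv_inj rvK)).
apply: leq_trans (main ((u%:R - v%:R) * pt p L 0 + (u * n.-1)%:R) _ _ cuv u0 v0).
apply/subset_leq_card/subsetP => x /imsetP[[i j]]; rewrite inE /= => /eqP h ->{x}; rewrite inE /=.
rewrite /= (_ : n - j.+1 = n.-1 - j)%N; last by lia.
rewrite natrD !natrM natrB; last by have := ltn_ord j; lia.
move: h; rewrite (pt_shift p L i) (pt_shift p L j) => /eqP; rewrite -subr_eq0 => /eqP h.
by rewrite -subr_eq0 -h; apply/eqP; ring.
Qed.

(** Thue: of the more than [p] differences [a - lam b] with [a], [b] up to the
    square root of [p], two coincide. *)
Lemma small_fraction (lam : 'F_p) : lam != 0 ->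
  exists u v : nat, exists sg : bool,
    [/\ coprime u v, (0 < u)%N, (0 < v)%N, (maxn u v ^ 2 <= p)%N &
        v%:R * lam = (-1) ^+ sg * u%:R].
Proof.
move=> lam0; have [r /andP[r1 r2]] := exists_sqrtn p; have p1 := prime_gt1 p_pr.
have rp : (r < p)%N by nia.
pose f (ab : 'I_r.+1 * 'I_r.+1) : 'F_p := ab.1%:R - lam * ab.2%:R.
have /injectivePn[[a b] [[a' b'] neq]] : ~~ injectiveb f.
  apply/negP => /injectiveP /card_codom h; have := max_card [in codom f].
  by rewrite h card_Fp // card_prod !card_ord leqNgt mulnn r2.
rewrite /f /= => eqf.
have ba : lam * (b%:R - b'%:R) = a%:R - a'%:R.
  by apply/eqP; rewrite -subr_eq0; move/eqP: eqf; rewrite -subr_eq0 => /eqP h;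
     apply/eqP; rewrite -[RHS]oppr0 -h; ring.
have diff (x y : 'I_r.+1) : exists d : nat, exists sg : bool,
    [/\ (d <= r)%N, (x%:R : 'F_p) - y%:R = (-1) ^+ sg * d%:R & (d == 0%N) = (x == y)].
  have xr := ltn_ord x; have yr := ltn_ord y; have [xy|xy] := leqP x y.
    exists (y - x)%N, true; split; [by lia|by rewrite natrB // expr1; ring|].
    by rewrite -val_eqE /=; apply/eqP/eqP; lia.
  exists (x - y)%N, false; split; [by lia|by rewrite natrB 1?ltnW // expr0; ring|].
  by rewrite -val_eqE /=; apply/eqP/eqP; lia.
have [u [su [ur uE u0]]] := diff a a'; have [v [sv [vr vE v0]]] := diff b b'.
have v_neq0 : v%:R != 0 :> 'F_p.
  apply/eqP => vz; have vp : v = 0%N.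
    apply/eqP; move/eqP: vz; rewrite natr_Fp_eq0; case: (posnP v) => [->//|vp].
    by rewrite gtnNdvd //; lia.
  have bb : b = b' by apply/eqP; rewrite -v0 vp.
  move: ba uE; rewrite bb subrr mulr0 => <- /esym/eqP.
  rewrite mulf_eq0 signr_eq0 natr_Fp_eq0 /=; case: (posnP u) => [uz|up].
    move: neq; rewrite bb; have /eqP -> : a == a' by rewrite -u0 uz.
    by rewrite eqxx.
  by rewrite gtnNdvd //; lia.
have eq1 : v%:R * lam = (-1) ^+ (su (+) sv) * u%:R.
  have uE' : lam * ((-1) ^+ sv * v%:R) = (-1) ^+ su * u%:R by rewrite -vE ba.
  rewrite addbC signr_addb -mulrA -uE' mulrCA
    (mulrA ((-1) ^+ sv)) -signr_addb addbb.
  by rewrite mul1r mulrC.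
have u_neq0 : u%:R != 0 :> 'F_p.
  apply: contra_neq lam0 => uz; move: eq1; rewrite uz mulr0 => /eqP.
  by rewrite mulf_eq0 (negPf v_neq0) => /eqP.
have u1 : (0 < u)%N by case: (u) u_neq0 => //; rewrite eqxx.
have v1 : (0 < v)%N by case: (v) v_neq0 => //; rewrite eqxx.
pose g := gcdn u v; have g0 : (0 < g)%N by rewrite gcdn_gt0 u1.
exists (u %/ g)%N, (v %/ g)%N, (su (+) sv); split.
- by rewrite /coprime -(eqn_pmul2r g0) mul1n muln_gcdl !divnK ?dvdn_gcdl ?dvdn_gcdr.
- by rewrite divn_gt0 // dvdn_leq ?dvdn_gcdl.
- by rewrite divn_gt0 // dvdn_leq ?dvdn_gcdr.
- apply: leq_trans r1; rewrite leq_exp2r // geq_max.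
  by rewrite !(leq_trans (leq_div _ _)).
- have g_neq0 : g%:R != 0 :> 'F_p.
    by rewrite natr_Fp_neq0 // g0 (leq_ltn_trans _ rp) // (leq_trans (dvdn_leq _ (dvdn_gcdl u v))).
  apply: (mulIf g_neq0); rewrite mulrAC -natrM -[RHS]mulrA -natrM.
  by rewrite !divnK ?dvdn_gcdl ?dvdn_gcdr.
Qed.

End Fractions.

(** * Multiplicative shifts of a set *)

Lemma sum_sqr_le (R : realDomainType) (I : finType) (P : pred I) (x y : I -> R) :
  (\sum_(i | P i) x i * y i) ^+ 2 <=
  (\sum_(i | P i) x i ^+ 2) * (\sum_(i | P i) y i ^+ 2).
Proof.
set A := \sum_(i | P i) x i ^+ 2; set B := \sum_(i | P i) y i ^+ 2.
have h : 0 <= \sum_(i | P i) \sum_(j | P j) (x i * y j - x j * y i) ^+ 2.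
  by apply: sumr_ge0 => i _; apply: sumr_ge0 => j _; exact: sqr_ge0.
suff e : \sum_(i | P i) \sum_(j | P j) (x i * y j - x j * y i) ^+ 2 =
    A * B + B * A - 2 * (\sum_(i | P i) x i * y i) ^+ 2 by lra.
rewrite expr2 !big_distrlr /= mulr_sumr -big_split -sumrB.
apply: eq_bigr => i _; rewrite mulr_sumr -big_split -sumrB.
by apply: eq_bigr => j _ /=; ring.
Qed.

Lemma sum_sqr_le_card (I : finType) (A : {set I}) (x : I -> nat) :
  ((\sum_(i in A) x i) ^ 2 <= #|A| * \sum_(i in A) x i ^ 2)%N.
Proof.
have /= := sum_sqr_le (mem A) (fun _ => 1 : int) (fun i => (x i)%:R).
under eq_bigr => i _ do rewrite mul1r.
rewrite expr1n sumr_const => h; rewrite -(ler_nat int) natrX natrM !natr_sum.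
by under [X in _ <= _ * X]eq_bigr => i _ do rewrite natrX.
Qed.

Definition shift_count (F : finFieldType) (A : {set F}) (mu : F) : nat :=
  #|[set a in A | a * mu \in A]|.

Lemma card_root_le (F : finFieldType) (P : {poly F}) (d : nat) :
  P != 0 -> (size P <= d.+1)%N -> (#|[set x | root P x]| <= d)%N.
Proof.
move=> P0 sP; rewrite cardE -ltnS (leq_trans _ sP) //.
apply: max_poly_roots => //; last exact: enum_uniq.
by apply/allP => x; rewrite mem_enum inE.
Qed.

Lemma card_pow_eq_le (F : finFieldType) (s : nat) (c : F) : (0 < s)%N ->
  (#|[set x : F | x ^+ s == c]| <= s)%N.
Proof.
move=> s0; have szP : size ('X^s - c%:P : {poly F}) = s.+1 by rewrite size_XnsubC.
have P0 : 'X^s - c%:P != 0 :> {poly F} by rewrite -size_poly_eq0 szP.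
apply: leq_trans (card_root_le P0 (eq_leq szP)).
by apply/subset_leq_card/subsetP => x; rewrite !inE rootE !hornerE subr_eq0.
Qed.

(** A pair [(a, b)] of elements of [A] is counted once for each [s]-th root of
    [b / a]. *)
Lemma shift_count_pow_sum (F : finFieldType) (A : {set F}) (s : nat) :
  (0 < s)%N -> 0 \notin A ->
  (\sum_(lam : F) shift_count A (lam ^+ s) <= s * #|A| ^ 2)%N.
Proof.
move=> s0 A0; rewrite /shift_count.
have -> : (\sum_(lam : F) #|[set a in A | (a * lam ^+ s)%R \in A]| =
   \sum_(a in A) \sum_(b in A) #|[set lam : F | (lam ^+ s == b / a)%R]|)%N.
  under [LHS]eq_bigr => lam _ do
    rewrite -(sum1dep_card (fun a => (a \in A) && (a * lam ^+ s \in A))).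
  rewrite (exchange_big_dep (mem A)) /=; last by move=> lam a _ /andP[].
  apply: eq_bigr => a aA; have a0 : a != 0 by apply: contraNneq A0 => <-.
  under [RHS]eq_bigr => b _ do
    rewrite -(sum1dep_card (fun lam => lam ^+ s == b / a)).
  rewrite (exchange_big_dep predT) //=.
  rewrite [LHS]big_mkcond /=; apply: eq_bigr => lam _; rewrite aA /=.
  case: ifP => h.
    rewrite (big_pred1 (a * lam ^+ s)) // => b /=.
    rewrite eq_sym -(inj_eq (mulIf a0)) divfK // [_ * a]mulrC.
    by case: eqP => [->|/eqP/negPf]; rewrite ?h ?andbT ?andbF // => ->.
  rewrite big_pred0 // => b /=; rewrite -(inj_eq (mulIf a0)) divfK //.
  by rewrite [_ * a]mulrC; case: eqP => [<-|]; rewrite ?h ?andbF.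
apply: (@leq_trans (\sum_(a in A) \sum_(b in A) s)); last first.
  by rewrite !sum_nat_const; lia.
by apply: leq_sum => a _; apply: leq_sum => b _; exact: card_pow_eq_le.
Qed.

(** * Energy along small fractions *)

Lemma shift_countE (F : finFieldType) (A : {set F}) (mu : F) :
  shift_count A mu = (\sum_(a in A) ((a * mu)%R \in A))%N.
Proof.
rewrite /shift_count -(sum1dep_card (fun a => (a \in A) && (a * mu \in A))).
by rewrite big_mkcondr; apply: eq_bigr => a _; case: (_ \in A).
Qed.

(** Walking from [a] to [a r1] and to [a r2] inside [A] is the same as starting
    from [a r1] and multiplying by the quotient of the two ratios. *)
Lemma shift_count_pair_le (F : finFieldType) (A : {set F}) (r1 r2 : F) : r1 != 0 ->
  (#|[set a in A | ((a * r1)%R \in A) && ((a * r2)%R \in A)]| <= shift_count A (r2 / r1)%R)%N.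
Proof.
move=> r10; rewrite -(card_imset _ (mulIf r10)); apply/subset_leq_card/subsetP.
move=> b /imsetP[a]; rewrite inE => /and3P[aA ar1 ar2] ->.
by rewrite inE ar1 /= mulrA mulrAC mulfK.
Qed.

Section Bootstrap.
Variables (p s : nat) (A : {set 'F_p}).
Hypotheses (p_pr : prime p) (s0 : (0 < s)%N) (A0 : 0 \notin A).

Definition in_box (T : nat) (w : 'I_p * 'I_p) : bool :=
  (0 < w.1 <= T)%N && (0 < w.2 <= T)%N.

Definition ratio (w : 'I_p * 'I_p) : 'F_p := (val w.1)%:R / (val w.2)%:R.

(** A sum over all pairs, coprime or not: this is what makes products of pairs
    easy to handle. *)
Definition ratio_energy (T : nat) : nat :=
  \sum_(w | in_box T w) shift_count A (ratio w ^+ s).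

Lemma ord_neq0 (i : 'I_p) : (0 < i)%N -> (val i)%:R != 0 :> 'F_p.
Proof. by move=> i0; rewrite natr_Fp_neq0 // i0 ltn_ord. Qed.

Lemma in_box_neq0 T w : in_box T w ->
  (val w.1)%:R != 0 :> 'F_p /\ (val w.2)%:R != 0 :> 'F_p.
Proof. by move=> /andP[/andP[? _] /andP[? _]]; split; apply: ord_neq0. Qed.

Lemma ratio_neq0 T w : in_box T w -> ratio w != 0.
Proof. by move=> /in_box_neq0[? ?]; rewrite mulf_neq0 ?invr_eq0. Qed.

(** A number has at most [tau] factorisations. *)
Lemma sum_product_le (tau T : nat) (G : nat -> nat) :
  (T ^ 2 < p)%N ->
  (forall n, (0 < n <= T ^ 2)%N -> (size (divisors n) <= tau)%N) ->
  (\sum_(w : 'I_p * 'I_p | in_box T w) G (w.1 * w.2)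
    <= tau * \sum_(n : 'I_p | 0 < n <= T ^ 2) G n)%N.
Proof.
move=> Tp htau.
have -> : (\sum_(w : 'I_p * 'I_p | in_box T w) G (w.1 * w.2) =
    \sum_(n : 'I_p | 0 < n <= T ^ 2)
      \sum_(w : 'I_p * 'I_p | in_box T w && (w.1 * w.2 == n)) G n)%N.
  have lt_p w : in_box T w -> (w.1 * w.2 < p)%N.
    move=> /andP[/andP[_ h1] /andP[_ h2]]; apply: leq_ltn_trans Tp.
    by rewrite -mulnn leq_mul.
  rewrite (exchange_big_dep (in_box T)) /=; last by move=> n w _ /andP[].
  apply: eq_bigr => w bw; rewrite (big_pred1 (Ordinal (lt_p w bw))) //= => n.
  rewrite bw /= -val_eqE /= [LHS]andbC eq_sym; case: eqP => //= ->.
  case/andP: bw => /andP[h1 h2] /andP[h3 h4].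
  by rewrite muln_gt0 h1 h3 -mulnn leq_mul.
rewrite big_distrr /=; apply: leq_sum => n hn.
rewrite sum_nat_const leq_mul2r; apply/orP; right.
apply: leq_trans (htau _ hn).
rewrite cardE -(size_map (fun w : 'I_p * 'I_p => val w.1)); apply: uniq_leq_size.
  rewrite map_inj_in_uniq ?enum_uniq // => w w'; rewrite !mem_enum !unfold_in.
  move=> /andP[/andP[/andP[w0 _] _] /eqP h] /andP[_ /eqP h'] e.
  case: w w' w0 h h' e => [x y] [x' y'] /= x0 h h' e.
  have xx : x = x' by apply: val_inj.
  subst x'; congr (_, _); apply: val_inj; apply/eqP.
  by rewrite -(eqn_pmul2l x0) h h'.
move=> d /mapP[w]; rewrite mem_enum unfold_in => /andP[_ /eqP h] ->.
by rewrite -dvdn_divisors -?h ?dvdn_mulr // h; case/andP: hn.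
Qed.

(** By the Cauchy-Schwarz inequality over [a], a pair of ratios both leading
    from [a] into [A] is replaced by their quotient. The numerator and the
    denominator of the quotient are products of two numbers up to [T], so each
    of them is hit at most [tau] times. *)
Lemma ratio_energy_sqr_le (tau T : nat) :
  (T ^ 2 < p)%N ->
  (forall n, (0 < n <= T ^ 2)%N -> (size (divisors n) <= tau)%N) ->
  (ratio_energy T ^ 2 <= #|A| * (tau ^ 2 * ratio_energy (T ^ 2)))%N.
Proof.
move=> Tp htau.
pose r w := ratio w ^+ s.
have -> : ratio_energy T = (\sum_(a in A) \sum_(w | in_box T w) ((a * r w)%R \in A))%N.
  rewrite /ratio_energy exchange_big /=; apply: eq_bigr => w _.
  exact: shift_countE.
apply: leq_trans (sum_sqr_le_card _ _) _; rewrite leq_mul2l; apply/orP; right.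
pose G n m := shift_count A ((n%:R / m%:R) ^+ s).
apply: (@leq_trans (\sum_(w | in_box T w) \sum_(w' : 'I_p * 'I_p | in_box T w')
    G (w'.1 * w.2) (w'.2 * w.1))%N).
  under eq_bigr => a _ do rewrite -mulnn big_distrlr /=.
  rewrite exchange_big /=; apply: leq_sum => w bw.
  rewrite exchange_big /=; apply: leq_sum => w' bw'.
  have rw0 : r w != 0 by rewrite expf_neq0 // (ratio_neq0 bw).
  have [w10 w20] := in_box_neq0 bw; have [w10' w20'] := in_box_neq0 bw'.
  apply: (@leq_trans (shift_count A (r w' / r w)%R)).
    apply: leq_trans (shift_count_pair_le A (r w') rw0).
    rewrite -sum1_card big_mkcond [X in (_ <= X)%N]big_mkcond /=.
    apply: leq_sum => a _; rewrite inE; case: (a \in A) => //=.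
    by rewrite mulnb; case: (_ && _).
  rewrite /G /r -expr_div_n /ratio !natrM invf_div.
  by rewrite mulf_div [X in _ / X]mulrC.
have -> : (\sum_(w | in_box T w) \sum_(w' : 'I_p * 'I_p | in_box T w')
      G (w'.1 * w.2) (w'.2 * w.1) =
    \sum_(q | in_box T q) \sum_(q' : 'I_p * 'I_p | in_box T q')
      G (q.1 * q.2) (q'.1 * q'.2))%N.
  rewrite !pair_big /=.
  rewrite (reindex (fun z : ('I_p * 'I_p) * ('I_p * 'I_p) =>
    ((z.2.2, z.1.2), (z.1.1, z.2.1)))) /=; last first.
    exists (fun z => ((z.2.1, z.1.2), (z.2.2, z.1.1))).
      by move=> [[? ?] [? ?]].
    by move=> [[? ?] [? ?]].
  apply: eq_bigl => -[[a b] [c d]]; rewrite /in_box /=.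
  case: (0 < a <= T)%N; case: (0 < b <= T)%N; case: (0 < c <= T)%N;
    by case: (0 < d <= T)%N.
apply: (@leq_trans (\sum_(q | in_box T q)
    tau * \sum_(m : 'I_p | 0 < m <= T ^ 2) G (q.1 * q.2) m)%N).
  by apply: leq_sum => q _; exact: sum_product_le.
rewrite -big_distrr /= -mulnn -mulnA leq_mul2l exchange_big /=.
apply/orP; right.
apply: (@leq_trans (\sum_(m : 'I_p | 0 < m <= T ^ 2)
    tau * \sum_(n : 'I_p | 0 < n <= T ^ 2) G n m)%N).
  by apply: leq_sum => m _; exact: (sum_product_le (fun n => G n m)).
rewrite -big_distrr /= leq_mul2l exchange_big pair_big /=; apply/orP; right.
exact: leqnn.
Qed.

End Bootstrap.

Lemma coprime_cross_eq (a b c d : nat) : coprime a b -> coprime c d ->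
  (a * d = c * b)%N -> a = c /\ b = d.
Proof.
move=> cab ccd e.
have ac : a = c.
  apply/eqP; rewrite eqn_dvd; apply/andP; split.
    by rewrite -(Gauss_dvdl c cab) -e dvdn_mulr.
  by rewrite -(Gauss_dvdl a ccd) e dvdn_mulr.
split=> //; subst c; have [a0|a0] := posnP a; last first.
  by apply/eqP; rewrite eq_sym -(eqn_pmul2l a0) e.
by move: cab ccd; rewrite a0 /coprime !gcd0n => /eqP -> /eqP ->.
Qed.

(** Summation by parts for weights [1 / m] (the sum of [1 / (t (t + 1))]
    telescopes). *)
Lemma telescope_inv (R : realFieldType) (m B : nat) : (0 < m)%N -> (m <= B)%N ->
  (m%:R : R)^-1 =
  \sum_(t < B | (m <= t.+1)%N) (t.+1%:R * t.+2%:R)^-1 + B.+1%:R^-1.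
Proof.
move=> m0; elim: B => [|B IHB]; first by rewrite leqNgt m0.
have fr : B.+1%:R^-1 = (B.+1%:R * B.+2%:R)^-1 + B.+2%:R^-1 :> R.
  have gen (b : R) : 0 < b -> b^-1 = (b * (b + 1))^-1 + (b + 1)^-1.
    by move=> b0; field; apply/andP; split; apply: lt0r_neq0; lra.
  by rewrite -[B.+2]addn1 natrD; apply: gen; rewrite ltr0n.
rewrite leq_eqVlt => /orP[/eqP ->|mB].
  rewrite big_mkcond big_ord_recr /= leqnn big1 ?add0r // => t _.
  by rewrite leqNgt ltnS ltn_ord.
rewrite IHB // big_mkcond [in RHS]big_mkcond big_ord_recr /= (ltnW mB).
by rewrite -addrA -fr.
Qed.

Section HeightSum.
Variables (R : realFieldType) (p s : nat) (A : {set 'F_p}).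
Hypotheses (p_pr : prime p) (s0 : (0 < s)%N) (A0 : 0 \notin A).

Notation F w := (shift_count A (ratio w ^+ s)).
Notation ht w := (maxn w.1 w.2).

(** The energy of [A] along fractions, with the weight [1 / T] for height [T]:
    this is how often a fraction of height [T] is the ratio of two points of an
    interval, up to the length. *)
Definition height_sum (B : nat) : R :=
  \sum_(w : 'I_p * 'I_p | in_box B w) (F w)%:R / (ht w)%:R.

Lemma ratio_inj_coprime (Y : nat) (w w' : 'I_p * 'I_p) : (Y ^ 2 < p)%N ->
  in_box Y w -> in_box Y w' -> coprime w.1 w.2 -> coprime w'.1 w'.2 ->
  ratio w = ratio w' -> w = w'.
Proof.
move=> Yp bw bw' cw cw' /eqP.
have [_ w2] := in_box_neq0 p_pr bw; have [_ w2'] := in_box_neq0 p_pr bw'.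
rewrite /ratio eqr_div // -!natrM natr_Fp_eq // !modn_small; last 2 first.
- case/andP: bw' => /andP[_ h1] _; case/andP: bw => _ /andP[_ h2].
  by apply: leq_ltn_trans Yp; rewrite -mulnn leq_mul.
- case/andP: bw => /andP[_ h1] _; case/andP: bw' => _ /andP[_ h2].
  by apply: leq_ltn_trans Yp; rewrite -mulnn leq_mul.
move=> /eqP /(coprime_cross_eq cw cw')[].
by case: w w' {cw cw' bw bw' w2 w2'} => [a b] [c d] /= /val_inj -> /val_inj ->.
Qed.

(** Distinct reduced fractions with terms up to [Y] stay distinct modulo [p], so
    they cannot collect more than all the ratios together. *)
Lemma coprime_box_sum (Y : nat) : (Y ^ 2 < p)%N ->
  (\sum_(w | in_box Y w && coprime w.1 w.2) F w <= s * #|A| ^ 2)%N.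
Proof.
move=> Yp; apply: leq_trans (shift_count_pow_sum s0 A0).
pose S := [set w : 'I_p * 'I_p | in_box Y w && coprime w.1 w.2].
rewrite (eq_bigl [in S]); last by move=> w; rewrite /= inE.
rewrite -(big_imset (fun lam => shift_count A (lam ^+ s)) (h := @ratio p)) /=.
  by rewrite [X in (_ <= X)%N](bigID (mem (@ratio p @: S))) /= leq_addr.
move=> w w'; rewrite !inE => /andP[bw cw] /andP[bw' cw'].
exact: ratio_inj_coprime Yp bw bw' cw cw'.
Qed.

Lemma card_multiples_le (Y : nat) (w : 'I_p * 'I_p) :
  in_box Y w -> coprime w.1 w.2 ->
  (#|[set w' : 'I_p * 'I_p | in_box Y w' && (w.1 * w'.2 == w'.1 * w.2)]| <= Y %/ ht w)%N.
Proof.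
move=> /andP[/andP[w1 _] /andP[w2 _]] cw.
have mult (w' : 'I_p * 'I_p) : (w.1 * w'.2 == w'.1 * w.2)%N ->
    w'.1 = (w'.1 %/ w.1 * w.1)%N :> nat /\ w'.2 = (w'.1 %/ w.1 * w.2)%N :> nat.
  move=> /eqP e; have d : (w.1 %| w'.1)%N by rewrite -(Gauss_dvdl _ cw) -e dvdn_mulr.
  rewrite divnK //; split => //; apply/eqP; rewrite -(eqn_pmul2l w1) e.
  by rewrite mulnA [(w.1 * _)%N]mulnC divnK.
rewrite -[X in (_ <= X)%N](size_iota 1) cardE.
rewrite -(size_map (fun w' : 'I_p * 'I_p => w'.1 %/ w.1)%N); apply: uniq_leq_size.
  rewrite map_inj_in_uniq ?enum_uniq // => x y; rewrite !mem_enum !inE.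
  move=> /andP[_ /mult[x1 x2]] /andP[_ /mult[y1 y2]] e.
  case: x y x1 x2 y1 y2 e => [x x'] [y y'] /= x1 x2 y1 y2 e.
  have xy : x = y by apply: val_inj; rewrite /= [LHS]x1 [RHS]y1 e.
  have xy' : x' = y' by apply: val_inj; rewrite /= [LHS]x2 [RHS]y2 e.
  by rewrite xy xy'.
move=> g /mapP[x]; rewrite mem_enum inE => /andP[bx /mult[x1 x2]] ->.
case/andP: bx => /andP[h1 h2] /andP[h3 h4].
rewrite mem_iota add1n ltnS divn_gt0 // leq_divRL; last by rewrite leq_max w1.
rewrite maxnMr geq_max -x1 -x2 h2 h4 !andbT.
by apply: dvdn_leq => //; rewrite x1 dvdn_mull.
Qed.

(** Grouping pairs by their reduced fraction turns the energy into a sum over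
    fractions weighted by the inverse height. Fractions of height beyond [B]
    have weight at most [1 / B], and are controlled by the number of pairs in
    [A]. *)
Lemma ratio_energy_le_height_sum (Y B : nat) : (0 < B)%N -> (Y ^ 2 < p)%N ->
  (ratio_energy s A Y)%:R <=
    Y%:R * (height_sum B + s%:R * #|A|%:R ^+ 2 / B%:R) :> R.
Proof.
move=> B0 Yp.
pose S := [pred w : 'I_p * 'I_p | in_box Y w && coprime w.1 w.2].
have reduced : (ratio_energy s A Y <= \sum_(w in S) F w * (Y %/ ht w))%N.
  apply: (@leq_trans (\sum_(w' | in_box Y w')
     \sum_(w in S | w.1 * w'.2 == w'.1 * w.2) F w)%N).
    apply: leq_sum => w' bw'; have [w10 w20] := in_box_neq0 p_pr bw'.
    case/andP: (bw') => /andP[h1 h2] /andP[h3 h4].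
    pose g := gcdn w'.1 w'.2; have g0 : (0 < g)%N by rewrite gcdn_gt0 h1.
    have lt1 : (w'.1 %/ g < p)%N by rewrite (leq_ltn_trans (leq_div _ _)).
    have lt2 : (w'.2 %/ g < p)%N by rewrite (leq_ltn_trans (leq_div _ _)).
    pose w := (Ordinal lt1, Ordinal lt2).
    have cross : (w.1 * w'.2 = w'.1 * w.2)%N.
      apply/eqP; rewrite -(eqn_pmul2r g0) /= mulnAC divnK ?dvdn_gcdl //.
      by rewrite -mulnA divnK ?dvdn_gcdr.
    have Sw : w \in S.
      rewrite inE; apply/andP; split; last first.
        by rewrite /coprime -(eqn_pmul2r g0) mul1n muln_gcdl /= !divnK ?dvdn_gcdl ?dvdn_gcdr.
      rewrite /in_box /= (leq_trans (leq_div _ _) h2) (leq_trans (leq_div _ _) h4).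
      rewrite !andbT divn_gt0 // divn_gt0 //.
      by apply/andP; split; apply: dvdn_leq; rewrite // ?dvdn_gcdl ?dvdn_gcdr.
    rewrite (bigD1 w) /=; last by rewrite cross eqxx andbT; exact: Sw.
    apply: leq_trans (leq_addr _ _); rewrite leq_eqVlt; apply/orP; left; apply/eqP.
    congr (shift_count A (_ ^+ s)); apply/eqP; rewrite /ratio eqr_div //; last first.
      by case/andP: Sw => /(in_box_neq0 p_pr)[].
    by rewrite -!natrM cross.
  rewrite (exchange_big_dep (mem S)) /=; last by move=> w' w _ /andP[].
  apply: leq_sum => w Sw; case/andP: (Sw) => bw cw.
  rewrite sum_nat_const mulnC leq_mul2l; apply/orP; right.
  apply: leq_trans (card_multiples_le bw cw); apply/subset_leq_card/subsetP.
  by move=> w'; rewrite !inE unfold_in => /and3P[-> _ ->].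
apply: (@le_trans _ _ (Y%:R * \sum_(w in S) (F w)%:R / (ht w)%:R)).
  rewrite (le_trans (_ : _ <= (\sum_(w in S) F w * (Y %/ ht w))%:R)) ?ler_nat //.
  rewrite natr_sum mulr_sumr; apply: ler_sum => w /andP[/andP[/andP[w1 _] _] _].
  have ht0 : 0 < (ht w)%:R :> R by rewrite ltr0n leq_max w1.
  rewrite natrM mulrCA ler_wpM2l ?ler0n // ler_pdivlMr // -natrM ler_nat.
  exact: leq_divM.
rewrite ler_wpM2l ?ler0n // (bigID (fun w : 'I_p * 'I_p => (ht w <= B)%N)) /=.
apply: lerD.
  rewrite /height_sum [X in _ <= X](bigID (mem S)) /= [X in X <= _]big_mkcond
    [X in _ <= X + _]big_mkcond /=.
  apply: ler_wpDr.
    by apply: sumr_ge0 => w _; rewrite divr_ge0 ?ler0n.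
  apply: ler_sum => w _; rewrite !inE /in_box geq_max.
  case: (0 < w.1)%N => //=; case: (0 < w.2)%N; rewrite ?andbF //=.
  by case: (w.1 <= Y)%N; case: (w.2 <= Y)%N; case: (w.1 <= B)%N; case: (w.2 <= B)%N;
    case: (coprime w.1 w.2) => //=; rewrite divr_ge0 ?ler0n.
apply: (@le_trans _ _ (\sum_(w in S) (F w)%:R / B%:R)).
  rewrite big_mkcondr /=; apply: ler_sum => w _; case: ifP => [|_].
    rewrite -ltnNge => hB; rewrite ler_wpM2l ?ler0n // lef_pV2 ?posrE ?ltr0n //.
      by rewrite ler_nat ltnW.
    by apply: leq_trans hB.
  by rewrite divr_ge0 ?ler0n.
rewrite -mulr_suml ler_wpM2r ?invr_ge0 ?ler0n // -natr_sum -natrX -natrM ler_nat.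
exact: coprime_box_sum.
Qed.

(** Summation by parts in the height: a fraction has height at most [t] when it
    occurs in the energy at scale [t]. *)
Lemma height_sum_le_max (B : nat) (G : R) :
  (forall t, (0 < t <= B)%N -> (ratio_energy s A t)%:R <= G * t%:R) ->
  0 <= G ->
  height_sum B <= G * \sum_(i < B.+1) (i.+1%:R)^-1.
Proof.
move=> hG G0.
have -> : height_sum B =
    \sum_(t < B) (ratio_energy s A t.+1)%:R / (t.+1%:R * t.+2%:R)
    + (ratio_energy s A B)%:R / B.+1%:R.
  have box_ht (t : nat) (w : 'I_p * 'I_p) :
      in_box t w = [&& (0 < w.1)%N, (0 < w.2)%N & (ht w <= t)%N].
    rewrite /in_box geq_max; case: (0 < w.1)%N; case: (0 < w.2)%N => //=.
    by rewrite andbF.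
  under [X in _ = X + _]eq_bigr => t _ do
    rewrite /ratio_energy natr_sum mulr_suml.
  rewrite (exchange_big_dep (in_box B)) /=; last first.
    move=> t w _; rewrite !box_ht => /and3P[-> -> /=] /leq_trans; apply.
    exact: ltn_ord.
  rewrite /ratio_energy natr_sum mulr_suml -big_split /=; apply: eq_bigr => w bw.
  move: (bw); rewrite box_ht => /and3P[w1 w2 hB].
  rewrite (@telescope_inv R (ht w) B) ?leq_max ?w1 // mulrDr mulr_sumr.
  by congr (_ + _); apply: eq_bigl => t; rewrite box_ht w1 w2.
rewrite big_ord_recl invr1 mulrDr mulr1 addrC; apply: lerD.
  have [->|B0] := posnP B.
    rewrite /ratio_energy big1 ?mul0r // => w /andP[/andP[w1]].
    by rewrite leqNgt w1.
  rewrite ler_pdivrMr ?ltr0n // (le_trans (hG B _)) ?B0 ?leqnn //.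
  by rewrite ler_wpM2l // ler_nat.
rewrite mulr_sumr; apply: ler_sum => t _.
have t1 : 0 < t.+1%:R :> R by rewrite ltr0n.
have t2 : 0 < t.+2%:R :> R by rewrite ltr0n.
rewrite invfM mulrA ler_pM2r ?invr_gt0 // ler_pdivrMr //.
by apply: hG; rewrite ltn_ord.
Qed.

(** Let [G] be the largest value of energy over scale, attained at [T <= B].
    Squaring the energy at scale [T] leads to scale [T ^ 2], where regrouping by
    reduced fractions gives a bound that is again linear in [G]. Hence [G ^ 2]
    is bounded by a linear function of [G]. *)
Lemma height_sum_le (tau B : nat) (L : R) :
  (0 < B)%N -> (B ^ 4 < p)%N -> (0 < tau)%N ->
  (forall n, (0 < n <= B ^ 2)%N -> (size (divisors n) <= tau)%N) ->
  1 <= L -> \sum_(i < B.+1) (i.+1%:R)^-1 <= L ->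
  height_sum B <=
    L * (tau%:R ^+ 2 * (L + s%:R) * (#|A|%:R + #|A|%:R ^+ 2 / B%:R)).
Proof.
move=> B0 Bp tau0 htau L1 harmL.
pose e (t : 'I_B) : R := (ratio_energy s A t.+1)%:R / t.+1%:R.
have [T _ maxT] := @arg_maxP _ _ _ (Ordinal B0) xpredT e isT.
set G := e T; set a : R := #|A|%:R; set K := (X in L * X).
have a0 : 0 <= a by rewrite ler0n.
have G0 : 0 <= G by rewrite divr_ge0 ?ler0n.
have hG t : (0 < t <= B)%N -> (ratio_energy s A t)%:R <= G * t%:R.
  case: t => // t tB; have := maxT (Ordinal tB) isT.
  by rewrite /e /= ler_pdivrMr ?ltr0n.
have HS : height_sum B <= G * L.
  by apply: le_trans (height_sum_le_max hG G0) _; rewrite ler_wpM2l.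
have TB : (T.+1 <= B)%N := ltn_ord T.
have Tp : ((T.+1 ^ 2) ^ 2 < p)%N by apply: leq_ltn_trans Bp; rewrite -expnM leq_exp2r.
have T2p : (T.+1 ^ 2 < p)%N by apply: leq_ltn_trans Tp; rewrite -[X in (X <= _)%N]expn1 leq_pexp2l // expn_gt0.
have htauT n : (0 < n <= T.+1 ^ 2)%N -> (size (divisors n) <= tau)%N.
  by move=> /andP[n0 nT]; apply: htau; rewrite n0 (leq_trans nT) // leq_exp2r.
have sq : G ^+ 2 <= a * tau%:R ^+ 2 * (G * L + s%:R * a ^+ 2 / B%:R).
  have Tpos : 0 < T.+1%:R ^+ 2 :> R by rewrite exprn_gt0 // ltr0n.
  have GT : G * T.+1%:R = (ratio_energy s A T.+1)%:R by rewrite divfK ?pnatr_eq0.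
  rewrite -(ler_pM2r Tpos) -exprMn GT.
  have := ratio_energy_sqr_le s A p_pr T2p htauT; rewrite -(ler_nat R).
  rewrite natrX natrM natrM natrX => /le_trans; apply.
  rewrite [X in X <= _]mulrA -[X in _ <= X]mulrA; apply: ler_wpM2l.
    by rewrite mulr_ge0 // exprn_ge0 ?ler0n.
  apply: le_trans (ratio_energy_le_height_sum B0 Tp) _.
  by rewrite natrX mulrC ler_wpM2r ?exprn_ge0 ?ler0n // lerD2r.
suff GK : G <= K.
  by apply: le_trans HS _; rewrite mulrC ler_wpM2l // (le_trans ler01).
have L0 : 0 <= L by apply: le_trans L1.
have t1 : 1 <= tau%:R ^+ 2 :> R by rewrite exprn_ege1 // ler1n.
have s_ge0 : 0 <= s%:R :> R by rewrite ler0n.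
have b0 : 0 <= a ^+ 2 / B%:R by rewrite divr_ge0 ?exprn_ge0 ?ler0n.
rewrite leNgt; apply/negP => KG.
have aK : a <= K.
  rewrite /K -/a; set t := tau%:R ^+ 2 in t1 *; set b := _ / _ in b0 *.
  have : 1 <= t * (L + s%:R) by nra.
  nra.
move: sq; rewrite /K -/a in KG aK *.
set t := tau%:R ^+ 2 in t1 KG aK *; rewrite -[s%:R * _ / _]mulrA.
set b := _ / _ in b0 KG aK *; set S := s%:R in s_ge0 KG aK *; move=> sq.
have t0 : 0 <= t by apply: le_trans t1.
have aG : a <= G := le_trans aK (ltW KG).
have h1 : 0 <= t * S * b * (G - a).
  by apply: mulr_ge0; [do 2 apply: mulr_ge0 => // | rewrite subr_ge0].
have h2 : 0 <= t * S * a * G by do 3 apply: mulr_ge0 => //.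
have h3 : 0 <= t * L * b * G by do 3 apply: mulr_ge0 => //.
have : G * (t * (L + S) * (a + b)) < G * G.
  by rewrite ltr_pM2l // (le_lt_trans _ KG) // (le_trans a0).
rewrite -expr2; nra.
Qed.

End HeightSum.

(** * Multiplicative energy of a set against an interval *)

(** The number of solutions of [a x ^+ s = a' y ^+ s] with [a], [a'] in [A] and
    [x], [y] in the interval, by [coincidences_times_power]. *)
Definition energy (p : nat) (A : {set 'F_p}) (s : nat) (L : int) (n : nat) : nat :=
  \sum_(i < n) \sum_(j < n) shift_count A ((pt p L i / pt p L j) ^+ s).

Section Energy.
Variables (R : realFieldType) (p s : nat) (L : int) (n B : nat).
Hypotheses (p_pr : prime p) (s0 : (0 < s)%N).
Hypothesis pt_neq0 : forall i, (i < n)%N -> pt p L i != 0.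
Hypotheses (B0 : (0 < B)%N) (Bn : (B <= n)%N) (Bnp : (B * n <= p)%N) (Bp : (B ^ 4 < p)%N).

Notation ht w := (maxn w.1 w.2).
Notation N lam := #|[set ij : 'I_n * 'I_n | (pt p L ij.1 / pt p L ij.2 == lam)%R]|.

(** By Thue every [lam] is a fraction of height at most the square root of [p];
    a ratio of height [T] is attained about [n / T] times when [T <= B] and at
    most about [n / B] times otherwise. *)
Lemma ratio_count_le (lam : 'F_p) :
  (N lam)%:R <= 8 * n%:R * (B%:R^-1 + \sum_(w : 'I_p * 'I_p | in_box B w)
    ((ratio w == lam)%:R + (- ratio w == lam)%:R) / (ht w)%:R) :> R.
Proof.
have pR : 0 < p%:R :> R by rewrite ltr0n prime_gt0.
have BR : 0 < B%:R :> R by rewrite ltr0n.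
have nR : 0 < n%:R :> R by rewrite ltr0n (leq_trans B0).
have BnR : B%:R <= n%:R :> R by rewrite ler_nat.
have BnpR : B%:R * n%:R <= p%:R :> R by rewrite -natrM ler_nat.
have sum_ge0 : 0 <= \sum_(w : 'I_p * 'I_p | in_box B w)
    ((ratio w == lam)%:R + (- ratio w == lam)%:R) / (ht w)%:R :> R.
  by apply: sumr_ge0 => w _; rewrite divr_ge0 ?addr_ge0 ?ler0n.
have [lam0|lam0] := eqVneq lam 0.
  rewrite (_ : N lam = 0)%N ?mulr_ge0 ?addr_ge0 ?invr_ge0 ?ler0n //.
  apply/eqP; rewrite cards_eq0; apply/eqP/setP => -[i j]; rewrite !inE lam0 /=.
  by rewrite mulf_eq0 invr_eq0 !(negPf (pt_neq0 _)).
have [u [v [sg [cuv u0 v0 Tp lamE]]]] := small_fraction p_pr lam0.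
set T := maxn u v in Tp *.
have T0 : (0 < T)%N by rewrite leq_max u0.
have TR : 0 < T%:R :> R by rewrite ltr0n.
have TpR : T%:R * T%:R <= p%:R :> R by rewrite -natrM ler_nat mulnn.
have vF0 : v%:R != 0 :> 'F_p.
  rewrite natr_Fp_neq0 // v0 (leq_ltn_trans (leq_maxr u v)) // -/T.
  have := prime_gt1 p_pr; rewrite -mulnn in Tp; nia.
have NR : (N lam)%:R <= (2 * T%:R * n%:R / p%:R + 1) * (n%:R / T%:R + 1) :> R.
  apply: (@le_trans _ _ ((2 * T * n %/ p).+1 * (n %/ T).+1)%:R).
    rewrite ler_nat; apply: leq_trans (card_ratio_le p_pr L n sg cuv u0 v0).
    apply/subset_leq_card/subsetP => -[i j]; rewrite !inE /= => /eqP e.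
    by rewrite -lamE -e -!mulrA mulVf ?mulr1 // pt_neq0.
  rewrite natrM; apply: ler_pM; rewrite ?ler0n // -addn1 natrD lerD2r.
    by rewrite ler_pdivlMr // -natrM -!natrM ler_nat leq_divM.
  by rewrite ler_pdivlMr // -natrM ler_nat leq_divM.
have [TB|BT] := leqP T B.
  have TBR : T%:R <= B%:R :> R by rewrite ler_nat.
  have Bltp : (B < p)%N by rewrite (leq_ltn_trans _ Bp) // -[X in (X <= _)%N]expn1 leq_pexp2l.
  have ult : (u < p)%N by rewrite (leq_ltn_trans (leq_maxl u v)) // (leq_ltn_trans TB).
  have vlt : (v < p)%N by rewrite (leq_ltn_trans (leq_maxr u v)) // (leq_ltn_trans TB).
  pose w := (Ordinal ult, Ordinal vlt).
  have bw : in_box B w.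
    rewrite /in_box /= u0 v0 (leq_trans (leq_maxl u v)) //.
    by rewrite (leq_trans (leq_maxr u v)).
  have lamw : (1 : R) <= (ratio w == lam)%:R + (- ratio w == lam)%:R.
    have lamE' : lam = (-1) ^+ sg * ratio w.
      by rewrite /ratio /= mulrA -lamE mulrC mulrA mulVf ?mul1r.
    case: sg lamE' {lamE NR} => /= ->.
      by rewrite mulN1r eqxx lerDr ler0n.
    by rewrite mul1r eqxx lerDl ler0n.
  apply: le_trans NR _; apply: (@le_trans _ _ (8 * n%:R * T%:R^-1)).
    have h1 : 2 * T%:R * n%:R / p%:R <= 2 :> R.
      have : T%:R * n%:R <= B%:R * n%:R :> R by rewrite ler_wpM2r // ltW.
      by rewrite ler_pdivrMr // -mulrA ler_pM2l // => h; apply: le_trans h _.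
    have h2 : 1 <= n%:R / T%:R :> R.
      by rewrite ler_pdivlMr // mul1r; apply: le_trans BnR.
    rewrite -[X in _ <= X]mulrA; set x := n%:R / T%:R in h2 *.
    have x1 : 0 <= x + 1 by lra.
    have : (2 * T%:R * n%:R / p%:R + 1) * (x + 1) <= 3 * (x + 1).
      by rewrite ler_wpM2r //; lra.
    by move=> /le_trans; apply; lra.
  rewrite ler_wpM2l ?mulr_ge0 ?ler0n // ler_wpDl ?invr_ge0 ?ler0n //.
  rewrite (bigD1 w) //= -/T; apply: ler_wpDr.
    by apply: sumr_ge0 => w' _; rewrite divr_ge0 ?addr_ge0 ?ler0n.
  by rewrite -[X in X <= _]mul1r ler_wpM2r // invr_ge0 ler0n.
have BTR : B%:R <= T%:R :> R by rewrite ler_nat ltnW.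
apply: le_trans NR _; apply: (@le_trans _ _ (8 * n%:R * B%:R^-1)); last first.
  by rewrite ler_wpM2l ?mulr_ge0 ?ler0n // lerDl.
rewrite -[X in _ <= X]mulrA; set y := n%:R / B%:R.
have h1 : n%:R / p%:R * n%:R <= y :> R.
  rewrite /y mulrAC ler_pdivrMr // mulrAC ler_pdivlMr // -mulrA.
  by apply: ler_wpM2l; [exact: ltW | rewrite mulrC].
have h2 : T%:R * n%:R / p%:R <= y :> R.
  rewrite /y ler_pdivrMr // mulrAC ler_pdivlMr //.
  have : B%:R * T%:R <= p%:R :> R by apply: le_trans TpR; rewrite ler_wpM2r // ltW.
  by move=> /(ler_wpM2l (ltW nR)) h; lra.
have h3 : n%:R / T%:R <= y :> R by rewrite ler_wpM2l ?ler0n // lef_pV2 ?posrE.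
have h4 : 1 <= y by rewrite ler_pdivlMr // mul1r.
have -> : (2 * T%:R * n%:R / p%:R + 1) * (n%:R / T%:R + 1) =
   2 * (n%:R / p%:R * n%:R) + 2 * (T%:R * n%:R / p%:R) + n%:R / T%:R + 1 :> R.
  by field; rewrite !gt_eqF.
lra.
Qed.

Lemma energy_fiber (A : {set 'F_p}) :
  energy A s L n = (\sum_(lam : 'F_p) N lam * shift_count A (lam ^+ s)%R)%N.
Proof.
rewrite /energy pair_big /=.
rewrite (partition_big (fun ij : 'I_n * 'I_n => pt p L ij.1 / pt p L ij.2) predT) //=.
apply: eq_bigr => lam _; rewrite -sum_nat_const big_mkcond [RHS]big_mkcond /=.
by apply: eq_bigr => ij _; rewrite inE; case: eqP => // ->.
Qed.

(** Symmetry of [A] absorbs the sign in Thue's lemma. *)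
Lemma energy_le_height_sum (A : {set 'F_p}) : 0 \notin A ->
  (forall a, a \in A -> - a \in A) ->
  (energy A s L n)%:R <=
    8 * n%:R * (s%:R * #|A|%:R ^+ 2 / B%:R + 2 * height_sum R s A B) :> R.
Proof.
move=> A0 symA.
have symF mu : shift_count A (- mu) = shift_count A mu.
  rewrite /shift_count; congr #|pred_of_set _|; apply/setP => a; rewrite !inE mulrN.
  by congr (_ && _); apply/idP/idP => /symA; rewrite ?opprK.
rewrite energy_fiber natr_sum.
pose c : R := 8 * n%:R; have c0 : 0 <= c by rewrite mulr_ge0 ?ler0n.
apply: (@le_trans _ _ (\sum_(lam : 'F_p) c * (B%:R^-1 + \sum_(w : 'I_p * 'I_p | in_box B w)
    ((ratio w == lam)%:R + (- ratio w == lam)%:R) / (ht w)%:R) *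
    (shift_count A (lam ^+ s))%:R)).
  by apply: ler_sum => lam _; rewrite natrM ler_wpM2r ?ler0n // ratio_count_le.
under eq_bigr => lam _ do rewrite -mulrA mulrDl mulr_suml.
rewrite -mulr_sumr -/c ler_wpM2l // big_split /= -mulr_sumr; apply: lerD.
  rewrite mulrC ler_wpM2r ?invr_ge0 ?ler0n // -natr_sum -natrX -natrM ler_nat.
  exact: shift_count_pow_sum.
rewrite exchange_big /= /height_sum mulr_sumr; apply: ler_sum => w _.
rewrite (_ : \sum_lam _ = \sum_(lam : 'F_p)
    ((ratio w == lam)%:R * ((shift_count A (lam ^+ s))%:R / (ht w)%:R) +
    (- ratio w == lam)%:R * ((shift_count A (lam ^+ s))%:R / (ht w)%:R))); last first.
  by apply: eq_bigr => lam _; ring.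
rewrite big_split /=.
have pick (mu : 'F_p) (g : 'F_p -> R) : \sum_(lam : 'F_p) (mu == lam)%:R * g lam = g mu.
  rewrite (bigD1 mu) //= eqxx mul1r big1 ?addr0 // => lam.
  by rewrite eq_sym => /negPf ->; rewrite mul0r.
rewrite !pick exprNn.
have -> : shift_count A ((-1) ^+ s * ratio w ^+ s) = shift_count A (ratio w ^+ s).
  by rewrite -signr_odd; case: (odd s); rewrite ?expr0 ?mul1r // expr1 mulN1r symF.
have dbl (z : R) : z + z <= 2 * z by lra.
exact: dbl.
Qed.

Lemma shift_count_mono (A A' : {set 'F_p}) mu : A \subset A' ->
  (shift_count A mu <= shift_count A' mu)%N.
Proof.
move=> /subsetP sAA; apply/subset_leq_card/subsetP => a; rewrite !inE.
by move=> /andP[/sAA -> /sAA].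
Qed.

(** The set is first made symmetric, at the cost of a factor 2 in its size. Up
    to divisors and logarithms the result is the number [n #|A|] of diagonal
    solutions as long as [#|A| <= B]. *)
Lemma energy_le (A : {set 'F_p}) (tau : nat) (l : R) : 0 \notin A ->
  (0 < tau)%N ->
  (forall m, (0 < m <= B ^ 2)%N -> (size (divisors m) <= tau)%N) ->
  1 <= l -> \sum_(i < B.+1) (i.+1%:R)^-1 <= l ->
  (energy A s L n)%:R <=
    96 * n%:R * (l * (tau%:R ^+ 2 * (l + s%:R) * (#|A|%:R + #|A|%:R ^+ 2 / B%:R))).
Proof.
move=> A0 tau0 htau l1 hl.
pose A' := A :|: [set - a | a in A].
have A'0 : 0 \notin A'.
  rewrite inE negb_or A0; apply/imsetP => -[a aA /eqP]; rewrite eq_sym oppr_eq0 => /eqP a0.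
  by move: A0; rewrite -a0 aA.
have symA' a : a \in A' -> - a \in A'.
  rewrite !inE => /orP[aA|/imsetP[b bA ->]]; apply/orP.
    by right; apply/imsetP; exists a.
  by left; rewrite opprK.
have cardA' : (#|A'| <= 2 * #|A|)%N.
  by rewrite mul2n -addnn (leq_trans (leq_card_setU _ _)) // leq_add2l leq_imset_card.
have sAA' : A \subset A' by apply/subsetUl.
apply: (@le_trans _ _ (energy A' s L n)%:R).
  by rewrite ler_nat; do 2 apply: leq_sum => ? _; exact: shift_count_mono.
apply: le_trans (energy_le_height_sum A'0 symA') _.
have HS := height_sum_le p_pr s0 A'0 B0 Bp tau0 htau l1 hl.
have BR : 0 < B%:R :> R by rewrite ltr0n.
have a'a : #|A'|%:R <= 2 * #|A|%:R :> R by rewrite -natrM ler_nat.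
have a0 : 0 <= #|A|%:R :> R by rewrite ler0n.
have a'0 : 0 <= #|A'|%:R :> R by rewrite ler0n.
have t1 : 1 <= tau%:R ^+ 2 :> R by rewrite exprn_ege1 // ler1n.
have s_ge0 : 0 <= s%:R :> R by rewrite ler0n.
move: (#|A'|%:R : R) (#|A|%:R : R) a'a a0 a'0 HS => x a xa a0 x0.
move: (height_sum _ _ _ _) => hs HS.
have Bi0 : 0 <= B%:R^-1 :> R by rewrite invr_ge0 ltW.
set b := B%:R^-1 in Bi0 HS *; move: (s%:R : R) s_ge0 HS => S S0 HS.
move: (tau%:R ^+ 2) t1 HS => t t1 HS.
have t0 : 0 <= t by apply: le_trans t1.
have l0 : 0 <= l by apply: le_trans l1.
have bd : x + x ^+ 2 * b <= 4 * (a + a ^+ 2 * b).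
  have : x ^+ 2 * b <= (2 * a) ^+ 2 * b by rewrite ler_wpM2r // ler_pXn2r ?nnegrE ?mulr_ge0.
  by move=> h; lra.
have y0 : 0 <= x + x ^+ 2 * b by rewrite addr_ge0 // mulr_ge0 ?exprn_ge0.
have c0 : 0 <= l * (t * (l + S)) by rewrite !mulr_ge0 ?addr_ge0.
have HS' : hs <= l * (t * (l + S)) * (4 * (a + a ^+ 2 * b)).
  by apply: le_trans HS _; rewrite mulrA ler_wpM2l.
have first : S * x ^+ 2 * b <= l * (t * (l + S)) * (4 * (a + a ^+ 2 * b)).
  apply: (@le_trans _ _ (l * (t * (l + S)) * (x + x ^+ 2 * b))); last by rewrite ler_wpM2l.
  rewrite -mulrA; apply: ler_pM => //; first by rewrite mulr_ge0 ?exprn_ge0.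
    have h1 : 1 * (l + S) <= t * (l + S) by rewrite ler_wpM2r ?addr_ge0.
    have h2 : 1 * (t * (l + S)) <= l * (t * (l + S)) by rewrite ler_wpM2r ?mulr_ge0 ?addr_ge0.
    lra.
  by rewrite lerDr.
have n0 : 0 <= n%:R :> R by rewrite ler0n.
move: (n%:R : R) n0 => m m0.
apply: (@le_trans _ _ (8 * m * (3 * (l * (t * (l + S)) * (4 * (a + a ^+ 2 * b)))))).
  rewrite ler_wpM2l ?mulr_ge0 //; lra.
by rewrite le_eqVlt; apply/orP; left; apply/eqP; ring.
Qed.

End Energy.

(** * Coincidences among the quotients of an interval by small integers *)

Lemma sum_gcd_le (v : nat) : (0 < v)%N ->
  (\sum_(1 <= w < v.+1) gcdn v w <= v * size (divisors v))%N.
Proof.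
move=> v0.
apply: (@leq_trans (\sum_(1 <= w < v.+1) \sum_(d <- divisors v) d * (d %| w))%N).
  rewrite !big_nat; apply: leq_sum => w /andP[w0 _].
  rewrite (big_rem (gcdn v w)) /=; last by rewrite -dvdn_divisors ?dvdn_gcdl.
  by rewrite dvdn_gcdr muln1 leq_addr.
rewrite exchange_big /= -sum1_size big_distrr /= big_seq [X in (_ <= X)%N]big_seq.
apply: leq_sum => d; rewrite -dvdn_divisors // => dv.
by rewrite muln1 -big_distrr /= -divn_count_dvd mulnC divnK.
Qed.

(** By symmetry the larger index may be fixed; then the sum of the gcd is a
    divisor sum. *)
Lemma sum_gcd_max_le (R : realFieldType) (V tau : nat) :
  (forall m, (0 < m <= V)%N -> (size (divisors m) <= tau)%N) ->
  \sum_(v < V) \sum_(w < V) (gcdn v.+1 w.+1)%:R / (maxn v.+1 w.+1)%:R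
    <= 2 * (V * tau)%:R :> R.
Proof.
move=> htau.
have half (v : 'I_V) :
    \sum_(w < V | (w <= v)%N) (gcdn v.+1 w.+1)%:R / v.+1%:R <= tau%:R :> R.
  rewrite -mulr_suml ler_pdivrMr ?ltr0n // -natr_sum -natrM ler_nat.
  apply: (@leq_trans (v.+1 * size (divisors v.+1))%N); last first.
    by rewrite mulnC leq_mul2r htau ?orbT //= ltn_ord.
  apply: leq_trans (sum_gcd_le _) => //.
  rewrite big_add1 /= big_mkord.
  by rewrite (big_ord_widen_cond V xpredT (fun w => gcdn v.+1 w.+1) (ltn_ord v)).
have sym : \sum_(v < V) \sum_(w < V) (gcdn v.+1 w.+1)%:R / (maxn v.+1 w.+1)%:R
  <= \sum_(v < V) \sum_(w < V | (w <= v)%N) (gcdn v.+1 w.+1)%:R / v.+1%:R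
   + \sum_(v < V) \sum_(w < V | (v <= w)%N) (gcdn v.+1 w.+1)%:R / w.+1%:R :> R.
  rewrite -big_split /=; apply: ler_sum => v _.
  rewrite [X in _ <= X + _]big_mkcond [X in _ <= _ + X]big_mkcond -big_split /=.
  apply: ler_sum => w _; have [wv|vw] := leqP w v.
    rewrite (maxn_idPl _) //; case: ifP => _; last by rewrite addr0.
    by rewrite lerDl divr_ge0 ?ler0n.
  by rewrite (ltnW vw) (maxn_idPr _) ?add0r // ltnS ltnW.
apply: le_trans sym _.
rewrite [X in _ + X](exchange_big_dep predT) //= mulr2n mulrDl mul1r.
have bd : \sum_(v < V) \sum_(w < V | (w <= v)%N) (gcdn v.+1 w.+1)%:R / v.+1%:R
    <= (V * tau)%:R :> R.
  apply: (@le_trans _ _ (\sum_(v < V) tau%:R)); first exact: ler_sum.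
  by rewrite sumr_const card_ord -(mulr_natl tau%:R V) natrM lexx.
apply: lerD => //; apply: le_trans bd; apply: ler_sum => v _.
by under eq_bigr => w _ do rewrite gcdnC.
Qed.

(** The number of coincidences among the quotients [x / v] of a point [x] by an
    integer [v <= V]. *)
Definition quotient_energy (p : nat) (L : int) (n V : nat) : nat :=
  \sum_(v < V) \sum_(w < V) #|[set ij : 'I_n * 'I_n |
    (w.+1%:R * pt p L ij.1 == v.+1%:R * pt p L ij.2)%R]|.

(** Reducing [v / w] to lowest terms shows that [x / v = y / w] has about [n
    gcd(v, w) / max(v, w)] solutions. *)
Lemma quotient_energy_le (p : nat) (L : int) (n V tau : nat) : prime p ->
  (V <= n)%N -> (V * n <= p)%N ->
  (forall m, (0 < m <= V)%N -> (size (divisors m) <= tau)%N) ->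
  (quotient_energy p L n V <= 12 * n * (V * tau))%N.
Proof.
move=> p_pr Vn Vnp htau; rewrite -(ler_nat rat) /quotient_energy natr_sum.
apply: (@le_trans _ _ (\sum_(v < V) \sum_(w < V)
    (6 * n)%:R * ((gcdn v.+1 w.+1)%:R / (maxn v.+1 w.+1)%:R))); last first.
  under eq_bigr => v _ do rewrite -mulr_sumr.
  rewrite -mulr_sumr; apply: (@le_trans _ _ ((6 * n)%:R * (2 * (V * tau)%:R))).
    by rewrite ler_wpM2l ?ler0n // sum_gcd_max_le.
  by rewrite -!natrM ler_nat; lia.
apply: ler_sum => v _; rewrite natr_sum; apply: ler_sum => w _.
rewrite mulrA ler_pdivlMr ?ltr0n ?leq_max // -!natrM ler_nat.
set g := gcdn v.+1 w.+1; have g0 : (0 < g)%N by rewrite gcdn_gt0.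
pose a := (v.+1 %/ g)%N; pose b := (w.+1 %/ g)%N.
have va : v.+1 = (a * g)%N by rewrite divnK ?dvdn_gcdl.
have wb : w.+1 = (b * g)%N by rewrite divnK ?dvdn_gcdr.
have a0 : (0 < a)%N by move: va; case: a.
have b0 : (0 < b)%N by move: wb; case: b.
have cab : coprime a b.
  by rewrite /coprime -(eqn_pmul2r g0) mul1n muln_gcdl -va -wb.
rewrite [in maxn _ _]va [in maxn _ _]wb -maxnMl mulnA leq_mul2r; apply/orP; right.
have vV := ltn_ord v; have wV := ltn_ord w; have p1 := prime_gt1 p_pr.
set T := maxn a b.
have TV : (T <= V)%N by rewrite geq_max; nia.
have T0 : (0 < T)%N by rewrite leq_max a0.
have gp : g%:R != 0 :> 'F_p by rewrite natr_Fp_neq0 // g0 /=; nia.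
have := card_ratio_le p_pr L n false cab a0 b0; rewrite -/T => hN.
have hN' : (#|[set ij : 'I_n * 'I_n |
    (w.+1%:R * pt p L ij.1 == v.+1%:R * pt p L ij.2)%R]| <=
    (2 * T * n %/ p).+1 * (n %/ T).+1)%N.
  apply: leq_trans hN; apply/subset_leq_card/subsetP => ij; rewrite !inE.
  rewrite expr0 mul1r va wb !natrM => /eqP h; apply/eqP/(mulIf gp).
  by rewrite mulrAC h mulrAC.
have d1 : (2 * T * n %/ p <= 2)%N.
  by rewrite -ltnS ltn_divLR ?prime_gt0 //; nia.
have d2 : (n %/ T * T <= n)%N := leq_divM n T.
have d3 : (0 < n %/ T)%N by rewrite divn_gt0 // (leq_trans TV).
apply: leq_trans (leq_mul hN' (leqnn T)) _.
apply: (@leq_trans (6 * (n %/ T * T))%N); last by rewrite leq_mul2l d2.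
by rewrite mulnA leq_mul2r (_ : 6 * _ = 3 * (2 * (n %/ T)))%N ?leq_mul ?orbT //; lia.
Qed.

(** * Sums of three negative powers at the points of a translate *)

(** A sum of negative powers with distinct poles cannot vanish identically:
    after clearing denominators it does not vanish at its own poles. *)
Lemma card_pole_sum_le (F : finFieldType) (s : nat) (T : {set F}) (c : F -> F) :
  (0 < s)%N -> (forall t, t \in T -> c t != 0) -> T != set0 ->
  (#|[set x | (\sum_(t in T) c t / (x + t) ^+ s == 0)%R]|
    <= #|T|.-1 * s + #|T|)%N.
Proof.
move=> s0 cT /set0Pn[t0 t0T].
pose Q (t : F) : {poly F} := \prod_(u in T :\ t) ('X + u%:P) ^+ s.
pose P : {poly F} := \sum_(t in T) (c t)%:P * Q t.
have X0 (u : F) : 'X + u%:P != 0 :> {poly F} by rewrite -size_poly_eq0 size_XaddC.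
have szX (u : F) : size (('X + u%:P) ^+ s) = s.+1.
  by rewrite -[LHS]prednK ?size_exp ?size_XaddC ?mul1n // size_poly_gt0 expf_neq0.
have szQ t : t \in T -> (size (Q t) <= (#|T|.-1 * s).+1)%N.
  move=> tT; rewrite size_prod; last by move=> u _; rewrite expf_neq0.
  under eq_bigr => u _ do rewrite szX.
  have arith n : ((n * s.+1).+1 - n <= (n * s).+1)%N by nia.
  by rewrite sum_nat_const (cardsD1 t T) tT; exact: arith.
have P0 : P != 0.
  apply/eqP => /(congr1 (fun q => q.[- t0])); rewrite horner0 /P horner_sum.
  rewrite (bigD1 t0) //= big1 ?addr0 => [|t /andP[tT tt0]].
    move/eqP; rewrite hornerM hornerC mulf_eq0 (negPf (cT _ t0T)) /= horner_prod.
    rewrite prodf_seq_eq0 => /hasP[u _ /andP[]]; rewrite !inE => /andP[ut0 _].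
    rewrite !hornerE expf_eq0 s0 /= addrC subr_eq0.
    by rewrite (negPf ut0).
  rewrite hornerM /Q (bigD1 t0) /=; last by rewrite !inE eq_sym tt0.
  by rewrite !hornerE addNr expr0n (gtn_eqF s0) /= ?mul0r ?mulr0 ?mul0r.
have szP : (size P <= (#|T|.-1 * s).+1)%N.
  apply: leq_trans (size_sum _ _ _) _; apply/bigmax_leqP => t tT.
  rewrite mul_polyC (leq_trans (size_scale_leq _ _)) //; exact: szQ.
apply: (@leq_trans #|[set x | root P x] :|: [set - t | t in T]|).
  apply/subset_leq_card/subsetP => x; rewrite !inE => /eqP hx.
  have [/imsetP[t tT ->]|nx] := boolP (x \in [set - t | t in T]).
    by rewrite orbT.
  have xt t : t \in T -> x + t != 0.
    by move=> tT; apply: contra nx => /eqP/addr0_eq xE; apply/imsetP; exists t; rewrite // -xE opprK.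
  rewrite orbF; apply/eqP; rewrite /P horner_sum.
  transitivity ((\sum_(t in T) c t / (x + t) ^+ s) * \prod_(u in T) (x + u) ^+ s).
    rewrite mulr_suml; apply: eq_bigr => t tT.
    rewrite hornerM hornerC horner_prod (bigD1 t tT) /= mulrA divfK; last first.
      by rewrite expf_neq0 // xt.
    congr (_ * _); apply: eq_big => [u|u _]; first by rewrite !inE andbC.
    by rewrite !hornerE.
  by rewrite hx mul0r.
apply: leq_trans (leq_card_setU _ _) _; apply: leq_add.
  exact: card_root_le.
exact: leq_imset_card.
Qed.

Lemma sum_count_mem (F : finFieldType) (a : seq F) (h : F -> F) :
  \sum_(x <- a) h x = \sum_(t : F) (count_mem t a)%:R * h t.
Proof.
elim: a => [|x a IHa]; first by rewrite big_nil big1 // => t _; rewrite mul0r.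
rewrite big_cons IHa; under [RHS]eq_bigr => t _ do rewrite /= natrD mulrDl.
rewrite big_split /= [in RHS](bigD1 x) //= eqxx mul1r.
rewrite [X in _ = _ + X + _]big1 ?addr0 // => t.
by rewrite eq_sym => /negPf ->; rewrite mul0r.
Qed.

(** The coefficient of [(x + t) ^- s] in the difference of the two sums is the
    difference of two multiplicities, at most 3 in absolute value. As [p > 3],
    it does not vanish for every [t] unless the two triples agree. *)
Lemma card_pole_coincidence_le (p s : nat) (a b : seq 'F_p) : prime p ->
  (3 < p)%N -> (0 < s)%N -> size a = 3%N -> size b = 3%N -> ~~ perm_eq a b ->
  (#|[set x : 'F_p | (\sum_(t <- a) ((x + t) ^+ s)^-1 ==
                      \sum_(t <- b) ((x + t) ^+ s)^-1)%R]| <= 5 * s + 6)%N.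
Proof.
move=> p_pr p3 s0 sa sb npm.
pose c t : 'F_p := (count_mem t a)%:R - (count_mem t b)%:R.
pose T := [set t | c t != 0].
have T0 : T != set0.
  move: npm; rewrite /perm_eq => /allPn[t _ ct]; apply/set0Pn; exists t.
  rewrite inE subr_eq0 natr_Fp_eq // !modn_small //.
    by rewrite (leq_ltn_trans (count_size _ _)) // ?sa ?sb.
  by rewrite (leq_ltn_trans (count_size _ _)) // ?sa ?sb.
have cardT : (#|T| <= 6)%N.
  rewrite cardE; apply: (@leq_trans (size (a ++ b))); last by rewrite size_cat sa sb.
  apply: uniq_leq_size => [|t]; first exact: enum_uniq.
  rewrite mem_enum inE mem_cat; apply: contraR; rewrite negb_or => /andP[ta tb].
  by rewrite /c !(count_memPn _) // subrr.
apply: (@leq_trans (#|T|.-1 * s + #|T|)%N); last first.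
  by apply: leq_add => //; rewrite leq_mul2r -subn1 leq_subLR cardT orbT.
have cT t : t \in T -> c t != 0 by rewrite inE.
apply: leq_trans (card_pole_sum_le s0 cT T0).
apply/subset_leq_card/subsetP => x; rewrite !inE.
rewrite (sum_count_mem a (fun t => ((x + t) ^+ s)^-1)).
rewrite (sum_count_mem b (fun t => ((x + t) ^+ s)^-1)) -subr_eq0 -sumrB.
move=> /eqP h; apply/eqP; rewrite -[RHS]h [RHS](bigID (mem T)) /=.
rewrite [X in _ = _ + X]big1 ?addr0 => [|t].
  by apply: eq_bigr => t _; rewrite mulrBl.
by rewrite inE negbK => /eqP ct; rewrite -mulrBl -/(c t) ct mul0r.
Qed.

Definition sum3 (T : Type) (V : nmodType) (g : T -> V) (t : T * T * T) : V :=
  g t.1.1 + g t.1.2 + g t.2.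

Definition list3 (T : Type) (t : T * T * T) : seq T := [:: t.1.1; t.1.2; t.2].

(** Three items have at most 6 arrangements, even if they repeat. *)
Lemma card_perm3_le (T : finType) (t : T * T * T) :
  (#|[set u | perm_eq (list3 u) (list3 t)]| <= 6)%N.
Proof.
pose t3 : 3.-tuple T := [tuple t.1.1; t.1.2; t.2].
pose l := [seq tval [tuple tnth t3 ((q : 'S_3) i) | i < 3] | q <- enum {perm 'I_3}].
have <- : size l = 6%N by rewrite size_map -cardE card_Sn.
rewrite cardE -(size_map (@list3 T)); apply: uniq_leq_size.
  rewrite map_inj_uniq ?enum_uniq // => -[[a b] c] [[a' b'] c'].
  by rewrite /list3 /= => -[-> -> ->].
move=> r /mapP[u]; rewrite mem_enum inE => pm -> {r}.
have /tuple_permP[q ->] : perm_eq (list3 u) t3 by [].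
by apply: map_f; rewrite mem_enum.
Qed.

(** Averaging over the translate: six points of [xi + {1..U}] with equal sums
    either form the same triple twice, or else [xi] is a zero of a nonzero
    rational function. *)
Lemma sum_translates_le (p s U : nat) (Xi : {set 'F_p}) : prime p -> (3 < p)%N ->
  (0 < s)%N -> (U < p)%N ->
  (\sum_(xi in Xi) #|[set tu : ('I_U * 'I_U * 'I_U) * ('I_U * 'I_U * 'I_U) |
      (sum3 (fun i : 'I_U => ((xi + i.+1%:R) ^+ s)^-1) tu.1 ==
       sum3 (fun i : 'I_U => ((xi + i.+1%:R) ^+ s)^-1) tu.2)%R]|
    <= 6 * #|Xi| * U ^ 3 + (5 * s + 6) * U ^ 6)%N.
Proof.
move=> p_pr p3 s0 Up.
pose I3 := ('I_U * 'I_U * 'I_U)%type.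
pose g (xi : 'F_p) (i : 'I_U) : 'F_p := ((xi + i.+1%:R) ^+ s)^-1.
pose E xi (tu : I3 * I3) := sum3 (g xi) tu.1 == sum3 (g xi) tu.2.
rewrite (_ : \sum_(xi in Xi) _ =
    (\sum_(tu : I3 * I3) #|[set xi in Xi | E xi tu]|)%N); last first.
  under eq_bigr => xi _ do rewrite -(sum1dep_card (E xi)).
  rewrite (exchange_big_dep predT) //=; apply: eq_bigr => tu _.
  by rewrite -(sum1dep_card (fun xi => (xi \in Xi) && E xi tu)).
pose D := [set tu : I3 * I3 | perm_eq (list3 tu.1) (list3 tu.2)].
rewrite (bigID (mem D)) /=; apply: leq_add.
  apply: (@leq_trans (\sum_(tu in D) #|Xi|)%N).
    apply: leq_sum => tu _; apply/subset_leq_card/subsetP => xi.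
    by rewrite inE => /andP[].
  rewrite sum_nat_const mulnAC leq_mul2r; apply/orP; right.
  rewrite -sum1_card; under eq_bigl => tu do rewrite inE.
  rewrite -(pair_big_dep xpredT (fun t u => perm_eq (list3 t) (list3 u)) (fun _ _ => 1%N)) /=.
  rewrite (exchange_big_dep predT) //=.
  apply: (@leq_trans (\sum_(u : I3) 6)%N).
    apply: leq_sum => u _; rewrite (sum1dep_card (fun t : I3 => perm_eq (list3 t) (list3 u))).
    exact: card_perm3_le.
  by rewrite sum_nat_const !card_prod !card_ord mulnC !expnS expn0 muln1 !mulnA.
apply: (@leq_trans (\sum_(tu : I3 * I3) (5 * s + 6))%N); last first.
  by rewrite sum_nat_const !card_prod !card_ord mulnC !expnS expn0 muln1 !mulnA.
rewrite big_mkcond /=; apply: leq_sum => -[t u] _; rewrite inE /=.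
case: ifP => // npm.
pose h (i : 'I_U) : 'F_p := i.+1%:R.
have h_inj : injective h.
  move=> i j /eqP; rewrite /h natr_Fp_eq // !modn_small ?(leq_ltn_trans _ Up) //.
  by move=> /eqP[ij]; apply: val_inj.
have npm' : ~~ perm_eq (map h (list3 t)) (map h (list3 u)).
  by apply: contra npm; apply: perm_map_inj.
have sz3 v : size (map h (list3 v)) = 3%N by [].
apply: leq_trans (card_pole_coincidence_le p_pr p3 s0 (sz3 t) (sz3 u) npm').
apply/subset_leq_card/subsetP => xi; rewrite !inE => /andP[_].
by rewrite /E /sum3 /= !big_cons !big_nil !addr0 !addrA.
Qed.

(** * Additive characters modulo p *)

Notation cabs := Normc.normc.

Section Cabs.
Variable R : realType.
Implicit Types z : R[i].

Lemma cabsE z : `|z| = (cabs z)%:C%C.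
Proof. by case: z => a b; rewrite normc_def. Qed.

Lemma cabs_ge0 z : 0 <= cabs z.
Proof. by case: z => a b; exact: sqrtr_ge0. Qed.

Lemma cabs0 : cabs (0 : R[i]) = 0.
Proof. exact: Normc.normc0. Qed.

Lemma cabs1 : cabs (1 : R[i]) = 1.
Proof. exact: Normc.normc1. Qed.

Lemma cabsX z n : cabs (z ^+ n) = cabs z ^+ n.
Proof. by elim: n => [|n IHn]; rewrite ?cabs1 // !exprS Normc.normcM IHn. Qed.

Lemma cabs_nat n : cabs (n%:R : R[i]) = n%:R.
Proof.
by apply: complexI; rewrite -cabsE normr_nat; rewrite (rmorph_nat (real_complex R)).
Qed.

Lemma cabs_sum (I : Type) (r : seq I) (P : pred I) (f : I -> R[i]) :
  cabs (\sum_(i <- r | P i) f i) <= \sum_(i <- r | P i) cabs (f i).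
Proof.
elim/big_rec2: _ => [|i x y _ le_yx]; first by rewrite cabs0.
by apply: le_trans (le_normcD _ _) _; rewrite lerD2l.
Qed.

Lemma cabs_sqr z : (cabs z ^+ 2)%:C%C = z * z^*%C.
Proof. by rewrite -sqr_normc cabsE rmorphXn. Qed.

Lemma cabs_conj z : cabs z^*%C = cabs z.
Proof. by apply: complexI; rewrite -!cabsE normcJ. Qed.

Lemma cabs_Re z : complex.Re z <= cabs z.
Proof.
case: z => a b /=; apply: le_trans (ler_norm a) _.
by rewrite -sqrtr_sqr ler_wsqrtr // lerDl sqr_ge0.
Qed.

End Cabs.

Section Characters.
Variables (R : realType) (p : nat).
Hypothesis p_pr : prime p.

Definition zeta : R[i] :=
  (cos (2 * pi / p%:R) +i* sin (2 * pi / p%:R))%C.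

(** The additive character [x |-> exp (2 i pi x / p)]. *)
Definition ech (x : 'F_p) : R[i] := zeta ^+ val x.

Let p_gt0 : 0 < p%:R :> R.
Proof. by rewrite ltr0n prime_gt0. Qed.

Lemma zetaX n : zeta ^+ n =
  (cos (n%:R * (2 * pi / p%:R)) +i* sin (n%:R * (2 * pi / p%:R)))%C.
Proof.
rewrite /zeta; move: (2 * pi / p%:R) => al.
elim: n => [|n IHn]; first by rewrite mul0r cos0 sin0.
rewrite exprS IHn -[n.+1]add1n (natrD _ 1 n) mulrDl mul1r cosD sinD.
by congr (_ +i* _)%C; rewrite addrC.
Qed.

Lemma double_pi : 2 * pi = pi + pi :> R.
Proof. by rewrite mulr2n mulrDl mul1r. Qed.

Lemma cos_2pi : cos (2 * pi) = 1 :> R.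
Proof. by rewrite double_pi cosD cospi sinpi mulrNN !mulr1 mulr0 subr0. Qed.

Lemma sin_2pi : sin (2 * pi) = 0 :> R.
Proof. by rewrite double_pi sinD cospi sinpi mulr0 mul0r addr0. Qed.

Lemma zeta_p : zeta ^+ p = 1.
Proof.
by rewrite zetaX mulrC divfK ?gt_eqF // cos_2pi sin_2pi.
Qed.

Lemma cabs_zeta n : cabs (zeta ^+ n) = 1.
Proof. by rewrite zetaX /= cos2Dsin2 sqrtr1. Qed.

Lemma zeta_neq1 : zeta != 1.
Proof.
have p2 : 2 <= p%:R :> R by rewrite ler_nat prime_gt1.
rewrite eq_complex negb_and /=; apply/orP; left.
have pi0 := pi_gt0 R.
have a0 : 0 < 2 * pi / p%:R :> R by rewrite divr_gt0 // mulr_gt0.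
have a1 : 2 * pi / p%:R <= pi :> R by rewrite ler_pdivrMr // mulrC ler_wpM2l // ltW.
rewrite lt_eqF // -[X in _ < X]cos0 ltr_cos // in_itv /= ?lexx ?a1 ?(ltW a0) //.
by rewrite ltW // pi_gt0.
Qed.

Lemma ech_nat (n : nat) : ech n%:R = zeta ^+ n.
Proof. by rewrite /ech /= val_Fp_nat // expr_mod // zeta_p. Qed.

Lemma ech_val (x : 'F_p) : x = (val x)%:R.
Proof. by rewrite natr_Zp. Qed.

Lemma ech0 : ech 0 = 1.
Proof. by rewrite /ech expr0. Qed.

Lemma echD x y : ech (x + y) = ech x * ech y.
Proof. by rewrite [x]ech_val [y]ech_val -natrD !ech_nat exprD. Qed.

Lemma ech_sum (I : Type) (r : seq I) (P : pred I) (f : I -> 'F_p) :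
  ech (\sum_(i <- r | P i) f i) = \prod_(i <- r | P i) ech (f i).
Proof. by elim/big_rec2: _ => [|i x y _ <-]; rewrite ?ech0 ?echD. Qed.

Lemma cabs_ech x : cabs (ech x) = 1.
Proof. exact: cabs_zeta. Qed.

Lemma echN x : ech (- x) = (ech x)^*%C.
Proof.
have e0 : ech x != 0.
  by apply/eqP => e; have := cabs_ech x; rewrite e cabs0 => /eqP; rewrite eq_sym oner_eq0.
apply: (mulfI e0); rewrite -echD subrr ech0 -cabs_sqr cabs_ech expr1n.
by rewrite rmorph1.
Qed.

(** Orthogonality: multiplying the sum by a nontrivial value of the character
    only permutes its terms. *)
Lemma sum_ech (b : 'F_p) : \sum_(x : 'F_p) ech (b * x) = if b == 0 then p%:R else 0.
Proof.
case: eqP => [->|/eqP b0].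
  under eq_bigr => x _ do rewrite mul0r ech0.
  by rewrite sumr_const card_Fp.
rewrite (reindex_inj (mulfI (invr_neq0 b0))) /=.
under eq_bigr => x _ do rewrite mulVKf //.
apply/eqP; have : (\sum_(x : 'F_p) ech x) * (ech 1 - 1) = 0.
  rewrite mulrBr mulr1 mulr_suml (reindex_inj (addIr (-1 : 'F_p))) /=.
  under eq_bigr => x _ do rewrite -echD subrK.
  by rewrite subrr.
move/eqP; rewrite mulf_eq0 subr_eq0 => /orP[//|].
by rewrite -[1 : 'F_p]/(1%:R) ech_nat expr1 (negPf zeta_neq1).
Qed.

(** Orthogonality after expanding the square. The weights [th] are needed for
    sums twisted by another character and for sums over a set of frequencies
    with phases. *)
Lemma parseval (T : finType) (g : T -> 'F_p) (th : T -> R[i]) :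
  (\sum_(b : 'F_p) cabs (\sum_t th t * ech (b * g t)) ^+ 2)%:C%C =
  p%:R * \sum_(t : T) \sum_(u : T | g t == g u) th t * (th u)^*%C.
Proof.
rewrite rmorph_sum /=; under eq_bigr => b _ do rewrite cabs_sqr rmorph_sum /= big_distrlr /=.
rewrite exchange_big /= mulr_sumr; apply: eq_bigr => t _.
rewrite exchange_big /= mulr_sumr [RHS]big_mkcond /=; apply: eq_bigr => u _.
transitivity (\sum_(b : 'F_p) th t * (th u)^*%C * ech ((g t - g u) * b)).
  apply: eq_bigr => b _; rewrite rmorphM /= -echN mulrACA -echD -mulrBr.
  by rewrite [b * _]mulrC.
rewrite -mulr_sumr sum_ech subr_eq0; case: eqP => _; first by rewrite mulrC.
by rewrite mulr0.
Qed.

Definition coincidences (T : finType) (g : T -> 'F_p) : nat :=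
  #|[set tu : T * T | g tu.1 == g tu.2]|.

Lemma coincidencesE (T : finType) (g : T -> 'F_p) :
  coincidences g = (\sum_(t : T) \sum_(u : T | g t == g u) 1)%N.
Proof.
by rewrite pair_big_dep /= (sum1dep_card (fun tu : T * T => g tu.1 == g tu.2)).
Qed.

Lemma parseval_count (T : finType) (g : T -> 'F_p) :
  \sum_(b : 'F_p) cabs (\sum_t ech (b * g t)) ^+ 2 = p%:R * (coincidences g)%:R.
Proof.
apply: complexI; have := parseval g (fun _ => 1).
under [X in X%:C%C = _ -> _]eq_bigr => b _ do under eq_bigr => t _ do rewrite mul1r.
move=> ->; rewrite coincidencesE rmorphM /= !(rmorph_nat (real_complex R)); congr (_ * _).
rewrite natr_sum; apply: eq_bigr => t _; rewrite natr_sum; apply: eq_bigr => u _.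
by rewrite oppr0 mul1r.
Qed.

Lemma parseval_le (T : finType) (g : T -> 'F_p) (th : T -> R[i]) :
  (forall t, cabs (th t) <= 1) ->
  \sum_(b : 'F_p) cabs (\sum_t th t * ech (b * g t)) ^+ 2
    <= p%:R * (coincidences g)%:R.
Proof.
move=> th1; set X := (X in X <= _).
have X0 : 0 <= X by apply: sumr_ge0 => b _; rewrite exprn_ge0 // cabs_ge0.
have -> : X = cabs (X%:C%C) by apply: complexI; rewrite -cabsE ger0_norm // lecR.
rewrite /X parseval Normc.normcM cabs_nat ler_wpM2l ?ler0n //.
apply: le_trans (cabs_sum _ _ _) _; rewrite coincidencesE natr_sum.
apply: ler_sum => t _; apply: le_trans (cabs_sum _ _ _) _; rewrite natr_sum.
apply: ler_sum => u _; rewrite Normc.normcM cabs_conj -[1%:R]mulr1.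
by apply: ler_pM; rewrite ?cabs_ge0.
Qed.

End Characters.

(** * Completion of sums over an interval *)

Section Completion.
Variables (R : realType) (p : nat).
Hypothesis p_pr : prime p.
Notation ech := (@ech R p).
Notation zeta := (zeta R p).

Let p_gt0 : 0 < p%:R :> R.
Proof. by rewrite ltr0n prime_gt0. Qed.

Lemma chord_half (c : nat) : (p <= 4 * c)%N -> (2 * c <= p)%N ->
  1 <= cabs (1 - zeta ^+ c).
Proof.
move=> c4 c2; apply: le_trans (cabs_Re _); rewrite zetaX.
rewrite -[1 - _]/((1 - cos _) +i* (0 - sin _))%C /= lerBrDr gerDl.
have pi0 := pi_gt0 R.
have h : cos (c%:R * (2 * pi / p%:R)) <= cos (pi / 2) :> R.
  have c4R : p%:R <= 4 * c%:R :> R by rewrite -natrM ler_nat.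
  have c2R : 2 * c%:R <= p%:R :> R by rewrite -natrM ler_nat.
  have lo : pi / 2 <= c%:R * (2 * pi / p%:R) :> R.
    rewrite mulrA ler_pdivlMr // mulrAC ler_pdivrMr //.
    by have := ler_wpM2l (ltW pi0) c4R; lra.
  have hi : c%:R * (2 * pi / p%:R) <= pi :> R.
    rewrite mulrA ler_pdivrMr //.
    by have := ler_wpM2l (ltW pi0) c2R; lra.
  by rewrite leNgt ltr_cos -?leNgt // in_itv /=; lra.
by apply: le_trans h _; rewrite cos_pihalf.
Qed.

Lemma chord_mul (c k : nat) : cabs (1 - zeta ^+ (c * k)) <= k%:R * cabs (1 - zeta ^+ c).
Proof.
have -> : 1 - zeta ^+ (c * k) = (1 - zeta ^+ c) * \sum_(i < k) (zeta ^+ c) ^+ i.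
  by rewrite exprM -opprB subrX1 -mulNr opprB.
rewrite Normc.normcM mulrC ler_wpM2r ?cabs_ge0 //.
apply: le_trans (cabs_sum _ _ _) _; under eq_bigr => i _ do rewrite -exprM cabs_zeta.
by rewrite sumr_const card_ord.
Qed.

(** A suitable multiple of the arc lands in the second quarter of the circle,
    where the chord is at least the radius; a multiple of an arc has at most
    that multiple of its chord. *)
Lemma chord_ge (c : nat) : (0 < c)%N -> (2 * c <= p)%N ->
  2 * c%:R / p%:R <= cabs (1 - zeta ^+ c).
Proof.
move=> c0 c2; have cR : 0 < c%:R :> R by rewrite ltr0n.
have c2R : 2 * c%:R <= p%:R :> R by rewrite -natrM ler_nat.
have [c4|c4] := leqP p (4 * c).
  by apply: le_trans (chord_half c4 c2); rewrite ler_pdivrMr // mul1r.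
(* The least [k] with [p <= 4 c k]. *)
pose k := ((p + 4 * c - 1) %/ (4 * c))%N.
have d0 : (0 < 4 * c)%N by lia.
have k1 : (k * (4 * c) <= p + 4 * c - 1)%N := leq_divM _ _.
have k2 : (p + 4 * c - 1 < k.+1 * (4 * c))%N by rewrite ltn_ceil.
have kh : 1 <= cabs (1 - zeta ^+ (c * k)) by apply: chord_half; lia.
have k0 : (0 < k)%N by rewrite divn_gt0 //; lia.
have kR : 0 < k%:R :> R by rewrite ltr0n.
have k3 : 2 * (k%:R * c%:R) <= p%:R :> R by rewrite -!natrM ler_nat; lia.
have := le_trans kh (chord_mul c k); set x := cabs _ => kx.
rewrite ler_pdivrMr //.
have x0 : 0 <= x by exact: cabs_ge0.
have := ler_wpM2l x0 k3; have := ler_wpM2l (ltW cR) kx; lra.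
Qed.

Lemma geometric_le (c n : nat) : (0 < c)%N -> (2 * c <= p)%N ->
  cabs (\sum_(i < n) (zeta ^+ c) ^+ i) <= p%:R / c%:R.
Proof.
move=> c0 c2; have cR : 0 < c%:R :> R by rewrite ltr0n.
have h : cabs (1 - zeta ^+ c) * cabs (\sum_(i < n) (zeta ^+ c) ^+ i) <= 2.
  rewrite -Normc.normcM -opprB mulNr -subrX1 opprB.
  apply: le_trans (le_normcD _ _) _; rewrite normcN cabs1 -exprM cabs_zeta //; lra.
rewrite ler_pdivlMr // mulrC.
have := ler_wpM2r (cabs_ge0 (\sum_(i < n) (zeta ^+ c) ^+ i)) (chord_ge c0 c2).
move=> /le_trans/(_ h); rewrite mulrAC ler_pdivrMr //; lra.
Qed.

Definition interval_sum (L : int) (n : nat) (c : 'F_p) : R[i] :=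
  \sum_(i < n) ech (c * pt p L i).

Lemma interval_sum_le_size L n c : cabs (interval_sum L n c) <= n%:R.
Proof.
apply: le_trans (cabs_sum _ _ _) _; under eq_bigr => i _ do rewrite cabs_ech //.
by rewrite sumr_const card_ord.
Qed.

Lemma interval_sumN L n c : cabs (interval_sum L n (- c)) = cabs (interval_sum L n c).
Proof.
rewrite -[RHS]cabs_conj; congr cabs; rewrite /interval_sum rmorph_sum /=.
by apply: eq_bigr => i _; rewrite mulNr echN.
Qed.

Lemma interval_sum_le L n (c : nat) : (0 < c)%N -> (2 * c <= p)%N ->
  cabs (interval_sum L n c%:R) <= p%:R / c%:R.
Proof.
move=> c0 c2; rewrite /interval_sum.
have -> : \sum_(i < n) ech (c%:R * pt p L i) =
    ech (c%:R * pt p L 0) * \sum_(i < n) (zeta ^+ c) ^+ i.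
  rewrite mulr_sumr; apply: eq_bigr => i _.
  by rewrite pt_shift mulrDr echD // -natrM ech_nat // exprM.
by rewrite Normc.normcM cabs_ech // mul1r geometric_le.
Qed.

(** Generalised Kloosterman sums over the whole field, with the inverse of [0]
    being [0]. *)
Definition Kl (s : nat) (b c : 'F_p) : R[i] := \sum_(x : 'F_p) ech (b / x ^+ s + c * x).

Definition power_sum (s : nat) (L : int) (n : nat) (b : 'F_p) : R[i] :=
  \sum_(i < n) ech (b / pt p L i ^+ s).

(** Fourier expansion of the indicator function of the interval. *)
Lemma completion (s : nat) L n b :
  p%:R * power_sum s L n b = \sum_(c : 'F_p) interval_sum L n (- c) * Kl s b c.
Proof.
under eq_bigr => c _ do rewrite /interval_sum /Kl big_distrlr /=.
rewrite exchange_big /= mulr_sumr; apply: eq_bigr => i _.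
rewrite exchange_big /= (bigD1 (pt p L i)) //= [X in _ + X]big1 ?addr0 => [|x xi].
  under eq_bigr => c _ do rewrite -echD // mulNr addrC addrK.
  by rewrite sumr_const card_Fp // mulr_natl.
transitivity (\sum_(c : 'F_p) ech (b / x ^+ s) * ech ((x - pt p L i) * c)).
  by apply: eq_bigr => c _; rewrite -!echD //; congr (ech _); ring.
by rewrite -mulr_sumr sum_ech // subr_eq0 (negPf xi) mulr0.
Qed.

(** Every residue is congruent to an integer of absolute value at most [p / 2].
    For [p = 2] the residue 1 occurs twice, whence the inequality. *)
Lemma sum_Fp_sym (f : 'F_p -> R) : (forall c, 0 <= f c) ->
  \sum_(c : 'F_p) f c <= f 0 + \sum_(k < p./2) (f k.+1%:R + f (- k.+1%:R)).
Proof.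
move=> f0; pose F k := f k%:R.
have -> : \sum_(c : 'F_p) f c = \sum_(0 <= k < p) F k.
  rewrite -[X in \sum_(0 <= _ < X) _](Fp_cast p_pr) big_mkord; apply: eq_bigr => c _.
  by rewrite /F natr_Zp.
have p1 := prime_gt1 p_pr.
rewrite big_ltn ?prime_gt0 // /F lerD2l big_split /=.
rewrite (@big_cat_nat _ _ _ p./2.+1) //=; [|lia..].
apply: lerD; first by rewrite big_add1 /= big_mkord.
rewrite big_nat_rev /=.
have -> : \sum_(i < p./2) f (- i.+1%:R) = \sum_(1 <= k < p./2.+1) f (- k%:R).
  by rewrite big_add1 /= big_mkord.
apply: (@le_trans _ _ (\sum_(1 <= k < (p - p./2.+1).+1) f (- k%:R))).
  rewrite [X in _ <= X]big_add1 /= [X in _ <= X]big_mkord.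
  rewrite -[X in \sum_(X <= _ < _) _]add0n big_addn big_mkord.
  rewrite le_eqVlt; apply/orP; left; apply/eqP; apply: eq_bigr => i _.
  have ip : (i < p - p./2.+1)%N := ltn_ord i.
  congr f; apply/eqP; rewrite -subr_eq0 opprK -natrD natr_Fp_eq0 //.
  by rewrite (_ : _ + _ = p)%N ?dvdnn //; lia.
have le : ((p - p./2.+1).+1 <= p./2.+1)%N by lia.
rewrite [X in _ <= X](big_cat_nat _ le) //= lerDl.
by apply: sumr_ge0 => k _.
Qed.

End Completion.

(** * Fourth moments of complete sums *)

(** Chebyshev's sum inequality for the similarly ordered [z] and [z ^+ k]. *)
Lemma chebyshev_le (R : realFieldType) (I : finType) (w z : I -> R) (k : nat) :
  (forall i, 0 <= w i) -> (forall i, 0 <= z i) ->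
  (\sum_i w i * z i) * (\sum_i w i * z i ^+ k) <=
  (\sum_i w i) * \sum_i w i * z i ^+ k.+1.
Proof.
move=> w0 z0.
have h : 0 <= \sum_i \sum_j w i * w j * ((z i - z j) * (z i ^+ k - z j ^+ k)).
  apply: sumr_ge0 => i _; apply: sumr_ge0 => j _.
  apply: mulr_ge0; first exact: mulr_ge0.
  have [le_ij|/ltW le_ji] := leP (z i) (z j).
    by rewrite mulr_le0 ?subr_le0 // lerXn2r ?nnegrE.
  by rewrite mulr_ge0 ?subr_ge0 // lerXn2r ?nnegrE.
suff e : \sum_i \sum_j w i * w j * ((z i - z j) * (z i ^+ k - z j ^+ k)) =
    (\sum_i w i * z i ^+ k.+1) * (\sum_i w i) + (\sum_i w i) * (\sum_i w i * z i ^+ k.+1)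
    - ((\sum_i w i * z i) * (\sum_i w i * z i ^+ k)
       + (\sum_i w i * z i ^+ k) * (\sum_i w i * z i)) by lra.
rewrite !big_distrlr /= -!big_split -sumrB.
apply: eq_bigr => i _; rewrite -!big_split -sumrB.
by apply: eq_bigr => j _ /=; rewrite !exprS; ring.
Qed.

Lemma add_pow4_le (R : realFieldType) (x y : R) : (x + y) ^+ 4 <= 8 * (x ^+ 4 + y ^+ 4).
Proof.
have h1 : 0 <= (x - y) ^+ 2 by exact: sqr_ge0.
have h2 : 0 <= (x ^+ 2 - y ^+ 2) ^+ 2 by exact: sqr_ge0.
have h3 : (x + y) ^+ 4 <= 2 * (x ^+ 2 + y ^+ 2) * (2 * (x ^+ 2 + y ^+ 2)).
  rewrite (_ : (x + y) ^+ 4 = (x + y) ^+ 2 * (x + y) ^+ 2); last by ring.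
  have le1 : (x + y) ^+ 2 <= 2 * (x ^+ 2 + y ^+ 2) by lra.
  by apply: ler_pM => //; exact: sqr_ge0.
lra.
Qed.

(** Hoelder's inequality with an integer exponent, by induction through
    [chebyshev_le]. *)
Lemma power_mean_le (R : realFieldType) (I : finType) (w z : I -> R) (k : nat) :
  (forall i, 0 <= w i) -> (forall i, 0 <= z i) ->
  (\sum_i w i * z i) ^+ k.+1 <= (\sum_i w i) ^+ k * \sum_i w i * z i ^+ k.+1.
Proof.
move=> w0 z0; elim: k => [|k IHk]; first by rewrite expr1 expr0 mul1r.
have W0 : 0 <= \sum_i w i by apply: sumr_ge0.
have Z0 : 0 <= \sum_i w i * z i by apply: sumr_ge0 => i _; rewrite mulr_ge0.
rewrite exprS; apply: le_trans (ler_wpM2l Z0 IHk) _.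
rewrite mulrCA [X in _ <= X * _]exprSr -[X in _ <= X]mulrA ler_wpM2l ?exprn_ge0 //.
exact: chebyshev_le.
Qed.

Lemma power_mean_set_le (R : realFieldType) (I : finType) (A : {set I}) (z : I -> R) (k : nat) :
  (forall i, 0 <= z i) ->
  (\sum_(i in A) z i) ^+ k.+1 <= #|A|%:R ^+ k * \sum_(i in A) z i ^+ k.+1.
Proof.
move=> z0; pose w (i : I) : R := if i \in A then 1 else 0.
have w0 i : 0 <= w i by rewrite /w; case: ifP.
have wE (h : I -> R) : \sum_(i in A) h i = \sum_i w i * h i.
  by rewrite big_mkcond; apply: eq_bigr => i _; rewrite /w; case: ifP; rewrite ?mul0r ?mul1r.
have <- : \sum_i w i = #|A|%:R by rewrite /w -big_mkcond /= sumr_const.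
by rewrite !wE; exact: power_mean_le.
Qed.

(** Clearing denominators gives a polynomial equation of degree at most [2 s],
    which is not an identity because [sg ^+ s] is its value at [0]; the poles
    [0] and [sg] add two points. *)
Lemma fibre_le (F : finFieldType) (s : nat) (sg w : F) : (0 < s)%N -> sg != 0 ->
  (#|[set x : F | ((x ^+ s)^-1 + ((sg - x) ^+ s)^-1 == w)%R]| <= 2 * s + 2)%N.
Proof.
move=> s0 sg0.
pose Y : {poly F} := sg%:P - 'X.
pose P : {poly F} := Y ^+ s + 'X^s - w%:P * ('X^s * Y ^+ s).
have szY1 : (size Y <= 2)%N.
  apply: leq_trans (size_polyD _ _) _; rewrite size_polyN size_polyX geq_max andbT.
  exact: leq_trans (size_polyC_leq1 _) _.
have szY : (size (Y ^+ s) <= s.+1)%N.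
  apply: leq_trans (size_exp_leq _ _) _; rewrite ltnS -[X in (_ <= X)%N]mul1n.
  by rewrite leq_mul2r -subn1 leq_subLR addn1 szY1 orbT.
have szP : (size P <= (2 * s).+1)%N.
  rewrite (leq_trans (size_polyD _ _)) // geq_max size_polyN; apply/andP; split.
    rewrite (leq_trans (size_polyD _ _)) // geq_max size_polyXn.
    by rewrite (leq_trans szY) /= ltnS; lia.
  rewrite mul_polyC (leq_trans (size_scale_leq _ _)) //.
  rewrite (leq_trans (size_polyMleq _ _)) // size_polyXn addSn /=.
  by rewrite mul2n -addnn -addnS leq_add2l.
have P0 : P != 0.
  apply/eqP => /(congr1 (fun q => q.[0])).
  rewrite !hornerE expr0n (gtn_eqF s0) /= ?mul0r ?mulr0 ?subr0 ?addr0 => /eqP.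
  by rewrite mul0r subr0 expf_eq0 (negPf sg0) andbF.
pose Z : {set F} := [set 0; sg].
apply: (@leq_trans #|[set x : F | root P x] :|: Z|).
  apply/subset_leq_card/subsetP => x; rewrite !inE => /eqP h.
  have [->|x0] := eqVneq x 0; first by rewrite !orbT.
  have [->|xs] := eqVneq x sg; first by rewrite !orbT.
  rewrite !orbF; apply/eqP; rewrite !hornerE -h.
  have X0 : x ^+ s != 0 by rewrite expf_neq0.
  have Y0 : (sg - x) ^+ s != 0 by rewrite expf_neq0 // subr_eq0 eq_sym.
  have clear_den (u v : F) : u != 0 -> v != 0 -> v + u - (u^-1 + v^-1) * u * v = 0.
    by move=> u0 v0; field; rewrite u0 v0.
  exact: clear_den.
apply: leq_trans (leq_card_setU _ _) _; rewrite leq_add // ?card_root_le //.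
by rewrite cards2; case: (_ == _).
Qed.

Lemma sum_orbit_le (R : realFieldType) (F : finFieldType) (s : nat) (b : F) (f : F -> R) :
  (0 < s)%N -> b != 0 -> (forall y, 0 <= f y) ->
  \sum_(t : F) f (b * t ^+ s) <= s%:R * \sum_(y : F) f y.
Proof.
move=> s0 b0 f0; rewrite (partition_big (fun t => b * t ^+ s) predT) //= mulr_sumr.
apply: ler_sum => y _; rewrite (eq_bigr (fun _ => f y)) => [|t /eqP -> //].
rewrite sumr_const -(mulr_natl (f y) _) ler_wpM2r // ler_nat.
apply: leq_trans (card_pow_eq_le (y / b) s0); apply/subset_leq_card/subsetP => t.
by rewrite unfold_in => /eqP e; rewrite inE -e mulrC mulKf.
Qed.

Section Kloosterman.
Variables (R : realType) (p s : nat).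
Hypotheses (p_pr : prime p) (s0 : (0 < s)%N).
Notation ech := (@ech R p).
Notation Kl := (@Kl R p s).

(** Up to modulus, a Kloosterman sum with [c != 0] depends only on [b c ^+ s]. *)
Definition kap (y : 'F_p) : R := cabs (Kl y 1).

Lemma kap_ge0 y : 0 <= kap y.
Proof. exact: cabs_ge0. Qed.

Lemma Kl_scale (b c t : 'F_p) : t != 0 -> Kl b c = Kl (b * t ^+ s) (c / t).
Proof.
move=> t0; rewrite /Kl (reindex_inj (mulIf (invr_neq0 t0))) /=.
apply: eq_bigr => x _; rewrite expr_div_n invf_div !mulrA; congr (ech _); ring.
Qed.

Lemma cabs_Kl (b c : 'F_p) : c != 0 -> cabs (Kl b c) = kap (b * c ^+ s).
Proof. by move=> c0; rewrite (Kl_scale b c c0) divff. Qed.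

Notation pair_sum := (fun t : 'F_p * 'F_p => t.1 + t.2).
Notation pair_pow := (fun t : 'F_p * 'F_p => (t.1 ^+ s)^-1 + (t.2 ^+ s)^-1).

(** Two pairs with the same sum are determined by one entry each. If the sum is
    nonzero, [fibre_le] leaves few choices for it; only [p] pairs have sum zero. *)
Lemma pair_coincidences_le :
  (#|[set tu : ('F_p * 'F_p) * ('F_p * 'F_p) |
     (pair_pow tu.1 == pair_pow tu.2)%R && (pair_sum tu.1 == pair_sum tu.2)%R]|
   <= (2 * s + 3) * p ^ 2)%N.
Proof.
rewrite -(sum1dep_card (fun tu : ('F_p * 'F_p) * ('F_p * 'F_p) =>
  (pair_pow tu.1 == pair_pow tu.2) && (pair_sum tu.1 == pair_sum tu.2))).
rewrite -(pair_big_dep xpredT (fun t u => (pair_pow t == pair_pow u) &&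
  (pair_sum t == pair_sum u)) (fun _ _ => 1%N)) /=.
apply: (@leq_trans (\sum_(t : 'F_p * 'F_p) ((2 * s + 2) + p * (t.1 == - t.2)%R))%N).
  apply: leq_sum => t _; rewrite (sum1dep_card (fun u => (pair_pow t == pair_pow u) &&
    (pair_sum t == pair_sum u))).
  set S := [set u | _].
  have fst_inj : {in S &, injective (fun u : 'F_p * 'F_p => u.1)}.
    move=> [x y] [x' y']; rewrite !inE /= => /andP[_ /eqP e] /andP[_ /eqP e'] xx.
    by subst x'; move: e'; rewrite e => /addrI ->.
  rewrite -(card_in_imset fst_inj); case: eqP => [_|/eqP ts]; last first.
    rewrite muln0 addn0.
    have sg0 : pair_sum t != 0 by rewrite /= addr_eq0.
    apply: leq_trans (fibre_le (pair_pow t) s0 sg0).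
    apply/subset_leq_card/subsetP => x /imsetP[[y z]]; rewrite inE /= => /andP[/eqP h /eqP e] ->.
    by rewrite inE /= e [y + z]addrC addrK h.
  rewrite muln1 (leq_trans (max_card _)) // card_Fp //; exact: leq_addl.
rewrite big_split /= sum_nat_const card_prod card_Fp // -big_distrr /=.
have -> : (\sum_(t : 'F_p * 'F_p) (t.1 == - t.2)%R = p)%N.
  rewrite -(pair_bigA _ (fun x y : 'F_p => nat_of_bool (x == - y))) /= exchange_big /=.
  under eq_bigr => y _ do rewrite -big_mkcond /= big_pred1_eq.
  by rewrite sum1_card card_Fp.
by rewrite -mulnn; set q := (p * p)%N; nia.
Qed.

(** Parseval in [b] and orthogonality in [c]. *)
Lemma sum_Kl4_le : \sum_(c : 'F_p) \sum_(b : 'F_p) cabs (Kl b c) ^+ 4 <=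
  p%:R ^+ 2 * ((2 * s + 3) * p ^ 2)%:R :> R.
Proof.
have sq b c : Kl b c ^+ 2 =
    \sum_(t : 'F_p * 'F_p) ech (c * pair_sum t) * ech (b * pair_pow t).
  rewrite expr2 /Kl big_distrlr /= pair_bigA /=; apply: eq_bigr => -[x y] _.
  by rewrite -!echD //=; congr (ech _); ring.
have pars (c : 'F_p) := parseval p_pr pair_pow (fun t => ech (c * pair_sum t)).
have E : (\sum_(c : 'F_p) \sum_(b : 'F_p) cabs (Kl b c) ^+ 4)%:C%C =
    (p%:R ^+ 2 * (#|[set tu : ('F_p * 'F_p) * ('F_p * 'F_p) |
     (pair_pow tu.1 == pair_pow tu.2)%R && (pair_sum tu.1 == pair_sum tu.2)%R]|)%:R)%:C%C.
  rewrite rmorph_sum /=; under eq_bigr => c _.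
    have -> : \sum_(b : 'F_p) cabs (Kl b c) ^+ 4 = \sum_(b : 'F_p)
      cabs (\sum_(t : 'F_p * 'F_p) ech (c * pair_sum t) * ech (b * pair_pow t)) ^+ 2.
      by apply: eq_bigr => b _; rewrite -sq cabsX -exprM.
    rewrite pars; under eq_bigr => t _ do under eq_bigr => u _ do
      rewrite -echN // -echD // -mulrBr mulrC.
    over.
  rewrite -mulr_sumr exchange_big /=.
  under eq_bigr => t _ do (rewrite exchange_big /=; under eq_bigr => u _ do rewrite sum_ech // subr_eq0).
  rewrite rmorphM rmorphXn /= !(rmorph_nat (real_complex R)) expr2 -mulrA; congr (_ * _).
  rewrite -(sum1dep_card (fun tu : ('F_p * 'F_p) * ('F_p * 'F_p) =>
    (pair_pow tu.1 == pair_pow tu.2) && (pair_sum tu.1 == pair_sum tu.2))).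
  rewrite -(pair_big_dep xpredT (fun t u => (pair_pow t == pair_pow u) &&
    (pair_sum t == pair_sum u)) (fun _ _ => 1%N)) /=.
  rewrite natr_sum mulr_sumr; apply: eq_bigr => t _; rewrite natr_sum mulr_sumr.
  rewrite [RHS]big_mkcondr; apply: eq_bigr => u _.
  by case: ifP; rewrite ?mulr1.
move/complexI: E => ->.
by rewrite ler_wpM2l ?exprn_ge0 ?ler0n // ler_nat pair_coincidences_le.
Qed.

Lemma sum_const_neq0 (K : R) : \sum_(c : 'F_p | c != 0) K = (p.-1)%:R * K.
Proof.
have : \sum_(c : 'F_p) K = p%:R * K by rewrite sumr_const card_Fp // mulr_natl.
have -> : p%:R = 1 + (p.-1)%:R :> R by rewrite nat1r prednK ?prime_gt0.
rewrite (bigD1 0) //= mulrDl mul1r; exact: addrI.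
Qed.

(** Each [c != 0] contributes the same amount to [sum_Kl4_le]. *)
Lemma sum_kap4_le : \sum_(y : 'F_p) kap y ^+ 4 <= (2 * (2 * s + 3) * p ^ 3)%:R.
Proof.
have p1 := prime_gt1 p_pr.
have h : (p.-1)%:R * \sum_(y : 'F_p) kap y ^+ 4 <=
    p%:R ^+ 2 * ((2 * s + 3) * p ^ 2)%:R :> R.
  apply: le_trans sum_Kl4_le; rewrite [X in _ <= X](bigD1 0) //= -[X in X <= _]add0r.
  apply: lerD; first by apply: sumr_ge0 => b _; rewrite exprn_ge0 ?cabs_ge0.
  rewrite [X in _ <= X](eq_bigr (fun _ => \sum_(y : 'F_p) kap y ^+ 4)) => [|c c0].
    by rewrite sum_const_neq0.
  under eq_bigr => b _ do rewrite cabs_Kl //.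
  by rewrite [RHS](reindex_inj (mulIf (expf_neq0 s c0))).
have q1 : p%:R <= 2 * (p.-1)%:R :> R by rewrite -natrM ler_nat; lia.
have q0 : 0 < (p.-1)%:R :> R by rewrite ltr0n; lia.
rewrite -(ler_pM2l q0); apply: le_trans h _.
rewrite !natrM ?natrX.
have S0 : 0 <= 2 * s%:R + 3 :> R by rewrite addr_ge0 ?mulr_ge0 ?ler0n.
have P3 : 0 <= (2 * s%:R + 3) * p%:R ^+ 3 :> R by rewrite mulr_ge0 ?exprn_ge0 ?ler0n.
have := ler_wpM2r P3 q1; rewrite natrD natrM; lra.
Qed.

(** An elementary substitute for Weil's bound: [Kl b 0] does not change when [b]
    is multiplied by an [s]-th power, so its square occurs at least about [p /
    s] times in the second moment. *)
Lemma Kl0_sqr_le (b : 'F_p) : b != 0 -> cabs (Kl b 0) ^+ 2 <= (2 * s ^ 2 * p)%:R.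
Proof.
move=> b0; have p1 := prime_gt1 p_pr.
have second : \sum_(y : 'F_p) cabs (Kl y 0) ^+ 2 <= p%:R * (s * p)%:R :> R.
  have -> : \sum_(y : 'F_p) cabs (Kl y 0) ^+ 2 =
      \sum_(y : 'F_p) cabs (\sum_(x : 'F_p) ech (y * (x ^+ s)^-1)) ^+ 2.
    by apply: eq_bigr => y _; congr (cabs _ ^+ 2); apply: eq_bigr => x _; rewrite mul0r addr0.
  rewrite parseval_count // ler_wpM2l ?ler0n // ler_nat coincidencesE.
  apply: (@leq_trans (\sum_(x : 'F_p) s)%N); last by rewrite sum_nat_const card_Fp // mulnC.
  apply: leq_sum => x _; rewrite (sum1dep_card (fun u : 'F_p => (x ^+ s)^-1 == (u ^+ s)^-1)).
  apply: leq_trans (card_pow_eq_le (x ^+ s) s0); apply/subset_leq_card/subsetP => u.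
  by rewrite !inE (inj_eq invr_inj) eq_sym.
have orbit : (p.-1)%:R * cabs (Kl b 0) ^+ 2 <= s%:R * (p%:R * (s * p)%:R) :> R.
  apply: (@le_trans _ _ (\sum_(t : 'F_p) cabs (Kl (b * t ^+ s) 0) ^+ 2)).
    rewrite [X in _ <= X](bigD1 0) //= -[X in X <= _]add0r.
    apply: lerD; first by rewrite exprn_ge0 ?cabs_ge0.
    rewrite [X in _ <= X](eq_bigr (fun _ => cabs (Kl b 0) ^+ 2)) => [|t t0].
      by rewrite sum_const_neq0.
    by rewrite [in RHS](Kl_scale b 0 t0) mul0r.
  apply: le_trans (sum_orbit_le (f := fun y => cabs (Kl y 0) ^+ 2) s0 b0 _) _.
    by move=> y; rewrite exprn_ge0 ?cabs_ge0.
  by rewrite ler_wpM2l ?ler0n.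
have q1 : p%:R <= 2 * (p.-1)%:R :> R by rewrite -natrM ler_nat; lia.
have q0 : 0 < (p.-1)%:R :> R by rewrite ltr0n; lia.
rewrite -(ler_pM2l q0); apply: le_trans orbit _.
rewrite !natrM ?natrX.
have P3 : 0 <= s%:R ^+ 2 * p%:R :> R by rewrite mulr_ge0 ?exprn_ge0 ?ler0n.
have := ler_wpM2r P3 q1; rewrite !expr2; lra.
Qed.

End Kloosterman.

(** * Incomplete sums *)

(** Cauchy-Schwarz twice: over [T], and then over the values of [g] with the
    squares of their multiplicities, which sum to the coincidences. *)
Lemma moment4_le (R : realType) (p : nat) (T : finType) (g : T -> 'F_p) (phi : 'F_p -> R) :
  (\sum_t phi (g t)) ^+ 4 <=
  #|T|%:R ^+ 2 * (coincidences g)%:R * \sum_(y : 'F_p) phi y ^+ 4.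
Proof.
(* The multiplicity of the value [y]. *)
pose r (y : 'F_p) : R := \sum_(t | g t == y) 1.
have sq (h : T -> R) : (\sum_t h t) ^+ 2 <= #|T|%:R * \sum_t h t ^+ 2.
  have := sum_sqr_le predT (fun _ => 1) h.
  under eq_bigr => t _ do rewrite mul1r.
  by under [X in _ <= X * _]eq_bigr => t _ do rewrite expr1n; rewrite sumr_const.
have fiber : \sum_t phi (g t) ^+ 2 = \sum_(y : 'F_p) r y * phi y ^+ 2.
  rewrite (partition_big g predT) //=; apply: eq_bigr => y _.
  by rewrite /r mulr_suml; apply: eq_bigr => t /eqP ->; rewrite mul1r.
have cs := sum_sqr_le predT r (fun y => phi y ^+ 2).
have r2 : \sum_(y : 'F_p) r y ^+ 2 = (coincidences g)%:R.
  rewrite coincidencesE natr_sum (partition_big g predT) //=; apply: eq_bigr => y _.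
  rewrite expr2 {1}/r mulr_suml; apply: eq_bigr => t /eqP gt; rewrite mul1r natr_sum.
  by apply: eq_bigl => u; rewrite gt eq_sym.
rewrite (_ : _ ^+ 4 = ((\sum_t phi (g t)) ^+ 2) ^+ 2); last by rewrite -exprM.
apply: (@le_trans _ _ ((#|T|%:R * \sum_t phi (g t) ^+ 2) ^+ 2)).
  by rewrite lerXn2r ?nnegrE ?sqr_ge0 ?mulr_ge0 ?sumr_ge0 ?ler0n // => t _; rewrite sqr_ge0.
rewrite exprMn -mulrA ler_wpM2l ?sqr_ge0 // fiber; apply: le_trans cs _.
rewrite r2 ler_wpM2l ?ler0n //; apply: ler_sum => y _.
by rewrite -exprM.
Qed.

Lemma shift_count_enum (F : finFieldType) (A : {set F}) (mu : F) :
  (\sum_(i < #|A|) \sum_(j < #|A| | (enum_val i * mu == enum_val j)%R) 1)%N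
  = shift_count A mu.
Proof.
rewrite shift_countE [RHS]big_enum_val /=; apply: eq_bigr => i _.
case: (boolP (_ \in A)) => [xA|xA]; last first.
  by rewrite big_pred0 // => j; apply: contraNF xA => /eqP ->; exact: enum_valP.
rewrite (big_pred1 (enum_rank_in xA (enum_val i * mu))) // => j /=.
by rewrite -[X in X == _](enum_rankK_in xA xA) (inj_eq enum_val_inj) eq_sym.
Qed.

Section Energies.
Variables (p : nat) (A : {set 'F_p}) (s : nat) (L : int) (n : nat).
Hypothesis pt_neq0 : forall i, (i < n)%N -> pt p L i != 0.

Definition times_power (t : 'I_#|A| * 'I_n) : 'F_p := enum_val t.1 * pt p L t.2 ^+ s.

Definition over_power (t : 'I_#|A| * 'I_n) : 'F_p := enum_val t.1 / pt p L t.2 ^+ s.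

Lemma sum_pairs_swap (P : 'I_#|A| -> 'I_n -> 'I_#|A| -> 'I_n -> bool) :
  (\sum_(t : 'I_#|A| * 'I_n) \sum_(u : 'I_#|A| * 'I_n | P t.1 t.2 u.1 u.2) 1 =
   \sum_(k < n) \sum_(l < n) \sum_(i < #|A|) \sum_(j < #|A| | P i k j l) 1)%N.
Proof.
rewrite -(pair_bigA _ (fun i k => \sum_(u : 'I_#|A| * 'I_n | P i k u.1 u.2) 1)%N) /=.
rewrite exchange_big /=; apply: eq_bigr => k _.
rewrite [RHS]exchange_big /=; apply: eq_bigr => i _.
rewrite -(pair_big_dep xpredT (fun j l => P i k j l) (fun _ _ => 1%N)) /=.
by rewrite (exchange_big_dep predT).
Qed.

Lemma coincidences_times_power : coincidences times_power = energy A s L n.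
Proof.
rewrite coincidencesE /times_power.
rewrite (sum_pairs_swap (fun i k j l =>
  enum_val i * pt p L k ^+ s == enum_val j * pt p L l ^+ s)).
apply: eq_bigr => k _; apply: eq_bigr => l _.
rewrite -shift_count_enum; apply: eq_bigr => i _; apply: eq_bigl => j.
have k0 := pt_neq0 (ltn_ord k); have l0 := pt_neq0 (ltn_ord l).
by rewrite expr_div_n mulrA [RHS](can2_eq (divfK _) (mulfK _)) ?expf_neq0.
Qed.

Lemma coincidences_over_power : coincidences over_power = energy A s L n.
Proof.
rewrite coincidencesE /over_power.
rewrite (sum_pairs_swap (fun i k j l =>
  enum_val i / pt p L k ^+ s == enum_val j / pt p L l ^+ s)).
rewrite exchange_big /=; apply: eq_bigr => l _; apply: eq_bigr => k _.
rewrite -shift_count_enum; apply: eq_bigr => i _; apply: eq_bigl => j.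
have k0 := pt_neq0 (ltn_ord k); have l0 := pt_neq0 (ltn_ord l).
rewrite expr_div_n mulrA mulrAC.
by rewrite [RHS](can2_eq (mulfK _) (divfK _)) ?expf_neq0.
Qed.

End Energies.

Section PowerSums.
Variables (R : realType) (p s : nat).
Hypotheses (p_pr : prime p) (s0 : (0 < s)%N).
Notation Kl := (@Kl R p s).
Notation kap := (@kap R p s).
Notation power_sum := (@power_sum R p s).

(** The contributions of the frequencies [c] and [- c] to [completion], put
    together. *)
Definition kap2 (y : 'F_p) : R := kap y + kap ((-1) ^+ s * y).

Lemma kap2_ge0 y : 0 <= kap2 y.
Proof. by rewrite addr_ge0 // kap_ge0. Qed.

Lemma sum_kap2_le : \sum_(y : 'F_p) kap2 y ^+ 4 <= (32 * (2 * s + 3) * p ^ 3)%:R.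
Proof.
apply: (@le_trans _ _ (8 * (\sum_(y : 'F_p) kap y ^+ 4 +
    \sum_(y : 'F_p) kap ((-1) ^+ s * y) ^+ 4))).
  rewrite -big_split mulr_sumr; apply: ler_sum => y _; exact: add_pow4_le.
have sgn0 : (-1) ^+ s != 0 :> 'F_p by rewrite signr_eq0.
rewrite [X in _ + X](_ : _ = \sum_(y : 'F_p) kap y ^+ 4); last first.
  by rewrite [RHS](reindex_inj (mulfI sgn0)).
have := @sum_kap4_le R p s p_pr s0; rewrite !natrM; lra.
Qed.

(** [completion], with the frequencies [c] and [- c] put together and the
    geometric sums bounded. *)
Lemma completion_le (L : int) (n : nat) (b : 'F_p) :
  p%:R * cabs (power_sum L n b) <= n%:R * cabs (Kl b 0) +
    \sum_(k < p./2) Num.min n%:R (p%:R / k.+1%:R) * kap2 (b * k.+1%:R ^+ s).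
Proof.
have -> : p%:R * cabs (power_sum L n b) = cabs (p%:R * power_sum L n b).
  by rewrite Normc.normcM cabs_nat.
rewrite completion //; apply: le_trans (cabs_sum _ _ _) _.
apply: le_trans (sum_Fp_sym p_pr (f := fun c =>
  cabs (interval_sum R L n (- c) * Kl b c)) _) _; first by move=> c; exact: cabs_ge0.
apply: lerD; first by rewrite Normc.normcM ler_wpM2r ?cabs_ge0 // interval_sum_le_size.
apply: ler_sum => k _; rewrite !Normc.normcM !interval_sumN //.
have kp : (k.+1 < p)%N by have := ltn_ord k; have := prime_gt1 p_pr; lia.
have k2 : (2 * k.+1 <= p)%N by have := ltn_ord k; lia.
have c0 : k.+1%:R != 0 :> 'F_p by rewrite natr_Fp_neq0 // kp.
rewrite cabs_Kl // cabs_Kl ?oppr_eq0 // -mulrDr.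
have -> : b * (- k.+1%:R) ^+ s = (-1) ^+ s * (b * k.+1%:R ^+ s).
  by rewrite exprNn mulrCA.
rewrite ler_wpM2r ?kap2_ge0 // le_min interval_sum_le_size //=.
exact: interval_sum_le.
Qed.

(** After completion, a sum over frequencies with total weight of order [p log
    p]; each nonzero frequency contributes the same fourth moment [sum_kap2_le],
    and the frequency 0 is bounded by [Kl0_sqr_le]. *)
Lemma power_sum_moment4_le (L : int) (n : nat) (l : R) : (n <= p)%N ->
  \sum_(k < p) (k.+1%:R)^-1 <= l ->
  \sum_(b : 'F_p | b != 0) cabs (power_sum L n b) ^+ 4 <=
    (1 + l) ^+ 4 * (4 * s ^ 4 + 32 * (2 * s + 3))%:R * p%:R ^+ 3.
Proof.
move=> np hl; have p1 := prime_gt1 p_pr.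
have pR : 0 < p%:R :> R by rewrite ltr0n; lia.
have l0 : 0 <= l by apply: le_trans hl; apply: sumr_ge0 => k _; rewrite invr_ge0 ler0n.
set C : R := (4 * s ^ 4 + 32 * (2 * s + 3))%:R.
pose w (k : 'I_(p./2).+1) : R := if val k is k'.+1 then p%:R / k'.+1%:R else n%:R.
pose z (b : 'F_p) (k : 'I_(p./2).+1) : R :=
  if val k is k'.+1 then kap2 (b * k'.+1%:R ^+ s) else cabs (Kl b 0).
have w0 k : 0 <= w k by rewrite /w; case: (val k) => [|k']; rewrite ?divr_ge0 ?ler0n.
have z0 b k : 0 <= z b k by rewrite /z; case: (val k) => [|k']; rewrite ?kap2_ge0 ?cabs_ge0.
have Xz b : p%:R * cabs (power_sum L n b) <= \sum_k w k * z b k.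
  apply: le_trans (completion_le L n b) _; rewrite big_ord_recl /= lerD2l.
  apply: ler_sum => k _; rewrite /w /z /= ler_wpM2r ?kap2_ge0 //.
  by rewrite ge_min lexx orbT.
have W : \sum_k w k <= p%:R * (1 + l).
  rewrite big_ord_recl /w /= mulrDr mulr1 lerD ?ler_nat // -mulr_sumr ler_wpM2l ?(ltW pR) //.
  apply: le_trans hl; rewrite (big_ord_widen p (fun k => (k.+1%:R : R)^-1)) /=; last by lia.
  by rewrite [X in X <= _]big_mkcond /=; apply: ler_sum => k _; case: ifP; rewrite ?invr_ge0 ?ler0n.
have W0 : 0 <= \sum_k w k by apply: sumr_ge0.
have Z k : \sum_(b : 'F_p | b != 0) z b k ^+ 4 <= C * p%:R ^+ 3.
  rewrite /z; case: k => [[|k'] hk] /=.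
    apply: (@le_trans _ _ (\sum_(b : 'F_p | b != 0) ((2 * s ^ 2 * p)%:R) ^+ 2)).
      apply: ler_sum => b b0; rewrite (_ : _ ^+ 4 = (cabs (Kl b 0) ^+ 2) ^+ 2); last by rewrite -exprM.
      by rewrite lerXn2r ?nnegrE ?ler0n ?sqr_ge0 // Kl0_sqr_le.
    rewrite sum_const_neq0 // /C -!natrX -!natrM ler_nat.
    apply: (@leq_trans (p * (2 * s ^ 2 * p) ^ 2)%N); first by rewrite leq_mul2r leq_pred orbT.
    apply: (@leq_trans (4 * s ^ 4 * p ^ 3)%N); last by rewrite leq_mul2r leq_addr orbT.
    by apply: eq_leq; ring.
  have kp : (k'.+1 < p)%N by move: hk; lia.
  have c0 : k'.+1%:R != 0 :> 'F_p by rewrite natr_Fp_neq0 // kp.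
  apply: (@le_trans _ _ (\sum_(b : 'F_p) kap2 (b * k'.+1%:R ^+ s) ^+ 4)).
    by rewrite big_mkcond /=; apply: ler_sum => b _; case: ifP; rewrite ?exprn_ge0 ?kap2_ge0.
  have -> : \sum_(b : 'F_p) kap2 (b * k'.+1%:R ^+ s) ^+ 4 = \sum_(y : 'F_p) kap2 y ^+ 4.
    by rewrite [RHS](reindex_inj (mulIf (expf_neq0 s c0))).
  apply: le_trans sum_kap2_le _; rewrite /C -natrX -natrM ler_nat.
  by rewrite leq_mul2r leq_addl orbT.
have p4 : 0 < p%:R ^+ 4 :> R by rewrite exprn_gt0.
rewrite -(ler_pM2l p4) mulr_sumr.
apply: (@le_trans _ _ (\sum_(b : 'F_p | b != 0)
   (\sum_k w k) ^+ 3 * \sum_k w k * z b k ^+ 4)).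
  apply: ler_sum => b _; rewrite -exprMn; apply: le_trans (power_mean_le 3 w0 (z0 b)).
  by rewrite lerXn2r ?nnegrE ?mulr_ge0 ?ler0n ?cabs_ge0 ?sumr_ge0 // => k _; rewrite mulr_ge0.
rewrite -mulr_sumr exchange_big /=.
apply: (@le_trans _ _ ((\sum_k w k) ^+ 3 * (\sum_k w k * (C * p%:R ^+ 3)))).
  rewrite ler_wpM2l ?exprn_ge0 //; apply: ler_sum => k _.
  by rewrite -mulr_sumr ler_wpM2l.
rewrite -mulr_suml mulrA -exprSr.
apply: (@le_trans _ _ ((p%:R * (1 + l)) ^+ 4 * (C * p%:R ^+ 3))).
  rewrite ler_wpM2r ?mulr_ge0 ?exprn_ge0 ?ler0n //.
  by rewrite lerXn2r ?nnegrE // mulr_ge0 ?ler0n ?addr_ge0.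
by rewrite exprMn !mulrA.
Qed.

End PowerSums.

(** * Averages of incomplete sums over a set *)

Section PowerSumAverage.
Variables (R : realType) (p s : nat) (A : {set 'F_p}) (b : 'F_p).
Hypotheses (p_pr : prime p) (s0 : (0 < s)%N) (A0 : 0 \notin A) (b0 : b != 0).
Variables (N : nat) (E : R).
Hypotheses (N0 : (0 < N)%N) (Np : (N <= p./2)%N).
Hypothesis E_ge : forall L : int, (forall i, (i < N)%N -> pt p L i != 0) ->
  (energy A s L N)%:R <= E.
Notation kap2 := (@kap2 R p s).

Definition block_sum (j : nat) : R :=
  \sum_(m in A) \sum_(i < N) kap2 (b * m * (j * N + i).+1%:R ^+ s).

Lemma block_sum_ge0 j : 0 <= block_sum j.
Proof. by do 2 apply: sumr_ge0 => ? _; exact: kap2_ge0. Qed.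

(** In a block the frequencies [c] form an interval, so that the products [m c
    ^+ s] have few coincidences and [moment4_le] applies. *)
Lemma block_sum_le j : (j * N < p./2)%N ->
  block_sum j ^+ 4 <= (#|A| * N)%:R ^+ 2 * E * (32 * (2 * s + 3) * p ^ 3)%:R.
Proof.
move=> jN; have p1 := prime_gt1 p_pr.
pose L : int := (j * N)%:Z.
have ptL i : pt p L i = (j * N + i).+1%:R.
  by rewrite /pt /L -PoszD -pmulrn addnS.
have pt0 i : (i < N)%N -> pt p L i != 0.
  by move=> iN; rewrite ptL natr_Fp_neq0 //=; lia.
pose phi y := kap2 (b * y).
have -> : block_sum j = \sum_(t : 'I_#|A| * 'I_N) phi (times_power s L t).
  rewrite -(pair_bigA _ (fun (i : 'I_#|A|) (k : 'I_N) => phi (enum_val i * pt p L k ^+ s))) /=.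
  rewrite /block_sum big_enum_val /=; apply: eq_bigr => i _; apply: eq_bigr => k _.
  by rewrite /phi ptL mulrA.
apply: le_trans (moment4_le _ _) _; rewrite card_prod !card_ord.
rewrite coincidences_times_power // -[X in X <= _]mulrA -[X in _ <= X]mulrA ler_wpM2l ?sqr_ge0 //.
apply: ler_pM; [by rewrite ler0n | | exact: (E_ge pt0) |].
  by apply: sumr_ge0 => y _; rewrite exprn_ge0 ?kap2_ge0.
apply: le_trans (sum_kap2_le R p_pr s0); rewrite [X in _ <= X](reindex_inj (mulfI b0)).
exact: lexx.
Qed.

(** The weights decrease, so a block can be given the weight of its first
    frequency. *)
Lemma weighted_blocks_le (n : nat) :
  \sum_(m in A) \sum_(k < p./2) Num.min n%:R (p%:R / k.+1%:R) * kap2 (b * m * k.+1%:R ^+ s)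
  <= \sum_(j < (p./2 + N).-1 %/ N)
       (if val j is j'.+1 then p%:R / (j'.+1 * N)%:R else n%:R) * block_sum j :> R.
Proof.
set J := ((p./2 + N).-1 %/ N)%N.
have JN : (p./2 <= J * N)%N.
  by have := ltn_ceil (p./2 + N).-1 N0; rewrite -/J mulSn; lia.
have NR : 0 < N%:R :> R by rewrite ltr0n.
under [X in _ <= X]eq_bigr => j _ do rewrite /block_sum mulr_sumr.
rewrite [X in _ <= X]exchange_big /=; apply: ler_sum => m _.
pose f k : R := Num.min n%:R (p%:R / k.+1%:R) * kap2 (b * m * k.+1%:R ^+ s).
have f0 k : 0 <= f k.
  by rewrite mulr_ge0 ?kap2_ge0 // le_min ler0n divr_ge0 ?ler0n.
apply: (@le_trans _ _ (\sum_(0 <= k < J * N) f k)).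
  rewrite -(big_mkord xpredT f) (big_cat_nat _ JN) //= lerDl.
  by apply: sumr_ge0 => k _.
rewrite big_nat_mul big_mkord; apply: ler_sum => j _.
rewrite -[X in \sum_(X <= _ < _) _]add0n big_addn mulSn addnK big_mkord mulr_sumr.
apply: ler_sum => i _; rewrite /f [(i + _)%N]addnC ler_wpM2r ?kap2_ge0 //.
case: (val j) => [|j']; first by rewrite ge_min lexx.
rewrite ge_min; apply/orP; right; rewrite ler_wpM2l ?ler0n //.
by rewrite lef_pV2 ?posrE ?ltr0n ?muln_gt0 // ler_nat; lia.
Qed.

(** The mean over [A] of incomplete sums, uniformly in the multiplier [b]. The
    frequencies of completion are cut into blocks of length [N], to each of
    which [block_sum_le] applies. *)
Lemma power_sum_average_le (L : int) (n : nat) (l : R) :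
  \sum_(k < p) (k.+1%:R)^-1 <= l ->
  (p%:R * \sum_(m in A) cabs (power_sum R s L n (b * m))) ^+ 4 <=
  8 * ((n * #|A|)%:R ^+ 4 * (2 * s ^ 2 * p)%:R ^+ 2 +
    (n%:R + p%:R / N%:R * l) ^+ 4 *
      ((#|A| * N)%:R ^+ 2 * E * (32 * (2 * s + 3) * p ^ 3)%:R)).
Proof.
move=> hl; have p1 := prime_gt1 p_pr.
have NR : 0 < N%:R :> R by rewrite ltr0n.
have l0 : 0 <= l by apply: le_trans hl; apply: sumr_ge0 => k _; rewrite invr_ge0 ler0n.
set J := ((p./2 + N).-1 %/ N)%N.
pose w (j : 'I_J) : R := if val j is j'.+1 then p%:R / (j'.+1 * N)%:R else n%:R.
have w0 j : 0 <= w j by rewrite /w; case: (val j) => [|?]; rewrite ?divr_ge0 ?ler0n.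
set Z := _ * E * _.
pose X1 : R := \sum_(m in A) n%:R * cabs (Kl R s (b * m) 0).
pose X2 : R := \sum_j w j * block_sum j.
have X10 : 0 <= X1 by apply: sumr_ge0 => m _; rewrite mulr_ge0 ?ler0n ?cabs_ge0.
have X20 : 0 <= X2 by apply: sumr_ge0 => j _; rewrite mulr_ge0 ?block_sum_ge0.
have bd : p%:R * \sum_(m in A) cabs (power_sum R s L n (b * m)) <= X1 + X2.
  rewrite mulr_sumr; apply: le_trans (ler_sum _ (fun m _ => completion_le R p_pr s0 L n (b * m))) _.
  by rewrite big_split lerD2l; exact: weighted_blocks_le.
apply: (@le_trans _ _ ((X1 + X2) ^+ 4)).
  apply: lerXn2r bd; rewrite nnegrE; last exact: addr_ge0.
  by rewrite mulr_ge0 ?ler0n // sumr_ge0 // => m _; exact: cabs_ge0.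
apply: le_trans (add_pow4_le _ _) _; rewrite ler_wpM2l //; apply: lerD.
  rewrite /X1 -mulr_sumr natrM !exprMn -[X in _ <= X]mulrA ler_wpM2l ?exprn_ge0 ?ler0n //.
  apply: le_trans (power_mean_set_le _ 3 (fun m => cabs_ge0 _)) _.
  rewrite [X in _ <= X * _]exprSr -[X in _ <= X]mulrA ler_wpM2l ?exprn_ge0 ?ler0n //.
  rewrite mulr_natl -sumr_const; apply: ler_sum => m mA.
  rewrite (_ : _ ^+ 4 = (cabs (Kl R s (b * m) 0) ^+ 2) ^+ 2); last by rewrite -exprM.
  rewrite lerXn2r ?nnegrE ?ler0n ?sqr_ge0 // Kl0_sqr_le // mulf_neq0 //.
  by apply: contraNneq A0 => <-.
have jK (j : 'I_J) : (j * N < p./2)%N.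
  have := ltn_ord j; rewrite /J; have := leq_divM (p./2 + N).-1 N; rewrite -/J.
  move=> h1 h2; have : (j.+1 * N <= J * N)%N by rewrite leq_mul2r h2 orbT.
  rewrite mulSn; lia.
have wsum : \sum_j w j <= n%:R + p%:R / N%:R * l.
  have Jp : (J <= p)%N.
    by rewrite /J -ltnS ltn_divLR // mulSn; have := leq_pmulr p N0; lia.
  rewrite (big_ord_widen p.+1 (fun j => if j is j'.+1 then p%:R / (j'.+1 * N)%:R else n%:R : R)); last exact: leqW.
  rewrite big_mkcond big_ord_recl /=; apply: lerD; first by case: ifP; rewrite ?ler0n.
  apply: (@le_trans _ _ (p%:R / N%:R * \sum_(k < p) (k.+1%:R)^-1)).
    rewrite mulr_sumr; apply: ler_sum => k _; rewrite add0n natrM invfM [_^-1 * _]mulrC mulrA.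
    by case: ifP => // _; rewrite !mulr_ge0 ?invr_ge0 ?ler0n.
  by rewrite ler_wpM2l ?divr_ge0 ?ler0n.
have Z0 : 0 <= Z.
  rewrite /Z !mulr_ge0 ?exprn_ge0 ?ler0n //; apply: le_trans (E_ge (L := 0) _) => // i iN.
  by rewrite /pt add0r -pmulrn natr_Fp_neq0 //=; lia.
apply: le_trans (power_mean_le 3 w0 (fun j => block_sum_ge0 j)) _.
apply: (@le_trans _ _ ((\sum_j w j) ^+ 3 * \sum_j w j * Z)).
  rewrite ler_wpM2l ?exprn_ge0 ?sumr_ge0 //; apply: ler_sum => j _.
  by rewrite ler_wpM2l // block_sum_le.
rewrite -mulr_suml mulrA -exprSr ler_wpM2r //.
by rewrite lerXn2r ?nnegrE ?sumr_ge0 // addr_ge0 ?mulr_ge0 ?divr_ge0 ?ler0n.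
Qed.

End PowerSumAverage.

(** * The sixth moment of short sums *)

(** In an equality between two sums of three terms, each of the six terms can be
    written in [#|W|] ways, independently of the others. *)
Lemma coincidences_embed (p : nat) (T W T' : finType) (g : T -> 'F_p) (g' : T' -> 'F_p)
    (phi : T -> W -> T') :
  (forall i w i' w', phi i w = phi i' w' -> i = i' /\ w = w') ->
  (forall i w, g' (phi i w) = g i) ->
  (coincidences (sum3 g) * #|W| ^ 6 <= coincidences (sum3 g'))%N.
Proof.
move=> phi_inj g'phi.
pose W3 := (W * W * W)%type; pose T3 := (T * T * T)%type.
pose phi3 (t : T3) (w : W3) := (phi t.1.1 w.1.1, phi t.1.2 w.1.2, phi t.2 w.2).
have phi3_inj t w t' w' : phi3 t w = phi3 t' w' -> t = t' /\ w = w'.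
  case: t w t' w' => [[a b] c] [[u v] w] [[a' b'] c'] [[u' v'] w'] [] /=.
  by move=> /phi_inj[-> ->] /phi_inj[-> ->] /phi_inj[-> ->].
have phi3_sum t w : sum3 g' (phi3 t w) = sum3 g t by rewrite /sum3 /= !g'phi.
pose h (z : (T3 * T3) * (W3 * W3)) := (phi3 z.1.1 z.2.1, phi3 z.1.2 z.2.2).
have h_inj : injective h.
  move=> [[t t'] [w w']] [[u u'] [v v']] e.
  have /= [-> ->] := phi3_inj _ _ _ _ (congr1 fst e).
  by have /= [-> ->] := phi3_inj _ _ _ _ (congr1 snd e).
rewrite /coincidences.
set C := [set tu : T3 * T3 | _]; set C' := [set tu | sum3 g' tu.1 == _].
have -> : (#|C| * #|W| ^ 6 = #|setX C [set: W3 * W3]|)%N.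
  rewrite cardsX cardsT !card_prod; congr (_ * _)%N.
  by rewrite !expnS expn0 muln1 !mulnA.
rewrite -(card_imset _ h_inj); apply/subset_leq_card/subsetP => z /imsetP[[[t u] [w v]]].
rewrite inE /= => /andP[tC _] ->; move: tC.
by rewrite /C /C' !inE /= !phi3_sum.
Qed.

Section SixthMoment.
Variables (R : realType) (p s : nat).
Hypotheses (p_pr : prime p) (s0 : (0 < s)%N).
Notation ech := (@ech R p).

Lemma moment6_eq (T : finType) (g : T -> 'F_p) :
  \sum_(b : 'F_p) cabs (\sum_(i : T) ech (b * g i)) ^+ 6 =
  p%:R * (coincidences (sum3 g))%:R.
Proof.
rewrite -parseval_count //; apply: eq_bigr => b _.
rewrite (_ : 6%N = (3 * 2)%N) // exprM -cabsX; congr (cabs _ ^+ 2).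
rewrite exprSr expr2 big_distrlr /= pair_bigA /= big_distrlr /= pair_bigA /=.
by apply: eq_bigr => -[[i j] k] _; rewrite /sum3 /= -!echD // !mulrDr.
Qed.

Variables (L : int) (n U : nat).
Hypotheses (U0 : (0 < U)%N) (Up : (U < p)%N).

Let n' := (n + U ^ 2)%N.
Let L' := L - (U ^ 2)%:Z.
Let T' := ('I_n' * 'I_U * 'I_U)%type.
Let g (i : 'I_n) : 'F_p := (pt p L i ^+ s)^-1.
Let g' (t : T') : 'F_p := ((pt p L' t.1.1 + t.1.2.+1%:R * t.2.+1%:R) ^+ s)^-1.

(** Every point [x] of the interval is [(x - u v) + u v], for each of the [U ^
    2] pairs [(u, v)], and [x - u v] belongs to an interval longer by [U ^ 2]. *)
Lemma shifted_coincidences_ge :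
  (coincidences (sum3 g) * U ^ 12 <= coincidences (sum3 g'))%N.
Proof.
have lt_n' (i : 'I_n) (w : 'I_U * 'I_U) : (i + (U ^ 2 - w.1.+1 * w.2.+1) < n')%N.
  by rewrite /n'; have := ltn_ord i; lia.
pose phi (i : 'I_n) (w : 'I_U * 'I_U) : T' := (Ordinal (lt_n' i w), w.1, w.2).
have le_U2 (w : 'I_U * 'I_U) : (w.1.+1 * w.2.+1 <= U ^ 2)%N by rewrite -mulnn leq_mul.
rewrite (_ : U ^ 12 = #|{: 'I_U * 'I_U}| ^ 6)%N; last first.
  by rewrite card_prod card_ord mulnn -expnM.
apply: (coincidences_embed (phi := phi)) => [i [u v] i' [u' v']|i w].
  case=> e eu ev; subst u' v'; split=> //; apply: val_inj; exact: addIn e.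
rewrite /g' /g /phi /=; congr (_ ^+ s)^-1.
rewrite !(pt_shift p _ (_ + _)) !(pt_shift p L i) /L' /pt natrD natrB // natrM !intrD rmorphN /=.
by rewrite -pmulrn; ring.
Qed.

Let xi (t : 'I_n' * 'I_U) : 'F_p := pt p L' t.1 / t.2.+1%:R.
Let mult (t : 'I_n' * 'I_U) : R := #|[set u | xi u == xi t]|%:R.

Lemma mult_ge1 t : 1 <= mult t.
Proof. by rewrite ler1n card_gt0; apply/set0Pn; exists t; rewrite inE. Qed.

Lemma sum_mult : \sum_t mult t = (quotient_energy p L' n' U)%:R.
Proof.
rewrite /mult -natr_sum; congr (_%:R).
under eq_bigr => t _ do rewrite -(sum1dep_card (fun u => xi u == xi t)).
rewrite -(pair_bigA _ (fun (i : 'I_n') (v : 'I_U) => \sum_(u | xi u == xi (i, v)) 1)%N) /=.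
rewrite exchange_big /= /quotient_energy; apply: eq_bigr => v _.
under eq_bigr => i _ do rewrite -(pair_big_dep xpredT (fun (j : 'I_n') (w : 'I_U) => xi (j, w) == xi (i, v)) (fun _ _ => 1%N)) /=.
under [RHS]eq_bigr => w _ do rewrite -(sum1dep_card (fun ij : 'I_n' * 'I_n' =>
  (w.+1%:R * pt p L' ij.1 == v.+1%:R * pt p L' ij.2)%R)).
under [RHS]eq_bigr => w _ do rewrite -(pair_big_dep xpredT (fun i j : 'I_n' =>
  (w.+1%:R * pt p L' i == v.+1%:R * pt p L' j)%R) (fun _ _ => 1%N)) /=.
rewrite [RHS]exchange_big /=; apply: eq_bigr => i _.
rewrite (exchange_big_dep predT) //=; apply: eq_bigr => w _; apply: eq_bigl => j.
have nz (a : 'I_U) : a.+1%:R != 0 :> 'F_p.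
  by rewrite natr_Fp_neq0 //=; apply: leq_ltn_trans Up.
by rewrite /xi /= eqr_div // eq_sym mulrC [X in _ == X]mulrC.
Qed.

Definition translate_coincidences (x : 'F_p) : nat :=
  coincidences (sum3 (fun u : 'I_U => ((x + u.+1%:R) ^+ s)^-1)).

(** As [x + u v = v (x / v + u)], a dilation of the frequency turns the sum over
    [u] into one that depends only on the quotient [xi = x / v]. Hoelder's
    inequality takes it out of the sum over [x] and [v]; the weights [mult] make
    every quotient contribute only once. *)
Lemma shifted_coincidences_le :
  (coincidences (sum3 g') <= quotient_energy p L' n' U ^ 5 *
     \sum_(x in xi @: setT) translate_coincidences x)%N.
Proof.
have pR : 0 < p%:R :> R by rewrite ltr0n prime_gt0.
rewrite -(ler_nat R) -(ler_pM2l pR) -moment6_eq.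
pose y b (t : 'I_n' * 'I_U) : R :=
  cabs (\sum_(u < U) ech (b * ((pt p L' t.1 + u.+1%:R * t.2.+1%:R) ^+ s)^-1)).
have nz (a : 'I_U) : a.+1%:R != 0 :> 'F_p.
  by rewrite natr_Fp_neq0 //=; apply: leq_ltn_trans Up.
have m0 t : 0 < mult t by apply: lt_le_trans (mult_ge1 t).
have y0 b t : 0 <= y b t by exact: cabs_ge0.
have tri b : cabs (\sum_t ech (b * g' t)) <= \sum_t mult t * (y b t / mult t).
  under [X in _ <= X]eq_bigr => t _ do rewrite mulrC divfK ?gt_eqF //.
  rewrite -(pair_bigA _ (fun (z : 'I_n' * 'I_U) v => ech (b * g' (z, v)))) /=.
  rewrite -(pair_bigA _ (fun (x : 'I_n') (u : 'I_U) => \sum_(v < U) ech (b * g' (x, u, v)))) /=.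
  under eq_bigr => x _ do rewrite exchange_big /=.
  by rewrite pair_bigA /=; exact: cabs_sum.
have step b : cabs (\sum_t ech (b * g' t)) ^+ 6 <=
    (\sum_t mult t) ^+ 5 * \sum_t (mult t)^-1 * y b t ^+ 6.
  apply: (@le_trans _ _ ((\sum_t mult t * (y b t / mult t)) ^+ 6)).
    rewrite lerXn2r ?nnegrE ?cabs_ge0 ?sumr_ge0 // => t _.
    by rewrite mulr_ge0 ?divr_ge0 // ltW.
  have m1 t : 0 <= mult t := ltW (m0 t).
  have q0 t : 0 <= y b t / mult t by rewrite divr_ge0.
  apply: le_trans (power_mean_le 5 m1 q0) _.
  rewrite ler_wpM2l ?exprn_ge0 ?sumr_ge0 //.
  apply: ler_sum => t _; rewrite exprMn mulrCA [X in _ <= X]mulrC ler_wpM2l ?exprn_ge0 //.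
  rewrite exprVn exprS invfM mulrA mulfV ?gt_eqF // mul1r.
  by rewrite lef_pV2 ?posrE ?exprn_gt0 // -[X in X <= _]expr1 ler_weXn2l ?mult_ge1.
have each t : \sum_(b : 'F_p) y b t ^+ 6 = p%:R * (translate_coincidences (xi t))%:R.
  rewrite /translate_coincidences -moment6_eq.
  have c0 : t.2.+1%:R ^+ s != 0 :> 'F_p by rewrite expf_neq0.
  rewrite [RHS](reindex_inj (mulIf (invr_neq0 c0))) /=; apply: eq_bigr => b _.
  congr (cabs _ ^+ 6); apply: eq_bigr => u _; congr (ech _).
  rewrite -mulrA -invfM -exprMn; congr (b * (_ ^+ s)^-1).
  by rewrite mulrDr /xi mulrCA mulfV // mulr1 [u.+1%:R * _]mulrC.
apply: (@le_trans _ _ ((\sum_t mult t) ^+ 5 *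
    \sum_t (mult t)^-1 * (p%:R * (translate_coincidences (xi t))%:R))).
  apply: le_trans (ler_sum _ (fun b _ => step b)) _.
  rewrite -mulr_sumr exchange_big /= le_eqVlt; apply/orP; left; apply/eqP; congr (_ * _).
  by apply: eq_bigr => t _; rewrite -mulr_sumr each.
rewrite sum_mult natrM natrX [X in _ <= X]mulrCA ler_wpM2l ?exprn_ge0 ?ler0n //.
under [X in X <= _]eq_bigr => t _ do rewrite mulrCA.
rewrite -mulr_sumr ler_wpM2l ?(ltW pR) //.
rewrite (partition_big xi (mem (xi @: setT))) /=; last by move=> t _; apply: imset_f.
rewrite natr_sum; apply: ler_sum => x /imsetP[t0 _ xE].
rewrite (eq_bigr (fun _ => (mult t0)^-1 * (translate_coincidences x)%:R)); last first.
  by move=> t /eqP tx; rewrite /mult tx xE.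
rewrite sumr_const -(mulr_natl (_ * _) _) mulrA.
rewrite (_ : #|_|%:R = mult t0) ?mulfV ?gt_eqF // ?mul1r //.
by rewrite /mult; congr (_%:R); apply: eq_card => t; rewrite !inE xE.
Qed.

(** The number of solutions of [1/x1^s + 1/x2^s + 1/x3^s = 1/y1^s + 1/y2^s +
    1/y3^s] in an interval of length [n], for a shift parameter [U] of about the
    square root of [n]. *)
Lemma moment6_coincidences_le (tau : nat) : (3 < p)%N -> (U * n' <= p)%N -> (U <= n')%N ->
  (forall m, (0 < m <= U)%N -> (size (divisors m) <= tau)%N) ->
  (coincidences (sum3 g) * U ^ 12 <=
    (12 * n' * (U * tau)) ^ 5 * (6 * (n' * U) * U ^ 3 + (5 * s + 6) * U ^ 6))%N.
Proof.
move=> p3 Unp Un htau; apply: leq_trans shifted_coincidences_ge _.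
apply: leq_trans shifted_coincidences_le _; apply: leq_mul.
  by rewrite leq_exp2r // quotient_energy_le.
apply: leq_trans (sum_translates_le _ p_pr p3 s0 Up) _.
rewrite leq_add2r leq_mul2r leq_mul2l (leq_trans (leq_imset_card _ _)) ?orbT //.
by rewrite cardsT card_prod !card_ord.
Qed.

End SixthMoment.

(** * Bilinear sums *)

(** By the hypothesis on the whole set, its smallest value has square at most [q
    / #|X|]. Remove it and repeat. *)
Lemma sum_sqr_harmonic_le (R : realFieldType) (T : finType) (f : T -> R) (q : R) (X : {set T}) :
  (forall a, 0 <= f a) -> 0 <= q ->
  (forall Y : {set T}, Y \subset X -> (\sum_(a in Y) f a) ^+ 2 <= q * #|Y|%:R) ->
  \sum_(a in X) f a ^+ 2 <= q * \sum_(k < #|X|) (k.+1%:R)^-1.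
Proof.
move=> f0 q0; move cX : #|X| => m.
elim: m X cX => [|m IHm] X cX hX.
  by rewrite (cards0_eq cX) big_set0 big_ord0 mulr0.
have [x0 x0X] : exists x, x \in X by apply/set0Pn; rewrite -card_gt0 cX.
have [a aX amin] := @arg_minP _ _ _ x0 (mem X) f x0X.
have {}aX : a \in X by [].
rewrite (big_setD1 a) //= big_ord_recr /= mulrDr addrC; apply: lerD.
  apply: IHm => [|Y YX].
    by have := cardsD1 a X; rewrite aX cX add1n => -[<-].
  by apply: hX; rewrite (subset_trans YX) // subD1set.
have := hX X (subxx _); rewrite cX => hsum.
have mR : 0 < m.+1%:R :> R by rewrite ltr0n.
have le1 : m.+1%:R * f a <= \sum_(b in X) f b.
  rewrite mulr_natl -cX -sumr_const; apply: ler_sum => b bX; exact: amin.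
have : (m.+1%:R * f a) ^+ 2 <= q * m.+1%:R.
  by apply: le_trans hsum; rewrite lerXn2r ?nnegrE ?mulr_ge0 ?sumr_ge0 // ltW.
rewrite ler_pdivlMr // exprMn expr2 -mulrA -[q * _]mulrC ler_pM2l //.
by rewrite mulrC.
Qed.

Lemma exists_subset_card (T : finType) (X : {set T}) (m : nat) : (m <= #|X|)%N ->
  exists2 Y : {set T}, Y \subset X & #|Y| = m.
Proof.
move=> mX; exists [set x in take m (enum X)].
  by apply/subsetP => x; rewrite inE => /mem_take; rewrite mem_enum.
by rewrite cardsE (card_uniqP _) ?take_uniq ?enum_uniq // size_takel -?cardE.
Qed.

(** Fewer than [B] values of [f] have a square beyond [2 Q / B], and harmonic
    summation applies to them. The others are controlled by the threshold and
    the second moment. *)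
Lemma sum_pow6_le (R : realFieldType) (T : finType) (D : {set T}) (f : T -> R)
    (Q Q2 D4 l : R) (B : nat) :
  (forall a, 0 <= f a) -> (0 < B)%N -> 0 <= Q -> 0 <= D4 ->
  (forall Y : {set T}, Y \subset D ->
    (\sum_(a in Y) f a) ^+ 2 <= Q * (#|Y|%:R * (1 + #|Y|%:R / B%:R))) ->
  \sum_(a in D) f a ^+ 2 <= Q2 ->
  (forall a, a \in D -> f a ^+ 4 <= D4) ->
  \sum_(k < B) (k.+1%:R)^-1 <= l ->
  \sum_(a in D) f a ^+ 6 <= D4 * (2 * Q * l) + (2 * Q / B%:R) ^+ 2 * Q2.
Proof.
move=> f0 B0 Q0 D40 hY hQ2 hD4 hl.
have BR : 0 < B%:R :> R by rewrite ltr0n.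
pose X := [set a in D | 2 * Q / B%:R < f a ^+ 2].
have XD : X \subset D by apply/subsetP => a; rewrite inE => /andP[].
have small (Y : {set T}) : Y \subset D -> (#|Y| <= B)%N ->
    (\sum_(a in Y) f a) ^+ 2 <= 2 * Q * #|Y|%:R.
  move=> YD YB; apply: le_trans (hY Y YD) _.
  have h : #|Y|%:R / B%:R <= 1 :> R by rewrite ler_pdivrMr // mul1r ler_nat.
  have : #|Y|%:R * (1 + #|Y|%:R / B%:R) <= #|Y|%:R * 2 :> R.
    by rewrite ler_wpM2l ?ler0n //; lra.
  by move=> /(ler_wpM2l Q0); lra.
have cardX : (#|X| < B)%N.
  rewrite ltnNge; apply/negP => /exists_subset_card[Y YX cY].
  have [a0 a0Y] : exists x, x \in Y by apply/set0Pn; rewrite -card_gt0 cY.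
  have [a aY amin] := @arg_minP _ _ _ a0 (mem Y) f a0Y.
  have {}aY : a \in Y by [].
  have := small Y (subset_trans YX XD); rewrite cY leqnn => /(_ isT) hsum.
  have le1 : B%:R * f a <= \sum_(b in Y) f b.
    by rewrite mulr_natl -cY -sumr_const; apply: ler_sum => b bY; exact: amin.
  have : (B%:R * f a) ^+ 2 <= 2 * Q * B%:R.
    by apply: le_trans hsum; rewrite lerXn2r ?nnegrE ?mulr_ge0 ?sumr_ge0 // ltW.
  have : a \in X by apply: (subsetP YX).
  rewrite inE => /andP[_]; rewrite ltr_pdivrMr // => lt1.
  rewrite exprMn expr2 -mulrA -[2 * Q * _]mulrC ler_pM2l // leNgt.
  by rewrite [B%:R * _]mulrC lt1.
have sqX : \sum_(a in X) f a ^+ 2 <= 2 * Q * l.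
  apply: le_trans (sum_sqr_harmonic_le f0 (q := 2 * Q) _ _) _.
  - by rewrite mulr_ge0.
  - move=> Y YX; apply: small; first exact: subset_trans YX XD.
    by rewrite (leq_trans (subset_leq_card YX)) // ltnW.
  rewrite ler_wpM2l ?mulr_ge0 //; apply: le_trans hl.
  rewrite (big_ord_widen B (fun k => (k.+1%:R : R)^-1) (ltnW cardX)) big_mkcond /=.
  by apply: ler_sum => k _; case: ifP; rewrite ?invr_ge0 ?ler0n.
have split6 a : f a ^+ 6 = f a ^+ 4 * f a ^+ 2 by rewrite -exprD.
rewrite (bigID (mem X)) /=; apply: lerD.
  apply: (@le_trans _ _ (\sum_(a in X) D4 * f a ^+ 2)); last first.
    by rewrite -mulr_sumr ler_wpM2l.
  rewrite (eq_bigl (mem X)) => [|a]; last first.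
    by rewrite /= andb_idl // => /(subsetP XD).
  apply: ler_sum => a aX; rewrite split6 ler_wpM2r ?sqr_ge0 //.
  by apply: hD4; apply: (subsetP XD).
apply: (@le_trans _ _ (\sum_(a in D) (2 * Q / B%:R) ^+ 2 * f a ^+ 2)); last first.
  by rewrite -mulr_sumr ler_wpM2l ?sqr_ge0.
rewrite big_mkcondr; apply: ler_sum => a aD; case: ifP => [|_]; last first.
  by rewrite mulr_ge0 ?sqr_ge0.
rewrite inE aD /= -leNgt => le1; rewrite split6 ler_wpM2r ?sqr_ge0 //.
rewrite (_ : f a ^+ 4 = (f a ^+ 2) ^+ 2); last by rewrite -exprM.
by rewrite lerXn2r ?nnegrE ?sqr_ge0 // divr_ge0 ?mulr_ge0 ?ler0n.
Qed.

Lemma prod_le_sum_pow (R : realFieldType) (m : nat) (x : 'I_m.+1 -> R) :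
  (forall i, 0 <= x i) -> \prod_i x i <= \sum_i x i ^+ m.+1.
Proof.
move=> x0; have [j _ jmax] := @arg_maxP _ _ _ ord0 xpredT x isT.
apply: (@le_trans _ _ (\prod_(i < m.+1) x j)).
  by apply: ler_prod => i _; rewrite x0 /=; exact: jmax.
rewrite prodr_const card_ord (bigD1 j) //= lerDl.
by apply: sumr_ge0 => i _; rewrite exprn_ge0.
Qed.

Section BilinearSums.
Variables (R : realType) (p s : nat).
Hypotheses (p_pr : prime p) (s0 : (0 < s)%N).
Notation ech := (@ech R p).

Definition bilinear_sum (A : {set 'F_p}) (L : int) (n : nat) (a : 'F_p) : R[i] :=
  \sum_(m in A) power_sum R s L n (a * m).

Variables (A : {set 'F_p}) (L : int) (n : nat).
Hypothesis pt_neq0 : forall i, (i < n)%N -> pt p L i != 0.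
Notation S := (bilinear_sum A L n).

Lemma bilinear_sumE a : S a = \sum_t ech (a * @over_power p A s L n t).
Proof.
rewrite -(pair_bigA _ (fun (i : 'I_#|A|) (k : 'I_n) => ech (a * (enum_val i / pt p L k ^+ s)))) /=.
rewrite /bilinear_sum big_enum_val /=; apply: eq_bigr => i _; apply: eq_bigr => k _.
by rewrite mulrA.
Qed.

Lemma bilinear_sum0 : S 0 = (#|A| * n)%:R.
Proof.
rewrite bilinear_sumE; under eq_bigr => t _ do rewrite mul0r ech0.
by rewrite sumr_const card_prod !card_ord.
Qed.

Lemma cabs_bilinear_sum_le a : cabs (S a) <= (#|A| * n)%:R.
Proof.
rewrite bilinear_sumE; apply: le_trans (cabs_sum _ _ _) _.
under eq_bigr => t _ do rewrite cabs_ech //.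
by rewrite sumr_const card_prod !card_ord.
Qed.

Lemma bilinear_sum_moment2 : \sum_(a : 'F_p) cabs (S a) ^+ 2 = p%:R * (energy A s L n)%:R.
Proof.
under eq_bigr => a _ do rewrite bilinear_sumE.
by rewrite parseval_count // coincidences_over_power.
Qed.

(** Duality: the sums over [A] and over [D] are exchanged, so that Cauchy-
    Schwarz over the elements of [A] and Parseval bring in the energy of [D]. *)
Lemma bilinear_sum_dual_le (D : {set 'F_p}) :
  (\sum_(a in D) cabs (S a)) ^+ 2 <= #|A|%:R * (p%:R * (energy D s L n)%:R).
Proof.
(* The phases that make [S a] nonnegative. *)
pose th a : R[i] := (cabs (S a))%:C%C * (S a)^-1.
have th1 a : cabs (th a) <= 1.
  rewrite /th Normc.normcM Normc.normcV; have [->|Sa] := eqVneq (S a) 0.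
    by rewrite cabs0 invr0 mulr0 ler01.
  have -> : cabs ((cabs (S a))%:C%C) = cabs (S a).
    by apply: complexI; rewrite -!cabsE normr_id.
  by rewrite divff //; apply: contraNneq Sa => /Normc.eq0_normc ->.
have thS a : th a * S a = (cabs (S a))%:C%C.
  have [Sa|Sa] := eqVneq (S a) 0; first by rewrite Sa mulr0 cabs0.
  by rewrite /th mulfVK.
pose G m : R[i] := \sum_(t : 'I_#|D| * 'I_n) th (enum_val t.1) * ech (m * over_power s L t).
have E : (\sum_(a in D) cabs (S a))%:C%C = \sum_(m in A) G m.
  rewrite rmorph_sum /=; under eq_bigr => a _ do rewrite -thS /bilinear_sum mulr_sumr.
  rewrite exchange_big /=; apply: eq_bigr => m _.
  rewrite /G -(pair_bigA _ (fun (i : 'I_#|D|) (k : 'I_n) =>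
    th (enum_val i) * ech (m * (enum_val i / pt p L k ^+ s)))) /=.
  rewrite big_enum_val /=; apply: eq_bigr => i _.
  rewrite /power_sum mulr_sumr; apply: eq_bigr => k _.
  by congr (_ * ech _); rewrite mulrA [_ * m]mulrC.
have bd : \sum_(a in D) cabs (S a) <= \sum_(m in A) cabs (G m).
  apply: le_trans (cabs_sum _ _ _); rewrite -E.
  by rewrite -lecR -cabsE ger0_norm // lecR sumr_ge0 // => a _; exact: cabs_ge0.
apply: (@le_trans _ _ ((\sum_(m in A) cabs (G m)) ^+ 2)).
  by rewrite lerXn2r ?nnegrE ?sumr_ge0 // => a _; exact: cabs_ge0.
have := sum_sqr_le (mem A) (fun _ => 1 : R) (fun m => cabs (G m)).
under eq_bigr => m _ do rewrite mul1r.
rewrite expr1n sumr_const => /le_trans; apply; rewrite ler_wpM2l ?ler0n //.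
apply: (@le_trans _ _ (\sum_(m : 'F_p) cabs (G m) ^+ 2)).
  by rewrite big_mkcond /=; apply: ler_sum => m _; case: ifP; rewrite ?sqr_ge0.
apply: le_trans (parseval_le p_pr _ (fun t => th1 (enum_val t.1))) _.
by rewrite coincidences_over_power.
Qed.

(** Since the elements of [A] are distinct, so are their multiples by [a]; the
    sum over [A] is completed to all frequencies. *)
Lemma bilinear_sum_pow6_le (a : 'F_p) : a != 0 ->
  cabs (S a) ^+ 6 <= #|A|%:R ^+ 5 *
    (p%:R * (coincidences (sum3 (fun i : 'I_n => (pt p L i ^+ s)^-1)))%:R).
Proof.
move=> a0.
apply: (@le_trans _ _ ((\sum_(m in A) cabs (power_sum R s L n (a * m))) ^+ 6)).
  rewrite lerXn2r ?nnegrE ?cabs_ge0 ?sumr_ge0 ?cabs_sum // => m _; exact: cabs_ge0.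
apply: le_trans (power_mean_set_le _ 5 (fun m => cabs_ge0 _)) _.
rewrite ler_wpM2l ?exprn_ge0 ?ler0n // -moment6_eq //.
rewrite [X in _ <= X](reindex_inj (mulfI a0)) big_mkcond /=; apply: ler_sum => m _.
by case: ifP => // _; rewrite exprn_ge0 ?cabs_ge0.
Qed.

End BilinearSums.

Lemma T6_fourier (R : realType) (p s H : nat) (A : 'I_6 -> {set 'F_p}) (L : 'I_6 -> int)
    (lambda : int) : prime p ->
  p%:R * (T6 s H A L lambda)%:R =
  \sum_(a : 'F_p) ech R (- (a * lambda%:~R)) * \prod_(i < 6) bilinear_sum R s (A i) (L i) H a.
Proof.
move=> p_pr.
pose val (m : {ffun 'I_6 -> 'F_p}) (h : {ffun 'I_6 -> 'I_H}) : 'F_p :=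
  \sum_(i < 6) m i / pt p (L i) (h i) ^+ s.
have prodE a : \prod_(i < 6) bilinear_sum R s (A i) (L i) H a =
    \sum_(m in family (fun i => mem (A i))) \sum_(h : {ffun 'I_6 -> 'I_H}) ech R (a * val m h).
  rewrite /bilinear_sum bigA_distr_big_dep /=; apply: eq_bigr => m _.
  rewrite /power_sum bigA_distr_bigA /=; apply: eq_bigr => h _.
  by rewrite -ech_sum // /val mulr_sumr; congr ech; apply: eq_bigr => i _; rewrite mulrA.
under eq_bigr => a _ do rewrite prodE mulr_sumr.
rewrite exchange_big /=.
under eq_bigr => m _ do under eq_bigr => a _ do rewrite mulr_sumr.
under eq_bigr => m _ do rewrite exchange_big /=.
have inner m h : \sum_(a : 'F_p) ech R (- (a * lambda%:~R)) * ech R (a * val m h) =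
    p%:R * (val m h == lambda%:~R)%:R.
  transitivity (\sum_(a : 'F_p) ech R ((val m h - lambda%:~R) * a)).
    by apply: eq_bigr => a _; rewrite -echD //; congr ech; ring.
  by rewrite sum_ech // subr_eq0; case: eqP; rewrite ?mulr1 ?mulr0.
under eq_bigr => m _ do under eq_bigr => h _ do rewrite inner.
under eq_bigr => m _ do rewrite -mulr_sumr.
rewrite -mulr_sumr; congr (_ * _).
rewrite /T6 -(sum1dep_card (fun mh : {ffun 'I_6 -> 'F_p} * {ffun 'I_6 -> 'I_H} =>
  [forall i, mh.1 i \in A i] &&
  (\sum_(i < 6) mh.1 i / (shifted L mh.2 i)%:~R ^+ s == lambda%:~R :> 'F_p))).
rewrite -(pair_big_dep (fun m : {ffun 'I_6 -> 'F_p} => [forall i, m i \in A i])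
  (fun m (h : {ffun 'I_6 -> 'I_H}) =>
    \sum_(i < 6) m i / (shifted L h i)%:~R ^+ s == lambda%:~R) (fun _ _ => 1%N)) /=.
rewrite natr_sum; apply: eq_big => [m|m _]; first by rewrite unfold_in.
rewrite natr_sum big_mkcond /=; apply: eq_bigr => h _.
by rewrite /val; case: ifP => _.
Qed.

(** The frequency [0] gives the main term. A product of six nonnegative numbers
    is at most the sum of their sixth powers, which separates the six variables. *)
Lemma T6_error_le (R : realType) (p s H M : nat) (A : 'I_6 -> {set 'F_p}) (L : 'I_6 -> int)
    (lambda : int) : prime p -> (forall i, #|A i| = M) ->
  `| p%:R * (T6 s H A L lambda)%:R - (M * H)%:R ^+ 6 | <=
  \sum_(i < 6) \sum_(a : 'F_p | a != 0) cabs (bilinear_sum R s (A i) (L i) H a) ^+ 6 :> R.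
Proof.
move=> p_pr cA; rewrite exchange_big /=.
have := T6_fourier R s H A L lambda p_pr; rewrite (bigD1 0) //= mul0r oppr0 ech0 mul1r.
under [X in X + _]eq_bigr => i _ do rewrite bilinear_sum0 cA.
rewrite prodr_const card_ord => /eqP; rewrite addrC -subr_eq => /eqP E.
have -> : `| p%:R * (T6 s H A L lambda)%:R - (M * H)%:R ^+ 6 | =
    cabs (p%:R * (T6 s H A L lambda)%:R - (M * H)%:R ^+ 6 : R[i]).
  apply: complexI; rewrite -cabsE.
  have -> : p%:R * (T6 s H A L lambda)%:R - (M * H)%:R ^+ 6 =
     (p%:R * (T6 s H A L lambda)%:R - (M * H)%:R ^+ 6 : R)%:C%C.
    by rewrite (rmorphB (real_complex R)) (rmorphXn (real_complex R)) (rmorphM (real_complex R))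
      !(rmorph_nat (real_complex R)).
  by rewrite normc_def /= expr0n addr0 sqrtr_sqr.
rewrite E; apply: le_trans (cabs_sum _ _ _) _; apply: ler_sum => a _.
rewrite Normc.normcM cabs_ech // mul1r.
have -> : cabs (\prod_(i < 6) bilinear_sum R s (A i) (L i) H a) =
    \prod_(i < 6) cabs (bilinear_sum R s (A i) (L i) H a).
  by elim/big_rec2: _ => [|i x y _ <-]; rewrite ?cabs1 ?Normc.normcM.
by apply: prod_le_sum_pow => i; exact: cabs_ge0.
Qed.

(** * Bounds in the three ranges of the length of the interval *)

Ltac nonneg := repeat (first [ assumption | by apply: ltW | exact: ler0n | apply: exprn_ge0
  | apply: mulr_ge0 | apply: addr_ge0 | apply: divr_ge0 | exact: ler01 ]).

Section Ranges.
Variables (R : realType) (p s : nat) (A : {set 'F_p}) (L : int) (H B tau : nat) (l T : R).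
Hypotheses (p_pr : prime p) (s0 : (0 < s)%N) (A0 : 0 \notin A).
Hypothesis pt_neq0 : forall i, (i < H)%N -> pt p L i != 0.
Hypotheses (M0 : (0 < #|A|)%N) (H2 : (1 < H)%N) (Hp : (H < p)%N).
Hypotheses (B0 : (0 < B)%N) (BH : (B <= H)%N) (BHp : (B * H <= p)%N) (B4 : (B ^ 4 < p)%N).
Hypotheses (tau0 : (0 < tau)%N) (htau : forall m, (0 < m <= p)%N -> (size (divisors m) <= tau)%N).
Hypotheses (l1 : 1 <= l) (hl : forall k, (k <= p)%N -> \sum_(i < k) (i.+1%:R)^-1 <= l :> R).
Hypotheses (T1 : 1 <= T) (tauT : tau%:R <= T) (lT : l <= T).

Notation S := (bilinear_sum R s A L H).
Notation M := #|A|.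
Let u : R := p%:R.
Let f (a : 'F_p) : R := cabs (S a) / (M * H)%:R.

Definition energy_const : R := 96 * (1 + s%:R).
(** The constant of the duality inequality: for any set [Y] of nonzero
    frequencies, the square of the sum of [f] over [Y] is at most [dual_bound *
    (#|Y| * (1 + #|Y| / B))]. *)
Definition dual_bound : R := energy_const * T ^+ 4 * u / (M * H)%:R.

Let T0 : 0 <= T. Proof. by apply: le_trans T1. Qed.
Let u0 : 0 < u. Proof. by rewrite ltr0n prime_gt0. Qed.
Let MH0 : 0 < (M * H)%:R :> R. Proof. by rewrite ltr0n muln_gt0 M0 ltnW. Qed.
Let MR0 : 0 < M%:R :> R. Proof. by rewrite ltr0n. Qed.
Let HR0 : 0 < H%:R :> R. Proof. by rewrite ltr0n ltnW. Qed.
Let BR0 : 0 < B%:R :> R. Proof. by rewrite ltr0n. Qed.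
Let energy_const0 : 0 <= energy_const. Proof. by rewrite mulr_ge0 // addr_ge0 ?ler0n. Qed.
Let f0 a : 0 <= f a. Proof. by rewrite divr_ge0 ?cabs_ge0 // ltW. Qed.

Lemma energy_pow4_le (X : {set 'F_p}) (L' : int) (n : nat) : 0 \notin X ->
  (forall i, (i < n)%N -> pt p L' i != 0) -> (B <= n)%N -> (B * n <= p)%N ->
  (energy X s L' n)%:R <= energy_const * T ^+ 4 * n%:R * (#|X|%:R * (1 + #|X|%:R / B%:R)).
Proof.
move=> X0 pt0 Bn Bnp.
have Bp : (B.+1 <= p)%N.
  by apply: leq_trans B4; rewrite ltnS -[X in (X <= _)%N]expn1 leq_pexp2l.
have htau' m : (0 < m <= B ^ 2)%N -> (size (divisors m) <= tau)%N.
  move=> /andP[m0 mB]; apply: htau; rewrite m0 (leq_trans mB) //.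
  by apply: leq_trans (ltnW B4); rewrite leq_pexp2l.
apply: le_trans (energy_le p_pr s0 pt0 B0 Bn Bnp B4 X0 tau0 htau' l1 (hl Bp)) _.
rewrite /energy_const; set x := #|X|%:R + _; have x0 : 0 <= x.
  by rewrite /x addr_ge0 ?divr_ge0 ?exprn_ge0 ?ler0n.
have -> : #|X|%:R * (1 + #|X|%:R / B%:R) = x by rewrite /x mulrDr mulr1 mulrA expr2.
have l0 : 0 <= l by apply: le_trans l1.
have s_ge0 : 0 <= s%:R :> R by rewrite ler0n.
have t0 : 0 <= tau%:R :> R by rewrite ler0n.
have h1 : l + s%:R <= T * (1 + s%:R).
  have : 1 * s%:R <= T * s%:R by rewrite ler_wpM2r.
  by rewrite mulrDr mulr1 mul1r => h; apply: lerD.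
have h2 : tau%:R ^+ 2 <= T ^+ 2 by rewrite lerXn2r ?nnegrE.
have h3 : l * (tau%:R ^+ 2 * (l + s%:R) * x) <= T * (T ^+ 2 * (T * (1 + s%:R)) * x).
  apply: ler_pM => //; first by nonneg.
  rewrite ler_wpM2r //; by apply: ler_pM => //; nonneg.
have n0 : 0 <= 96 * n%:R :> R by rewrite mulr_ge0 ?ler0n.
apply: le_trans (ler_wpM2l n0 h3) _.
by rewrite le_eqVlt; apply/orP; left; apply/eqP; ring.
Qed.

(** Both inputs of [sum_pow6_le] are energies: of a set of frequencies, by
    duality, and of [A] itself, by Parseval. *)
Lemma sum_pow6_le_max4 (D4 : R) : 0 <= D4 -> (forall a, a != 0 -> f a ^+ 4 <= D4) ->
  \sum_(a : 'F_p | a != 0) f a ^+ 6 <=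
  D4 * (2 * dual_bound * T) + (2 * dual_bound / B%:R) ^+ 2 * (dual_bound * (1 + M%:R / B%:R)).
Proof.
move=> D40 hD4.
have Q0 : 0 <= dual_bound.
  by apply: divr_ge0 (ltW MH0); apply: mulr_ge0 (ltW u0); exact: mulr_ge0 (exprn_ge0 _ _).
have hY (Y : {set 'F_p}) : Y \subset [set a | a != 0] ->
    (\sum_(a in Y) f a) ^+ 2 <= dual_bound * (#|Y|%:R * (1 + #|Y|%:R / B%:R)).
  move=> Y0; have Y00 : 0 \notin Y.
    by apply/negP => /(subsetP Y0); rewrite inE eqxx.
  have -> : \sum_(a in Y) f a = (\sum_(a in Y) cabs (S a)) / (M * H)%:R by rewrite mulr_suml.
  rewrite expr_div_n ler_pdivrMr ?exprn_gt0 //.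
  apply: le_trans (bilinear_sum_dual_le R s p_pr A pt_neq0 Y) _.
  have h := energy_pow4_le Y00 pt_neq0 BH BHp.
  have Mu : 0 <= M%:R * u by rewrite mulr_ge0 ?ltW.
  rewrite mulrA; apply: le_trans (ler_wpM2l Mu h) _.
  rewrite /dual_bound natrM le_eqVlt; apply/orP; left; apply/eqP.
  by field; rewrite !gt_eqF.
have hQ2 : \sum_(a in [set a : 'F_p | a != 0]) f a ^+ 2 <= dual_bound * (1 + M%:R / B%:R).
  under eq_bigr => a _ do rewrite /f expr_div_n.
  rewrite -mulr_suml ler_pdivrMr ?exprn_gt0 //.
  apply: (@le_trans _ _ (\sum_(a : 'F_p) cabs (S a) ^+ 2)).
    by rewrite big_mkcond; apply: ler_sum => a _; case: ifP; rewrite ?sqr_ge0.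
  rewrite bilinear_sum_moment2 //.
  have := ler_wpM2l (ltW u0) (energy_pow4_le A0 pt_neq0 BH BHp) => /le_trans; apply.
  rewrite /dual_bound natrM le_eqVlt; apply/orP; left; apply/eqP.
  by field; rewrite !gt_eqF.
have hD4' a : a \in [set a : 'F_p | a != 0] -> f a ^+ 4 <= D4 by rewrite inE; exact: hD4.
have Bp : (B <= p)%N.
  by apply: leq_trans (ltnW B4); rewrite -[X in (X <= _)%N]expn1 leq_pexp2l.
have := sum_pow6_le f0 B0 Q0 D40 hY hQ2 hD4' (le_trans (hl Bp) lT).
by under eq_bigl => a do rewrite inE.
Qed.

Lemma f_le_sum a : f a <= (\sum_(m in A) cabs (power_sum R s L H (a * m))) / (M * H)%:R.
Proof. by rewrite ler_pM2r ?invr_gt0 //; exact: cabs_sum. Qed.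

Lemma f_le1 a : f a <= 1.
Proof. by rewrite ler_pdivrMr // mul1r cabs_bilinear_sum_le. Qed.

(** Long intervals: as [f <= 1], the fourth moment of the single sums over [x]
    is enough. *)
Lemma long_range_le :
  \sum_(a : 'F_p | a != 0) f a ^+ 6 <=
  16 * (4 * s ^ 4 + 32 * (2 * s + 3))%:R * T ^+ 4 * (u ^+ 3 / H%:R ^+ 4).
Proof.
set C : R := (4 * s ^ 4 + 32 * (2 * s + 3))%:R.
have C0 : 0 <= C by rewrite ler0n.
apply: (@le_trans _ _ (\sum_(a : 'F_p | a != 0) f a ^+ 4)).
  apply: ler_sum => a _; rewrite (_ : f a ^+ 6 = f a ^+ 4 * f a ^+ 2); last by rewrite -exprD.
  by rewrite ler_piMr ?exprn_ge0 // exprn_ile1 // f_le1.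
have each a : f a ^+ 4 <= (M%:R ^+ 3 * \sum_(m in A) cabs (power_sum R s L H (a * m)) ^+ 4)
    / (M * H)%:R ^+ 4.
  apply: (@le_trans _ _ (((\sum_(m in A) cabs (power_sum R s L H (a * m))) / (M * H)%:R) ^+ 4)).
    rewrite lerXn2r ?nnegrE ?f_le_sum // divr_ge0 ?sumr_ge0 ?ler0n // => m _; exact: cabs_ge0.
  rewrite expr_div_n ler_wpM2r ?invr_ge0 ?exprn_ge0 ?ler0n //.
  exact: (power_mean_set_le _ 3 (fun m => cabs_ge0 _)).
apply: le_trans (ler_sum _ (fun a _ => each a)) _.
rewrite -mulr_suml -mulr_sumr exchange_big /=.
have mom (m : 'F_p) : m \in A -> \sum_(a : 'F_p | a != 0) cabs (power_sum R s L H (a * m)) ^+ 4 <=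
    16 * T ^+ 4 * C * u ^+ 3.
  move=> mA; have m0 : m != 0 by apply: contraNneq A0 => <-.
  apply: (@le_trans _ _ (\sum_(b : 'F_p | b != 0) cabs (power_sum R s L H b) ^+ 4)).
    rewrite [X in _ <= X](reindex_inj (mulIf m0)) /=.
    rewrite le_eqVlt; apply/orP; left; apply/eqP; apply: eq_bigl => a.
    by rewrite mulf_eq0 (negPf m0) orbF.
  apply: le_trans (power_sum_moment4_le p_pr s0 L (ltnW Hp) (hl (leqnn p))) _.
  rewrite -/C -/u ler_wpM2r ?exprn_ge0 ?(ltW u0) // ler_wpM2r //.
  have lT2 : 1 + l <= 2 * T by rewrite mulr2n mulrDl !mul1r lerD.
  have : (1 + l) ^+ 4 <= (2 * T) ^+ 4 by rewrite lerXn2r ?nnegrE ?addr_ge0 ?mulr_ge0 // (le_trans _ l1).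
  by rewrite exprMn (_ : 2 ^+ 4 = 16 :> R) //; ring.
apply: (@le_trans _ _ (M%:R ^+ 3 * (M%:R * (16 * T ^+ 4 * C * u ^+ 3)) / (M * H)%:R ^+ 4)).
  rewrite ler_wpM2r ?invr_ge0 ?exprn_ge0 ?ler0n // ler_wpM2l ?exprn_ge0 ?ler0n //.
  apply: (@le_trans _ _ (\sum_(m in A) (16 * T ^+ 4 * C * u ^+ 3))); first exact: ler_sum.
  by move: (16 * T ^+ 4 * C * u ^+ 3) => w; rewrite sumr_const mulr_natl.
rewrite natrM le_eqVlt; apply/orP; left; apply/eqP.
by field; rewrite !gt_eqF.
Qed.

(** Medium intervals: [power_sum_average_le] with blocks of length [p / H], for
    which the energy of [A] is under control. *)
Lemma medium_range_le (a : 'F_p) : a != 0 -> (B * (p %/ H) <= p)%N -> (B <= p %/ H)%N ->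
  f a ^+ 4 <= 8 * (4 * s%:R ^+ 4 / u ^+ 2 +
    81 * 16 * energy_const * (32 * (2 * s%:R + 3)) * T ^+ 8 * (u ^+ 2 / H%:R ^+ 3 * (1 / M%:R + 1 / B%:R))).
Proof.
move=> a0 BNp BN; set N := (p %/ H)%N.
have N0 : (0 < N)%N := leq_trans B0 BN.
have Np : (N <= p./2)%N.
  rewrite -divn2; apply: leq_div2l => //.
have NH : (N * H <= p)%N := leq_divM _ _.
have NR0 : 0 < N%:R :> R by rewrite ltr0n.
have NHR : N%:R <= u / H%:R by rewrite ler_pdivlMr // -natrM ler_nat.
have pN : u / N%:R <= 2 * H%:R.
  rewrite ler_pdivrMr // -!natrM ler_nat.
  apply: ltnW; apply: leq_trans (ltn_ceil p (ltnW H2)) _.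
  rewrite -/N (_ : 2 * H * N = 2 * N * H)%N; last by ring.
  by rewrite leq_mul2r mul2n -addnn -addn1 leq_add2l N0 orbT.
set E := energy_const * T ^+ 4 * N%:R * (M%:R * (1 + M%:R / B%:R)).
have E_ge (L' : int) : (forall i, (i < N)%N -> pt p L' i != 0) -> (energy A s L' N)%:R <= E.
  by move=> pt0; exact: energy_pow4_le.
have avg := power_sum_average_le p_pr s0 A0 a0 N0 Np E_ge L H (hl (leqnn p)).
set X := \sum_(m in A) cabs (power_sum R s L H (a * m)) in avg.
have X0 : 0 <= X by apply: sumr_ge0 => m _; exact: cabs_ge0.
have fX : f a ^+ 4 <= (u * X) ^+ 4 / (u * (M * H)%:R) ^+ 4.
  rewrite -expr_div_n invfM mulrACA divff ?gt_eqF // mul1r.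
  by apply: lerXn2r; rewrite ?nnegrE ?f0 //; [exact: divr_ge0 X0 (ltW MH0) | exact: f_le_sum].
apply: le_trans fX _; rewrite ler_pdivrMr ?exprn_gt0 ?mulr_gt0 //.
apply: le_trans avg _; rewrite -[X in _ <= X]mulrA ler_wpM2l //.
have B1 : 0 <= 1 + M%:R / B%:R :> R by rewrite addr_ge0 // divr_ge0 ?ler0n.
have E0 : 0 <= E by rewrite !mulr_ge0 ?exprn_ge0 ?ler0n.
rewrite mulrDl; apply: lerD.
  rewrite !natrM le_eqVlt; apply/orP; left; apply/eqP.
  by rewrite -/u; field; rewrite gt_eqF.
have w1 : (H%:R + u / N%:R * l) ^+ 4 <= (3 * H%:R * T) ^+ 4.
  have l0 : 0 <= l by apply: le_trans l1.
  rewrite lerXn2r ?nnegrE ?addr_ge0 ?mulr_ge0 ?divr_ge0 ?invr_ge0 ?ler0n ?(ltW u0) //.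
  have h1 : u / N%:R * l <= 2 * H%:R * T by apply: ler_pM; rewrite ?divr_ge0 ?ler0n ?(ltW u0).
  have h2 : H%:R * 1 <= H%:R * T by rewrite ler_wpM2l ?ler0n.
  lra.
have N3 : N%:R ^+ 3 <= (u / H%:R) ^+ 3 by rewrite lerXn2r ?nnegrE ?divr_ge0 ?ler0n // ltW.
set C4 : R := 32 * (2 * s%:R + 3).
have C40 : 0 <= C4 by rewrite mulr_ge0 // addr_ge0 ?mulr_ge0 ?ler0n.
apply: (@le_trans _ _ ((3 * H%:R * T) ^+ 4 *
    (M%:R ^+ 2 * (energy_const * T ^+ 4 * (M%:R * (1 + M%:R / B%:R))) * C4 * u ^+ 3 * (u / H%:R) ^+ 3))).
  apply: ler_pM => //; first by rewrite exprn_ge0 // addr_ge0 ?mulr_ge0 ?divr_ge0 ?invr_ge0 ?ler0n ?(ltW u0) // (le_trans _ l1).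
    by rewrite !mulr_ge0 ?exprn_ge0 ?ler0n.
  rewrite (_ : _ * E * _ = M%:R ^+ 2 * (energy_const * T ^+ 4 * (M%:R * (1 + M%:R / B%:R))) * C4 * u ^+ 3 * N%:R ^+ 3).
    by rewrite ler_wpM2l // !mulr_ge0 ?exprn_ge0 ?ler0n // ltW.
  by rewrite /E /C4 /u !natrM ?natrX natrD natrM; ring.
have -> : 81 * 16 * energy_const * C4 * T ^+ 8 * (u ^+ 2 / H%:R ^+ 3 * (1 / M%:R + 1 / B%:R)) *
    (u * (M * H)%:R) ^+ 4 = 16 * ((3 * H%:R * T) ^+ 4 *
    (M%:R ^+ 2 * (energy_const * T ^+ 4 * (M%:R * (1 + M%:R / B%:R))) * C4 * u ^+ 3 * (u / H%:R) ^+ 3)).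
  by rewrite natrM; field; rewrite !gt_eqF.
rewrite -[X in X <= _]mul1r ler_wpM2r //; last by lra.
by rewrite !mulr_ge0 ?exprn_ge0 ?ler0n // ?divr_ge0 ?ler0n // ltW.
Qed.

(** Short intervals: the sixth moment of the sums over [x], where [n'] is the
    length after the shifts by [u v]. *)
Lemma short_range_le (U : nat) (a : 'F_p) : a != 0 -> (3 < p)%N -> (0 < U)%N ->
  (U ^ 2 <= H)%N -> (4 * H ^ 3 <= p ^ 2)%N ->
  f a ^+ 6 <= 24 ^+ 5 * (5 * s%:R + 18) * T ^+ 5 * (u / (M%:R * U%:R ^+ 3)).
Proof.
move=> a0 p3 U0 UH Hp3; set n' := (H + U ^ 2)%N.
have n'H : (n' <= 2 * H)%N by rewrite /n' mul2n -addnn leq_add2l.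
have UU : (U <= U ^ 2)%N by rewrite -[X in (X <= _)%N]expn1 leq_pexp2l.
have Un' : (U <= n')%N by apply: leq_trans UU (leq_addl _ _).
have UnP : (U * n' <= p)%N.
  rewrite -(@leq_exp2r _ _ 2) //; apply: leq_trans Hp3; rewrite expnMn.
  apply: (@leq_trans (H * (2 * H) ^ 2)%N); first by rewrite leq_mul // leq_exp2r.
  by apply: eq_leq; ring.
have Up : (U < p)%N by apply: leq_ltn_trans Hp; apply: leq_trans UH.
have htauU m : (0 < m <= U)%N -> (size (divisors m) <= tau)%N.
  by move=> /andP[m0 mU]; apply: htau; rewrite m0 (leq_trans mU) // ltnW.
set J := coincidences (sum3 (fun i : 'I_H => (pt p L i ^+ s)^-1)).
have UR0 : 0 < U%:R :> R by rewrite ltr0n.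
have JU : J%:R * U%:R ^+ 12 <= (24 * H%:R * (U%:R * T)) ^+ 5 * ((5 * s%:R + 18) * (H%:R * U%:R ^+ 4)).
  have := moment6_coincidences_le R p_pr s0 L U0 Up p3 UnP Un' htauU.
  rewrite -/J -/n' -(ler_nat R) natrM natrX => /le_trans; apply.
  move: (n') n'H => k kH; rewrite natrM; apply: ler_pM; rewrite ?ler0n //.
    rewrite natrX lerXn2r ?nnegrE ?ler0n ?mulr_ge0 ?ler0n // !natrM.
    apply: ler_pM; rewrite ?mulr_ge0 ?ler0n //.
      have -> : 24 * H%:R = 12 * (2 * H%:R) :> R by ring.
      by rewrite ler_wpM2l ?ler0n // -natrM ler_nat.
    by rewrite ler_wpM2l ?ler0n.
  rewrite natrD (natrM _ _ (U ^ 3)) (natrM _ _ (U ^ 6)) !natrX natrM natrM natrD natrM.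
  have h1 : k%:R <= 2 * H%:R :> R by rewrite -natrM ler_nat.
  have h2 : U%:R ^+ 2 <= H%:R :> R by rewrite -natrX ler_nat.
  have h3 : 6 * (k%:R * U%:R) * U%:R ^+ 3 <= 12 * (H%:R * U%:R ^+ 4) :> R.
    have : k%:R * U%:R ^+ 4 <= 2 * H%:R * U%:R ^+ 4 :> R by rewrite ler_wpM2r ?exprn_ge0 ?ler0n.
    rewrite (_ : 6 * (k%:R * U%:R) * U%:R ^+ 3 = 6 * (k%:R * U%:R ^+ 4) :> R); last by ring.
    by move=> h; lra.
  have h4 : (5 * s%:R + 6) * U%:R ^+ 6 <= (5 * s%:R + 6) * (H%:R * U%:R ^+ 4) :> R.
    rewrite ler_wpM2l ?addr_ge0 ?mulr_ge0 ?ler0n //.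
    by have := ler_wpM2r (exprn_ge0 4 (ler0n R U)) h2; rewrite -exprD.
  rewrite (_ : (5 * s%:R + 18) * _ = 12 * (H%:R * U%:R ^+ 4) + (5 * s%:R + 6) * (H%:R * U%:R ^+ 4)).
    exact: lerD h3 h4.
  by ring.
have pow6 := bilinear_sum_pow6_le R s p_pr A L H a0; rewrite -/J in pow6.
rewrite expr_div_n ler_pdivrMr ?exprn_gt0 //; apply: le_trans pow6 _.
have U12 : 0 < U%:R ^+ 12 :> R by rewrite exprn_gt0.
rewrite -(ler_pM2r U12).
have Mu : 0 <= M%:R ^+ 5 * u by rewrite mulr_ge0 ?exprn_ge0 ?ler0n // ltW.
rewrite mulrA -[X in X <= _]mulrA; apply: le_trans (ler_wpM2l Mu JU) _.
rewrite natrM le_eqVlt; apply/orP; left; apply/eqP.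
by field; rewrite !gt_eqF.
Qed.

End Ranges.

(** * Exponents of the prime *)

(** Divisor functions and logarithms are smaller than any power of [p]. The
    [k]-th powers of both are [O(p)], for [k] as large as we please. *)
Lemma divisor_log_factor (R : realType) (eta : R) : 0 < eta -> exists C : R, 1 <= C /\
  forall p : nat, (0 < p)%N -> exists (tau : nat) (l : R),
   [/\ (0 < tau)%N, forall m, (0 < m <= p)%N -> (size (divisors m) <= tau)%N, 1 <= l,
       forall k, (k <= p)%N -> \sum_(i < k) (i.+1%:R)^-1 <= l
     & tau%:R <= C * p%:R `^ eta /\ l <= C * p%:R `^ eta].
Proof.
move=> eta0; set k := (Num.truncn eta^-1).+1.
have k0 : (0 < k)%N by [].
have keta : 1 <= eta * k%:R.
  by rewrite -ler_pdivrMl // mulr1 ltW // truncnS_gt.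
have [C1 [C10 hC1]] := divisors_bound k0.
pose C : R := (C1 + k)%:R.
have C_ge1 : 1 <= C by rewrite /C ler1n addn_gt0 C10.
exists C; split => // p p0.
have u1 : 1 <= p%:R :> R by rewrite ler1n.
set P := p%:R `^ eta.
have P0 : 0 <= P := powR_ge0 _ _.
have uP : p%:R <= P ^+ k.
  by rewrite -powR_mulrn ?powR_ge0 // -powRrM le1r_powR.
have root (x : nat) (c : nat) : (c <= C1 + k)%N -> (x ^ k <= c ^ k * p)%N -> x%:R <= C * P.
  move=> cC xp; rewrite -(@ler_pXn2r _ k) ?nnegrE ?mulr_ge0 ?ler0n // exprMn.
  rewrite -(ler_nat R) natrX natrM natrX in xp; apply: le_trans xp _.
  by apply: ler_pM; rewrite ?exprn_ge0 ?ler0n // lerXn2r ?nnegrE ?ler0n // ler_nat.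
set tau := \max_(m < p.+1) size (divisors m).
have htau m : (0 < m <= p)%N -> (size (divisors m) <= tau)%N.
  move=> /andP[m0 mp].
  by have := @leq_bigmax _ (fun i : 'I_p.+1 => size (divisors i)) (Ordinal (mp : (m < p.+1)%N)).
have tau0 : (0 < tau)%N by apply: leq_trans (htau 1%N _); rewrite ?p0.
exists tau, (trunc_log 2 p).+1%:R; split => //; first by rewrite ler1n.
  move=> j jp; apply: le_trans (harmonic_le_log R j) _.
  by rewrite ler_nat ltnS leq_trunc_log.
split; last by apply: (root _ k); rewrite ?leq_addl ?trunc_log_bound.
have [i ->] : {i : 'I_p.+1 | tau = size (divisors i)}.
  by apply: (@bigop.eq_bigmax _ (fun i : 'I_p.+1 => size (divisors i))); rewrite card_ord.
have [i0|i0] := posnP i.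
  rewrite i0 (_ : size (divisors 0) = 1%N) //; apply: (root _ 1%N); last by rewrite !exp1n mul1n.
  by rewrite addn_gt0 C10.
apply: (root _ C1); first exact: leq_addr.
apply: leq_trans (hC1 i i0) _; apply: leq_mul; last by rewrite -ltnS.
by rewrite -[X in (X <= _)%N]expn1 leq_pexp2l.
Qed.

Section Powers.
Variables (R : realType) (u : R).
Hypothesis u1 : 1 < u.
Notation P x := (u `^ x).

Let u0 : 0 < u. Proof. exact: lt_trans u1. Qed.

Lemma pow_gt0 x : 0 < P x. Proof. exact: powR_gt0. Qed.

Lemma pow_ge0 x : 0 <= P x. Proof. exact: powR_ge0. Qed.

Lemma powD x y : P (x + y) = P x * P y.
Proof. by rewrite powRD //; apply/implyP => _; rewrite gt_eqF. Qed.

Lemma powX x n : P x ^+ n = P (n%:R * x).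
Proof. by rewrite -powR_mulrn ?powR_ge0 // -powRrM mulrC. Qed.

Lemma pow_le x y : (P x <= P y) = (x <= y).
Proof. by rewrite -[LHS]ler_ln ?posrE ?pow_gt0 // !ln_powR ler_pM2r // ln_gt0. Qed.

Lemma pow_lt x y : (P x < P y) = (x < y).
Proof. by rewrite !ltNge pow_le. Qed.

Lemma pow_log x : 0 < x -> x = P (ln x / ln u).
Proof.
move=> x0; apply: ln_inj; rewrite ?posrE ?pow_gt0 //.
by rewrite ln_powR divfK // gt_eqF // ln_gt0.
Qed.

(** The last term of [sum_pow6_le_max4], when [dual_bound] is [C u ^ q] and [A]
    has [u ^ m] elements. *)
Lemma tail_pow_le (q m b e C Bn : R) : 0 <= C -> P b / 2 <= Bn ->
  3 * q - 2 * b <= e -> 3 * q + m - 3 * b <= e ->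
  (2 * (C * P q) / Bn) ^+ 2 * (C * P q * (1 + P m / Bn)) <= 48 * C ^+ 3 * P e.
Proof.
move=> C0 hB e1 e2.
have Bn0 : 0 < Bn by apply: lt_le_trans hB; rewrite divr_gt0 ?pow_gt0.
have iB0 : 0 <= Bn^-1 by rewrite invr_ge0 ltW.
have iB : Bn^-1 <= 2 * P (- b).
  by rewrite powRN -[2 * _]invrK lef_pV2 ?posrE ?invr_gt0 ?mulr_gt0 ?invr_gt0 ?pow_gt0 // invfM invrK mulrC.
have iB2 : Bn^-1 ^+ 2 <= 4 * P (- 2 * b).
  have -> : 4 * P (- 2 * b) = (2 * P (- b)) ^+ 2.
    by rewrite exprMn powX; congr (_ * P _); ring.
  by rewrite lerXn2r ?nnegrE // mulr_ge0 ?pow_ge0.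
have iB3 : Bn^-1 ^+ 3 <= 8 * P (- 3 * b).
  have -> : 8 * P (- 3 * b) = (2 * P (- b)) ^+ 3.
    by rewrite exprMn powX; congr (_ * P _); ring.
  by rewrite lerXn2r ?nnegrE // mulr_ge0 ?pow_ge0.
have -> : (2 * (C * P q) / Bn) ^+ 2 * (C * P q * (1 + P m / Bn)) =
   4 * C ^+ 3 * (P q ^+ 3 * Bn^-1 ^+ 2) + 4 * C ^+ 3 * (P q ^+ 3 * (P m * Bn^-1 ^+ 3)).
  by ring.
have -> : 48 * C ^+ 3 * P e = 4 * C ^+ 3 * (4 * P e) + 4 * C ^+ 3 * (8 * P e) by ring.
have C3 : 0 <= 4 * C ^+ 3 by rewrite mulr_ge0 ?exprn_ge0.
rewrite powX; apply: lerD; apply: ler_wpM2l => //.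
  apply: le_trans (ler_wpM2l (pow_ge0 _) iB2) _.
  by rewrite mulrCA -powD ler_wpM2l // pow_le; lra.
apply: le_trans (ler_wpM2l (pow_ge0 _) (ler_wpM2l (pow_ge0 _) iB3)) _.
rewrite [P m * (8 * _)]mulrCA [P _ * (8 * _)]mulrCA -!powD ler_wpM2l // pow_le.
by lra.
Qed.

Lemma fourth_from_sixth (f K y : R) : 0 <= f -> 0 <= K -> f ^+ 6 <= K * P y ->
  f ^+ 4 <= (1 + K) * P (2 / 3 * y).
Proof.
move=> f0 K0 h; have K1 : 0 <= 1 + K by rewrite addr_ge0.
rewrite -(@ler_pXn2r _ 3) ?nnegrE ?mulr_ge0 ?exprn_ge0 ?pow_ge0 //.
rewrite -exprM (_ : (4 * 3 = 6 * 2)%N) // exprM [X in _ <= X]exprMn [P _ ^+ 3]powX.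
apply: (@le_trans _ _ ((K * P y) ^+ 2)).
  by rewrite lerXn2r ?nnegrE ?mulr_ge0 ?exprn_ge0 ?pow_ge0.
rewrite [X in X <= _]exprMn [P _ ^+ 2]powX (_ : 3%:R * (2 / 3 * y) = 2%:R * y); last by field.
rewrite ler_wpM2r ?pow_ge0 //.
apply: (@le_trans _ _ ((1 + K) ^+ 2)); first by rewrite lerXn2r ?nnegrE // lerDr.
by rewrite [X in _ <= X]exprS ler_peMl ?exprn_ge0 // lerDl.
Qed.

End Powers.

(** Here [p ^ h], [p ^ m] and [p ^ b] are the sizes of the interval, of [A] and
    of the parameter [B]. For [h] below [5 / 12] the second bound needs the
    condition with [9 / 5], beyond that the one with [6 / 5]. *)
Lemma tail_exponents (R : realFieldType) (h m b e sig : R) : 0 < sig -> sig <= e -> sig <= 1 / 50 ->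
  0 <= m -> 1 + e < 9 / 5 * h + 2 / 5 * m -> 1 + e < 6 / 5 * h + m -> h <= 19 / 25 ->
  b = Num.min (1 / 4) (1 - h) ->
  3 * (1 - m - h) - 2 * b <= - sig /\ 3 * (1 - m - h) + m - 3 * b <= - sig.
Proof. by move=> *; subst b; rewrite /Num.min /Order.min; case: ltP => *; split; lra. Qed.

(** One bound for each of the three terms of [medium_range_le], multiplied by
    [dual_bound]. *)
Lemma medium_exponents (R : realFieldType) (h m b e sig : R) : 0 < sig -> sig <= e -> sig <= 1 / 50 ->
  0 <= m -> 1 + e < 6 / 5 * h + m -> 65 / 100 <= h -> h <= 19 / 25 ->
  b = Num.min (1 / 4) (1 - h) ->
  [/\ 1 - m - h - 2 <= - sig, 1 - m - h + (2 - 3 * h - m) <= - sig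
    & 1 - m - h + (2 - 3 * h - b) <= - sig].
Proof. by move=> *; subst b; rewrite /Num.min /Order.min; case: ltP => *; split; lra. Qed.

Section OneInterval.
Variables (R : realType) (s : nat) (eps : R).
Hypotheses (s0 : (0 < s)%N) (eps0 : 0 < eps).

(* [sig] is the saving in the exponents without divisors and logarithms; each
   factor [p ^ eta] bounds one of these, and at most 13 of them occur. *)
Let sig : R := Num.min eps (1 / 50).
Let eta : R := sig / 30.
Let dl : R := sig / 2.

Let sig_gt0 : 0 < sig. Proof. by rewrite lt_min eps0 divr_gt0. Qed.
Let sig_eps : sig <= eps. Proof. by rewrite ge_min lexx. Qed.
Let sig_50 : sig <= 1 / 50. Proof. by rewrite ge_min lexx orbT. Qed.

Definition dual_const (C : R) : R := energy_const R s * C ^+ 4.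
Definition tail_const (C : R) : R := 48 * dual_const C ^+ 3.
Definition short_const (C : R) : R := 24 ^+ 5 * (5 * s%:R + 18) * C ^+ 5 * 8.
Definition medium_const (C : R) : R := 8 * (81 * 16 * energy_const R s * (32 * (2 * s%:R + 3))) * C ^+ 8.
Definition long_const (C : R) : R := 16 * (4 * s ^ 4 + 32 * (2 * s + 3))%:R * C ^+ 4.

Section LargePrime.
Variables (p : nat) (A : {set 'F_p}) (L : int) (H tau : nat) (l C : R).
Let u : R := p%:R.
Notation P x := (u `^ x).
Hypotheses (p_pr : prime p) (u_large : 4 <= P (1 / 20)).
Hypotheses (A0 : 0 \notin A) (M0 : (0 < #|A|)%N) (H0 : (0 < H)%N) (Hp : (H < p)%N).
Hypothesis pt_neq0 : forall i, (i < H)%N -> pt p L i != 0.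
Hypotheses (C1 : 1 <= C) (tau0 : (0 < tau)%N).
Hypothesis htau : forall m, (0 < m <= p)%N -> (size (divisors m) <= tau)%N.
Hypotheses (l1 : 1 <= l) (hl : forall k, (k <= p)%N -> \sum_(i < k) (i.+1%:R)^-1 <= l :> R).
Hypotheses (tauC : tau%:R <= C * P eta) (lC : l <= C * P eta).

Let u1 : 1 < u. Proof. by rewrite ltr1n prime_gt1. Qed.
Let u0 : 0 < u. Proof. exact: lt_trans u1. Qed.
Let h : R := ln H%:R / ln u.
Let m : R := ln #|A|%:R / ln u.
Let T : R := C * P eta.

Hypotheses (c2 : 1 + eps < 9 / 5 * h + 2 / 5 * m) (c3 : 1 + eps < 6 / 5 * h + m).

Let HE : H%:R = P h. Proof. by apply: pow_log => //; rewrite ltr0n. Qed.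
Let ME : #|A|%:R = P m. Proof. by apply: pow_log => //; rewrite ltr0n. Qed.
Let uE : u = P 1. Proof. by rewrite powRr1 // ltW. Qed.
Let m_ge0 : 0 <= m. Proof. by rewrite -(pow_le u1) -ME powRr0 ler1n. Qed.
Let m_le1 : m <= 1.
Proof.
rewrite -(pow_le u1) -ME -uE ler_nat.
by apply: leq_trans (max_card _) _; rewrite card_Fp.
Qed.
Let h_ge : 1 / 3 <= h.
Proof. by move: c2 m_le1 eps0 => *; lra. Qed.
Let C0 : 0 <= C. Proof. exact: le_trans C1. Qed.
Let T1 : 1 <= T. Proof. exact: le_trans lC. Qed.
Let eta0 : 0 < eta. Proof. by rewrite divr_gt0. Qed.

Let H_gt1 : (1 < H)%N.
Proof.
rewrite -(ltr_nat R) HE -[1%:R](powRr0 u) pow_lt //.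
by move: h_ge => *; lra.
Qed.

Let b : R := Num.min (1 / 4) (1 - h).

(** The largest [B] with [B ^ 4 < p] and [B <= p / H]. It does not exceed [H]
    because the condition with [9 / 5] and [m <= 1] force [h >= 1 / 3]. *)
Lemma exists_fraction_height : exists B : nat,
  [/\ (0 < B)%N, (B <= p %/ H)%N, (B <= H)%N, (B ^ 4 < p)%N & P b / 2 <= B%:R].
Proof.
have [t /andP[t1 t2]] := exists_sqrtn p.-1.
have [r /andP[r1 r2]] := exists_sqrtn t.
have p1 : (1 < p)%N := prime_gt1 p_pr.
have r4 : (r ^ 4 < p)%N.
  rewrite -(prednK (ltnW p1)) ltnS (_ : 4 = 2 * 2)%N // expnM.
  by apply: leq_trans t1; rewrite leq_exp2r.
have r4' : (p <= r.+1 ^ 4)%N.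
  rewrite -(prednK (ltnW p1)) (_ : 4 = 2 * 2)%N // expnM.
  by apply: leq_trans t2 _; rewrite leq_exp2r.
have r0 : (0 < r)%N.
  case: r r1 r2 r4 r4' => // _ _ _; rewrite exp1n => h1.
  by move: (leq_trans p1 h1).
have N0 : (0 < p %/ H)%N by rewrite divn_gt0 // ltnW.
(* [r] is the integer part of the fourth root of [p - 1]. *)
exists (minn r (p %/ H)); split.
- by rewrite leq_min r0.
- exact: geq_minr.
- apply: leq_trans (geq_minl _ _) _; rewrite -(@leq_exp2r _ _ 4) //.
  apply: leq_trans (ltnW r4) _; rewrite -(ler_nat R) natrX HE powX -/u [X in X <= _]uE pow_le //.
  by move: h_ge => *; lra.
- by apply: leq_ltn_trans r4; rewrite leq_exp2r // geq_minl.
have half (x : nat) (y : R) : (0 < x)%N -> y <= x.+1%:R -> y / 2 <= x%:R.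
  move=> x0 yx; have : 1 <= x%:R :> R by rewrite ler1n.
  by move: yx; rewrite -natr1 => *; lra.
rewrite natr_min le_min; apply/andP; split.
  apply: half => //; rewrite -(@ler_pXn2r _ 4) ?nnegrE ?ler0n ?powR_ge0 // powX.
  apply: (@le_trans _ _ u); last by rewrite -natrX ler_nat.
  rewrite [X in _ <= X]uE pow_le //; have : b <= 1 / 4 by rewrite ge_min lexx.
  by move=> ?; lra.
apply: half => //; apply: (@le_trans _ _ (P (1 - h))).
  by rewrite pow_le // ge_min lexx orbT.
rewrite powD // powRN -uE -HE ler_pdivrMr ?ltr0n // -natrM ler_nat.
exact: ltnW (ltn_ceil _ _).
Qed.

Notation f a := (cabs (bilinear_sum R s A L H a) / (#|A| * H)%:R).
Notation Cq := (dual_const C).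
Let q : R := 4 * eta + 1 - m - h.

Let energy_const0 : 0 <= energy_const R s. Proof. by rewrite mulr_ge0 // addr_ge0 ?ler0n. Qed.
Let Cq0 : 0 <= Cq. Proof. by apply: mulr_ge0; last exact: exprn_ge0. Qed.

Lemma dual_boundE : dual_bound s A H T = Cq * P q.
Proof.
rewrite /dual_bound /dual_const natrM HE ME -[p%:R]/u {1}uE exprMn powX invfM -!powRN.
rewrite (_ : q = 4%:R * eta + (1 + (- m + - h))) ?powD //; last by rewrite /q; ring.
by ring.
Qed.

Lemma sum_pow6_pow_le (D4 : R) : 0 <= D4 -> (forall a, a != 0 -> f a ^+ 4 <= D4) -> h <= 19 / 25 ->
  \sum_(a : 'F_p | a != 0) f a ^+ 6 <=
  D4 * (2 * Cq * C * P (5 * eta + 1 - m - h)) + tail_const C * P (- dl).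
Proof.
move=> D40 hD4 h1; have [B [B0 BN BH B4 hB]] := exists_fraction_height.
have BHp : (B * H <= p)%N by apply: leq_trans (leq_divM p H); rewrite leq_mul2r BN orbT.
apply: le_trans (sum_pow6_le_max4 p_pr s0 A0 pt_neq0 M0 H_gt1 B0 BH BHp B4 tau0 htau l1 hl
  T1 tauC lC D40 hD4) _.
rewrite dual_boundE; apply: lerD.
  rewrite le_eqVlt; apply/orP; left; apply/eqP.
  rewrite /T (_ : 5 * eta + 1 - m - h = q + eta); last by rewrite /q; ring.
  by rewrite powD //; ring.
have [e1 e2] := tail_exponents sig_gt0 sig_eps sig_50 m_ge0 c2 c3 h1 (erefl b).
rewrite ME; apply: (tail_pow_le u1 Cq0 hB).
  by rewrite /q /dl /eta; move: sig_gt0 e1 => *; lra.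
by rewrite /q /dl /eta; move: sig_gt0 e2 => *; lra.
Qed.

(** The exponent of the main term is [5/3 (1 - m - 6/5 h)] up to [eta]. *)
Lemma short_pow_le : (4 * H ^ 3 <= p ^ 2)%N ->
  \sum_(a : 'F_p | a != 0) f a ^+ 6 <=
  (2 * Cq * C * (1 + short_const C) + tail_const C) * P (- dl).
Proof.
move=> Hp3.
have K0 : 0 <= short_const C by rewrite /short_const; nonneg.
have p3 : (3 < p)%N.
  rewrite -(ltr_nat R); apply: (@lt_le_trans _ _ 4); first by rewrite ltr_nat.
  by apply: le_trans u_large _; rewrite -/u [X in _ <= X]uE pow_le //; lra.
have [U /andP[UH UH']] := exists_sqrtn H.
have U0 : (0 < U)%N.
  by case: U UH UH' => // _; rewrite exp1n ltnS leqNgt H0.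
have hU : P (h / 2) / 2 <= U%:R.
  rewrite ler_pdivrMr // -(@ler_pXn2r _ 2) ?nnegrE ?powR_ge0 ?mulr_ge0 ?ler0n // powX.
  rewrite (_ : 2%:R * (h / 2) = h); last by field.
  rewrite -HE -natrM -natrX ler_nat; apply: leq_trans (ltnW UH') _.
  by rewrite leq_exp2r // muln2 -addnn -addn1 leq_add2l.
have iU : (U%:R ^+ 3)^-1 <= 8 * P (- (3 / 2 * h)).
  rewrite powRN -[8 * _]invrK lef_pV2 ?posrE ?invr_gt0 ?mulr_gt0 ?invr_gt0 ?(pow_gt0 u1) ?exprn_gt0 ?ltr0n //.
  rewrite invfM invrK (_ : _ * _ = (P (h / 2) / 2) ^+ 3).
    by rewrite lerXn2r ?nnegrE ?ler0n // divr_ge0 ?powR_ge0.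
  rewrite expr_div_n powX (_ : 3%:R * (h / 2) = 3 / 2 * h); last by field.
  by field.
set y := 5 * eta + 1 - m - 3 / 2 * h.
have D4 a : a != 0 -> f a ^+ 4 <= (1 + short_const C) * P (2 / 3 * y).
  move=> a0; apply: fourth_from_sixth => //.
    by rewrite divr_ge0 ?cabs_ge0 ?ler0n.
  apply: le_trans (short_range_le L p_pr s0 M0 H_gt1 Hp htau T1 tauC a0 p3 U0 UH Hp3) _.
  set c := 24 ^+ 5 * _; have c0 : 0 <= c by rewrite /c; nonneg.
  rewrite invfM ME -powRN -/u {1}uE.
  apply: (@le_trans _ _ (c * T ^+ 5 * (P 1 * (P (- m) * (8 * P (- (3 / 2 * h))))))).
    apply: ler_wpM2l; first by apply: mulr_ge0 c0 (exprn_ge0 _ _); apply: le_trans T1.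
    exact: (ler_wpM2l (powR_ge0 _ _) (ler_wpM2l (powR_ge0 _ _) iU)).
  rewrite /T exprMn powX le_eqVlt; apply/orP; left; apply/eqP.
  rewrite (_ : y = 5%:R * eta + (1 + (- m + - (3 / 2 * h)))) ?powD //; last by rewrite /y; ring.
  by rewrite /short_const -/c; ring.
have h1 : h <= 19 / 25.
  have : h <= 2 / 3.
    have : (H ^ 3 <= p ^ 2)%N by apply: leq_trans Hp3; rewrite leq_pmull.
    rewrite -(ler_nat R) !natrX -/u HE powX -(powR_mulrn 2) ?(ltW u0) // pow_le // => *; lra.
  by move=> *; lra.
have D40 : 0 <= (1 + short_const C) * P (2 / 3 * y) by rewrite mulr_ge0 ?powR_ge0 // addr_ge0.
apply: le_trans (sum_pow6_pow_le D40 D4 h1) _.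
rewrite [X in _ <= X]mulrDl lerD2r.
rewrite (_ : _ * _ = 2 * Cq * C * (1 + short_const C) * (P (2 / 3 * y) * P (5 * eta + 1 - m - h))); last by ring.
rewrite -powD // ler_wpM2l //.
  by apply: mulr_ge0; [apply: mulr_ge0 => //; apply: mulr_ge0 | exact: addr_ge0].
rewrite pow_le // /y /dl /eta; move: sig_gt0 sig_eps c3 => *; lra.
Qed.

Lemma medium_pow_le : (p ^ 2 < 4 * H ^ 3)%N -> h <= 19 / 25 ->
  \sum_(a : 'F_p | a != 0) f a ^+ 6 <=
  (2 * Cq * C * (32 * s%:R ^+ 4 + 3 * medium_const C) + tail_const C) * P (- dl).
Proof.
move=> Hp3 h1; have [B [B0 BN BH B4 hB]] := exists_fraction_height.
(* As [4 <= u ^ (1 / 20)], the complement of the short range is [H ^ 3 > u ^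
   (39 / 20)] at least. *)
have h65 : 65 / 100 <= h.
  rewrite leNgt; apply/negP => hh.
  have : P 2 < P (1 / 20) * P (3%:R * h).
    rewrite -(powX u) // -HE (powR_mulrn 2) ?(ltW u0) //.
    apply: (@lt_le_trans _ _ (4 * H%:R ^+ 3)); last by rewrite ler_wpM2r ?exprn_ge0 ?ler0n.
    by rewrite -!natrX -natrM ltr_nat.
  by rewrite -powD // pow_lt //; lra.
have K0 : 0 <= medium_const C by rewrite /medium_const; nonneg.
have s4 : 0 <= 32 * s%:R ^+ 4 :> R by nonneg.
have BNp : (B * (p %/ H) <= p)%N.
  by apply: leq_trans (leq_divM p H); rewrite mulnC leq_mul2l BH orbT.
set D4 := 32 * s%:R ^+ 4 * P (8 * eta - 2) + medium_const C *
  (P (8 * eta + (2 - 3 * h - m)) + 2 * P (8 * eta + (2 - 3 * h - b))).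
have D40 : 0 <= D4 by rewrite addr_ge0 ?mulr_ge0 ?addr_ge0 ?mulr_ge0 ?powR_ge0.
have hD4 a : a != 0 -> f a ^+ 4 <= D4.
  move=> a0; apply: le_trans (medium_range_le L p_pr s0 A0 M0 H_gt1 B0 B4 tau0 htau l1 hl
    T1 tauC lC a0 BNp BN) _.
  rewrite mulrDr; apply: lerD.
    rewrite [X in X <= _](_ : _ = 32 * s%:R ^+ 4 * P (- 2)); last first.
      by rewrite powRN powR_mulrn ?(ltW u0) // -/u; ring.
    by rewrite ler_wpM2l // pow_le //; move: eta0 => *; lra.
  set c := 81 * 16 * _ * _; have c0 : 0 <= c by rewrite /c; nonneg.
  have iB : 1 / B%:R <= 2 * P (- b).
    rewrite div1r powRN -[2 * _]invrK lef_pV2 ?posrE ?invr_gt0 ?mulr_gt0 ?invr_gt0 ?(pow_gt0 u1) ?ltr0n //.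
    by rewrite invfM invrK mulrC.
  have iM : 1 / #|A|%:R = P (- m) by rewrite ME powRN div1r.
  have uH : p%:R ^+ 2 / H%:R ^+ 3 = P (2 - 3 * h).
    by rewrite powD // powRN HE powX -/u powR_mulrn ?(ltW u0).
  rewrite uH iM; apply: (@le_trans _ _ (8 * (c * T ^+ 8 * (P (2 - 3 * h) * (P (- m) + 2 * P (- b)))))).
    have T8 : 0 <= c * T ^+ 8 by apply: mulr_ge0 c0 (exprn_ge0 _ _); apply: le_trans T1.
    by rewrite ler_wpM2l // (ler_wpM2l T8) // (ler_wpM2l (powR_ge0 _ _)) // lerD2l.
  rewrite /T exprMn powX le_eqVlt; apply/orP; left; apply/eqP.
  rewrite !(powD u1 (8 * eta)) [P (2 - 3 * h - m)](powD u1) [P (2 - 3 * h - b)](powD u1).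
  by rewrite /medium_const -/c; ring.
apply: le_trans (sum_pow6_pow_le D40 hD4 h1) _.
rewrite [X in _ <= X]mulrDl lerD2r.
have [x1 x2 x3] := medium_exponents sig_gt0 sig_eps sig_50 m_ge0 c3 h65 h1 (erefl b).
set e := 5 * eta + 1 - m - h; rewrite /D4.
have shift x : 1 - m - h + x <= - sig -> P (8 * eta + x) * P e <= P (- dl).
  by move=> hx; rewrite -powD // pow_le // /e /dl /eta; move: hx sig_gt0 => *; lra.
rewrite (_ : _ * (2 * Cq * C * P e) = 2 * Cq * C * (32 * s%:R ^+ 4 * (P (8 * eta - 2) * P e) +
    medium_const C * (P (8 * eta + (2 - 3 * h - m)) * P e + 2 * (P (8 * eta + (2 - 3 * h - b)) * P e)))); last by ring.
have CC : 0 <= 2 * Cq * C by apply: mulr_ge0 => //; apply: mulr_ge0.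
rewrite -[X in _ <= X]mulrA; apply: (ler_wpM2l CC); rewrite [X in _ <= X]mulrDl; apply: lerD.
  by apply: (ler_wpM2l s4); apply: shift.
rewrite [3 * medium_const C]mulrC -[X in _ <= X]mulrA; apply: (ler_wpM2l K0).
rewrite (_ : 3 * P (- dl) = P (- dl) + 2 * P (- dl)); last by ring.
by apply: lerD; [exact: shift | apply: ler_wpM2l => //; exact: shift].
Qed.

Lemma long_pow_le : 19 / 25 <= h ->
  \sum_(a : 'F_p | a != 0) f a ^+ 6 <= long_const C * P (- dl).
Proof.
move=> h1; apply: le_trans (long_range_le L p_pr s0 A0 M0 H_gt1 Hp l1 hl T1 lC) _.
rewrite HE -/u -(powR_mulrn 3) ?(ltW u0) // powX /T exprMn powX -powRN -powD //.
rewrite (_ : _ * (C ^+ 4 * _) * _ = long_const C * (P (4%:R * eta) * P (3 + - (4%:R * h)))).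
  rewrite -powD // ler_wpM2l //; first by rewrite /long_const; nonneg.
  by rewrite pow_le // /dl /eta; move: sig_gt0 sig_50 => *; lra.
by rewrite /long_const; ring.
Qed.

End LargePrime.

(** Half of the saving [sig] in the exponents is spent on divisors and
    logarithms. Primes below [4 ^ 20] only affect the constant. *)
Lemma moment6_pow_le : exists K : R, 0 < K /\
  forall (p H : nat) (A : {set 'F_p}) (L : int),
    prime p -> 0 \notin A -> (0 < #|A|)%N -> (0 < H)%N -> (H < p)%N ->
    (forall i, (i < H)%N -> pt p L i != 0) ->
    p%:R `^ (1 + eps) < H%:R `^ (9 / 5) * #|A|%:R `^ (2 / 5) ->
    p%:R `^ (1 + eps) < H%:R `^ (6 / 5) * #|A|%:R ->
    \sum_(a : 'F_p | a != 0) (cabs (bilinear_sum R s A L H a) / (#|A| * H)%:R) ^+ 6 <=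
      K * p%:R `^ (- dl).
Proof.
have eta0 : 0 < eta by rewrite divr_gt0.
have [C [C1 hC]] := divisor_log_factor eta0.
have C0 : 0 <= C by apply: le_trans C1.
have energy_const0 : 0 <= energy_const R s by rewrite mulr_ge0 // addr_ge0 ?ler0n.
have Cq0 : 0 <= dual_const C by apply: mulr_ge0; last exact: exprn_ge0.
have t0 : 0 <= tail_const C by rewrite /tail_const; nonneg.
have k1 : 0 <= 2 * dual_const C * C * (1 + short_const C) by rewrite /short_const; nonneg.
have k2 : 0 <= 2 * dual_const C * C * (32 * s%:R ^+ 4 + 3 * medium_const C).
  by rewrite /medium_const; nonneg.
have k3 : 0 <= long_const C by rewrite /long_const; nonneg.
pose small : R := (4 ^+ 20) ^+ 2.
have sm0 : 0 < small by rewrite !exprn_gt0.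
exists (small + (2 * dual_const C * C * (1 + short_const C)
  + 2 * dual_const C * C * (32 * s%:R ^+ 4 + 3 * medium_const C)
  + tail_const C + long_const C)).
split; first by move: t0 k1 k2 k3 sm0 => *; lra.
move=> p H A L p_pr A0 M0 H0 Hp pt_neq0 c2 c3.
have u1 : 1 < p%:R :> R by rewrite ltr1n prime_gt1.
have u0 : 0 < p%:R :> R := lt_trans ltr01 u1.
have P0 : 0 <= p%:R `^ (- dl) :> R := powR_ge0 _ _.
have weaken (x y : R) : x <= y * p%:R `^ (- dl) -> forall z, y <= z -> x <= z * p%:R `^ (- dl).
  by move=> xy z yz; apply: le_trans xy _; rewrite ler_wpM2r.
have [u_large|u_small] := lerP 4 (p%:R `^ (1 / 20) : R); last first.
  apply: (@weaken _ small); last by move: t0 k1 k2 k3 => *; lra.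
  apply: (@le_trans _ _ (\sum_(a : 'F_p) 1)).
    rewrite big_mkcond; apply: ler_sum => a _; case: ifP => // _.
    rewrite exprn_ile1 // ?divr_ge0 ?cabs_ge0 ?ler0n //.
    by rewrite ler_pdivrMr ?mul1r ?ltr0n ?muln_gt0 ?M0 // cabs_bilinear_sum_le.
  rewrite sumr_const card_Fp // /small.
  apply: (@le_trans _ _ (p%:R ^+ 2 * p%:R `^ (- 1))).
    by rewrite powR_inv1 ?ler0n // expr2 mulfK ?gt_eqF.
  apply: ler_pM; rewrite ?exprn_ge0 ?powR_ge0 //.
    rewrite lerXn2r ?nnegrE ?exprn_ge0 //.
    have -> : p%:R = p%:R `^ (1 / 20) ^+ 20 :> R.
      by rewrite -powR_mulrn ?powR_ge0 // -powRrM (_ : 1 / 20 * 20%:R = 1) ?powRr1 ?(ltW u0) //; field.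
    by rewrite lerXn2r ?nnegrE ?powR_ge0 // ltW.
  by rewrite pow_le // lerN2 /dl; move: sig_50 => *; lra.
have [tau [l [tau0 htau l1 hl [tauC lC]]]] := hC p (prime_gt0 p_pr).
set h := ln H%:R / ln p%:R : R; set m := ln #|A|%:R / ln p%:R : R.
have HE x : H%:R `^ x = p%:R `^ (h * x) :> R by rewrite powRrM /h -pow_log // ltr0n.
have ME x : #|A|%:R `^ x = p%:R `^ (m * x) :> R by rewrite powRrM /m -pow_log // ltr0n.
rewrite HE ME -powD // pow_lt // in c2.
rewrite -[X in _ * X]powRr1 ?ler0n // HE ME -powD // pow_lt // in c3.
have c2' : 1 + eps < 9 / 5 * h + 2 / 5 * m by rewrite mulrC [2 / 5 * m]mulrC.
have c3' : 1 + eps < 6 / 5 * h + m by rewrite mulrC -[m]mulr1.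
have [h1|h1] := lerP (19 / 25) h.
  apply: le_trans (long_pow_le L p_pr A0 M0 H0 Hp C1 l1 hl lC c2' h1) _; apply: ler_wpM2r => //.
  by move: t0 k1 k2 k3 sm0 => *; lra.
have [Hp3|Hp3] := leqP (4 * H ^ 3) (p ^ 2).
  apply: le_trans (short_pow_le p_pr u_large A0 M0 H0 Hp pt_neq0 C1 tau0 htau l1 hl tauC lC c2' c3' Hp3) _; apply: ler_wpM2r => //.
  by move: t0 k1 k2 k3 sm0 => *; lra.
apply: le_trans (medium_pow_le p_pr u_large A0 M0 H0 Hp pt_neq0 C1 tau0 htau l1 hl tauC lC c2' c3' Hp3 (ltW h1)) _; apply: ler_wpM2r => //.
by move: t0 k1 k2 k3 sm0 => *; lra.
Qed.

End OneInterval.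

(** * The range of the variables *)

Lemma pt_neq0_of_range (p H : nat) (L : int) : prime p ->
  (forall x : int, L + 1 <= x <= L + H%:Z -> 1 <= x <= p%:Z - 1) ->
  forall i, (i < H)%N -> pt p L i != 0.
Proof.
move=> p_pr hL i iH; have p0 := prime_gt0 p_pr.
have /andP[x1 xp] : 1 <= L + i.+1%:Z <= p%:Z - 1 by apply: hL; lia.
rewrite /pt; case: (L + i.+1%:Z) x1 xp => // n n1 np.
rewrite -[(Posz n)%:~R]/(n%:R) -(dvdn_pcharf (pchar_Fp p_pr)).
by apply/negP => /dvdn_leq; lia.
Qed.

Lemma length_lt_prime (p H : nat) (L : int) : (0 < p)%N -> (0 < H)%N ->
  (forall x : int, L + 1 <= x <= L + H%:Z -> 1 <= x <= p%:Z - 1) -> (H < p)%N.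
Proof.
move=> p0 H0 hL; have /andP[a1 _] : 1 <= L + 1 <= p%:Z - 1 by apply: hL; lia.
have /andP[_ b1] : 1 <= L + H%:Z <= p%:Z - 1 by apply: hL; lia.
by lia.
Qed.

Theorem theorem1p3 (R : realType) (s : nat) (eps : R) :
  (0 < s)%N -> 0 < eps ->
  exists delta : R, 0 < delta /\ exists c : R, 0 < c /\
  forall (p H M : nat) (A : 'I_6 -> {set 'F_p}) (L : 'I_6 -> int)
    (lambda : int),
    prime p -> (0 < H)%N -> (0 < M)%N ->
    p%:R `^ (1 + eps) < H%:R `^ (24 / 17) * M%:R `^ (11 / 17) ->
    p%:R `^ (1 + eps) < H%:R `^ (9 / 5) * M%:R `^ (2 / 5) ->
    p%:R `^ (1 + eps) < H%:R `^ (6 / 5) * M%:R ->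
    (forall i, 0 \notin A i) ->
    (forall i, #|A i| = M) ->
    (forall i (x : int), L i + 1 <= x <= L i + H%:Z -> 1 <= x <= p%:Z - 1) ->
    exists theta : R,
      (T6 s H A L lambda)%:R
        = H%:R ^+ 6 * M%:R ^+ 6 / p%:R * (1 + theta) /\
      `|theta| <= c * p%:R `^ (- delta).
Proof.
move=> s0 eps0; have [K [K0 hK]] := moment6_pow_le s0 eps0.
exists (Num.min eps (1 / 50) / 2); split; first by rewrite divr_gt0 // lt_min eps0 divr_gt0.
exists (6 * K); split; first by rewrite mulr_gt0.
move=> p H M A L lambda p_pr H0 M0 _ c2 c3 A0 cA hL.
have p0 := prime_gt0 p_pr.
have u0 : 0 < p%:R :> R by rewrite ltr0n.
have HR0 : 0 < H%:R :> R by rewrite ltr0n.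
have MR0 : 0 < M%:R :> R by rewrite ltr0n.
have MH0 : 0 < (M * H)%:R ^+ 6 :> R by rewrite exprn_gt0 // ltr0n muln_gt0 M0.
exists (p%:R * (T6 s H A L lambda)%:R / (M * H)%:R ^+ 6 - 1); split.
  by rewrite natrM; field; rewrite !gt_eqF.
have D1 : 1 = (M * H)%:R ^+ 6 / (M * H)%:R ^+ 6 :> R by rewrite divff ?gt_eqF.
rewrite [X in _ - X]D1 -mulrBl normrM normfV [`|_ ^+ 6|]gtr0_norm // ler_pdivrMr //.
apply: le_trans (T6_error_le R s H L lambda p_pr cA) _.
rewrite -ler_pdivrMr // mulr_suml.
apply: (@le_trans _ _ (\sum_(i < 6) K * p%:R `^ (- (Num.min eps (1 / 50) / 2)))); last first.
  by rewrite sumr_const card_ord -(mulr_natl (K * _) 6) mulrA.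
apply: ler_sum => i _; rewrite mulr_suml.
have := hK p H (A i) (L i) p_pr (A0 i); rewrite cA => hi.
under eq_bigr => a _ do rewrite -expr_div_n.
by apply: hi => //; [exact: length_lt_prime p0 H0 (hL i) | exact: pt_neq0_of_range p_pr (hL i)].
Qed.
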